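(* Let $X=\langle a,b\rangle\langle c,d\rangle$ be an exact bidihedral group, where $\langle a,b\rangle\cong D_{2n}$ and $\langle c,d\rangle\cong D_{2m}$ with $a^n=b^2=1$, $a^b=a^{-1}$, $c^m=d^2=1$, $c^d=c^{-1}$. Then one of the following forms holds. (1) $X=(\langle c,d\rangle\langle a\rangle)\rtimes\langle b\rangle$; (2) $X=(\langle a,b\rangle\langle c\rangle)\rtimes\langle d\rangle$; (3) $X=[(\langle c,d\rangle\langle a^2\rangle)\rtimes\langle b\rangle].\langle a\rangle$; (4) $X=[(\langle a,b\rangle\langle c^4\rangle\rtimes\langle d\rangle).\langle c^2\rangle].\langle c\rangle$.
   Context: All groups are finite. $x^y=y^{-1}xy$. $D_{2n}=\langle a,b\mid a^n=1,\ b^2=1,\ a^b=a^{-1}\rangle$ is the dihedral group of order $2n$, and $D_{2m}=\langle c,d\mid c^m=1,\ d^2=1,\ c^d=c^{-1}\rangle$ the one of order $2m$, with $n,m\ge 2$ (so $D_4\cong C_2\times C_2$ counts as dihedral). A group is bidihedral if it is a product $X=\langle a,b\rangle\langle c,d\rangle$ of two dihedral subgroups; it is an exact bidihedral group if moreover $\langle a,b\rangle\cap\langle c,d\rangle=1$. All products in the displayed forms are products of subgroups of $X$, and writing such a product as a factor in one of the forms includes the assertion that it is a subgroup of $X$. $G\rtimes H$ is the internal semidirect product: $GH$ with $G\unlhd GH$ and $G\cap H=1$. For subgroups $G,H$ of $X$, $A=G.H$ means that $A=GH$ is a subgroup, $G\unlhd A$, and for any element $h\in H$ there exists an integer $\ell$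 such that $h^{\ell}\in G$. In form (4), $\langle a,b\rangle\langle c^4\rangle\rtimes\langle d\rangle$ is the semidirect product of the subgroup $\langle a,b\rangle\langle c^4\rangle$ by $\langle d\rangle$.
   Formalization: Forms (3) and (4) are proved for a suitable reflection: b replaced by some a^i b in (3), d by some c^j d in (4). With b and d fixed the claim fails: in D_8×C_2=⟨r,s⟩×⟨z⟩ take a=rs, b=zr^{-1}s, c=s, d=sz. *)

(* Defs.v *)
From mathcomp Require Import all_boot all_fingroup all_solvable.

Set Implicit Arguments.
Unset Strict Implicit.
Unset Printing Implicit Defensive.

Import GroupScope.

Definition dihedral_gens (gT : finGroupType) (n : nat) (a b : gT) : Prop :=
  [/\ 2 <= n, <<[set a; b]>> \isog [set: 'D_(2 * n)],
      a ^+ n = 1, b ^+ 2 = 1 & a ^ b = a^-1].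

Definition exact_bidihedral (gT : finGroupType) (X : {group gT}) (n m : nat)
    (a b c d : gT) : Prop :=
  [/\ dihedral_gens n a b, dihedral_gens m c d,
      <<[set a; b]>> * <<[set c; d]>> = X
    & <<[set a; b]>> :&: <<[set c; d]>> = 1].

(* A = G.H. Since groups are finite, every integer power of h is a natural    *)
(* power of h, so the exponent may be taken in nat. As in the source, it is   *)
(* not required to be nonzero.                                                *)
Definition dot_product (gT : finGroupType) (G H A : {group gT}) : Prop :=
  [/\ G * H = A, G <| A
    & forall h : gT, h \in H -> exists l : nat, h ^+ l \in G].

(* In the forms below "*" is the product of sets. An equation K ><| L = M     *)
(* with K != 1 and M a group forces K to be a group, so the factors such as   *)
(* <<[set c; d]>> * <[a]> are asserted to be subgroups.                       *)

Definition form1 (gT : finGroupType) (X : {group gT}) (a b c d : gT) : Prop :=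
  (<<[set c; d]>> * <[a]>) ><| <[b]> = X.

Definition form2 (gT : finGroupType) (X : {group gT}) (a b c d : gT) : Prop :=
  (<<[set a; b]>> * <[c]>) ><| <[d]> = X.

(* Forms 3 and 4 depend on which reflection of the dihedral group is called b *)
(* (resp. d), whereas the relations do not determine it: a ^+ i * b satisfies *)
(* the same relations with a and generates the same subgroup. If form3 holds  *)
(* both for b and for a * b, then form1 holds; so forms 3 and 4 can only be   *)
(* claimed for a suitable reflection a ^+ i * b, resp. c ^+ j * d.            *)

Definition form3 (gT : finGroupType) (X : {group gT}) (a b c d : gT) : Prop :=
  exists2 M : {group gT},
    (<<[set c; d]>> * <[a ^+ 2]>) ><| <[b]> = M
    & dot_product M <[a]>%G X.

Definition form4 (gT : finGroupType) (X : {group gT}) (a b c d : gT) : Prop :=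
  exists M N : {group gT},
    [/\ (<<[set a; b]>> * <[c ^+ 4]>) ><| <[d]> = M,
        dot_product M <[c ^+ 2]>%G N
      & dot_product N <[c]>%G X].

(* Main.v *)
(* Write G = <a, b>, H = <c, d>. All forms are statements about homomorphisms
   to Z/2: form (1) says that X has one with a, c, d -> 0 and b -> 1, form (3)
   that the kernel of one with a -> 1 and b, c, d -> 0 again has one of the
   first kind, and so on.

   The key fact is that X always has a subgroup of index 2 containing G or H.
   By induction on |X|: take a maximal subgroup M over a factor, say H, whose
   core R is as large as possible. If R = 1 for every choice, counting the
   orbits of <c> on X / M leaves few possibilities, and the sign of the action
   of X on X / H gives the subgroup. If R = (R :&: G)(R :&: H) is not trivial,
   pass to X / R. Otherwise X / R is dihedral of order 2p with p an odd prime,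
   and the induction hypothesis applies to M. This yields a homomorphism on R,
   and a combination of its conjugates under a is invariant, or else p = 3 and
   R has a smaller normal subgroup T identifying the reflections b and d; such
   subgroups always have a homomorphism with a, c -> 0 and bd -> 1.

   Applied repeatedly, the key fact shows that unless (1) or (2) holds,
   K = <a^2, b><c^2, d> is normal with X / K of order 4, and Hom(K, Z/2) has an
   element nonzero on exactly one of a^2, b, c^2, d, namely on b or on d. The
   action of a and c on Hom(K, Z/2) then decides between (3) and (4). *)

Require Import Defs.
From mathcomp Require Import all_boot all_fingroup all_solvable.
From mathcomp Require Import zify.
Import GroupScope.

Set Implicit Arguments.
Unset Strict Implicit.
Unset Printing Implicit Defensive.

(** * Dihedral subgroups *)

(** The recurrent obstacle is to climb back from a subgroup of index 2: a homomorphism [f] to Z/2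
    extends with value 0 at an outside element [g] once it is [g]-invariant and kills g^2. When g^2
    lies in the subgroup, f + f^g is invariant, and the question is whether it still has the
    required values on rotations and reflections. These are governed by b^a = b a^2: an
    [a]-invariant homomorphism defined at [b] and a^2 kills a^2. Taking the core as large as
    possible serves to compare both factors in one quotient: if G R were proper, a maximal subgroup
    over it would have the same core R, and the orbits of [<[a]>] and [<[c]>] in X / R would give
    two opposite strict inequalities. In the core-free case orbit counts and signs leave one set of
    parameters, order 120 with a subgroup of index 6, as for PGL(2,5) on the projective line; a
    centralizer argument removes it. For p = 3 the sum of three conjugates of a homomorphism is
    invariant, and it agrees with the original wherever that one was already invariant, because 3 is
    odd. *)

Definition dihp (gT : finGroupType) (a b : gT) : Prop :=
  [/\ b \notin <[a]>, b ^+ 2 = 1 & a ^ b = a^-1].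

Fact Dh_key : unit. Proof. by []. Qed.
Definition Dh (gT : finGroupType) (a b : gT) : {group gT} :=
  locked_with Dh_key <<[set a; b]>>%G.

Section Dih.
Variable gT : finGroupType.
Implicit Types (a b x y : gT).

Lemma Dh_unlock a b : Dh a b = <<[set a; b]>>%G.
Proof. by rewrite /Dh unlock. Qed.

Lemma Dh_l a b : a \in Dh a b. Proof. by rewrite Dh_unlock mem_gen // !inE eqxx. Qed.
Lemma Dh_r a b : b \in Dh a b. Proof. by rewrite Dh_unlock mem_gen // !inE eqxx orbT. Qed.
Lemma Dh_sub a b (K : {group gT}) : (Dh a b \subset K) = (a \in K) && (b \in K).
Proof. by rewrite Dh_unlock gen_subG subUset !sub1set. Qed.

Lemma cyc_Dh a b : <[a]> \subset Dh a b.
Proof. by rewrite cycle_subG Dh_l. Qed.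

Lemma dihpV a b : dihp a b -> b^-1 = b.
Proof. by case=> _ b2 _; apply/eqP; rewrite eq_invg_mul -expg2 b2. Qed.

Lemma dihp_norm a b : dihp a b -> b \in 'N(<[a]>).
Proof. by case=> _ _ ab; rewrite -cycle_subG norms_cycle ab groupV cycle_id. Qed.

Lemma dihp_ord a b : dihp a b -> #[b] = 2.
Proof.
case=> Ab b2 _; apply: nt_prime_order => //.
by apply: contraNneq Ab => ->.
Qed.

Lemma DhE a b : dihp a b -> (Dh a b : {set gT}) = <[a]> * <[b]>.
Proof.
move=> dab; rewrite -norm_joinEr ?cycle_subG ?dihp_norm //.
rewrite Dh_unlock /= -joing_idl -joing_idr !genGid.
by rewrite joing_idl joing_idr.
Qed.

Lemma cyc_b a b : dihp a b -> (<[b]> : {set gT}) = [set 1; b].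
Proof.
by move=> dab; apply: cycle2g; apply: dihp_ord dab.
Qed.

Lemma dihp_ti a b : dihp a b -> <[a]> :&: <[b]> = 1.
Proof.
move=> dab; apply/trivgP; rewrite /= (cyc_b dab); apply/subsetP => x; rewrite !inE.
case/andP=> Ax /orP[] // /eqP xb; case: dab; by rewrite -xb Ax.
Qed.

Lemma card_Dh a b : dihp a b -> #|Dh a b| = (#[a] * 2)%N.
Proof.
move=> dab; rewrite (DhE dab) TI_cardMg ?dihp_ti //.
by rewrite -!orderE (dihp_ord dab).
Qed.

Lemma DhP a b x : dihp a b -> x \in Dh a b ->
  (exists i, x = a ^+ i) \/ (exists i, x = a ^+ i * b).
Proof.
move=> dab; rewrite -[x \in _]/(x \in (Dh a b : {set gT})) (DhE dab).
case/mulsgP=> u v /cycleP[i ->]; rewrite (cyc_b dab) !inE.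
by case/orP=> /eqP -> ->; [left | right]; exists i; rewrite ?mulg1.
Qed.

Lemma Dh_refl_conj a b i : dihp a b -> b * a ^+ i = a ^- i * b.
Proof.
move=> dab; case: (dab) => _ _ ab.
have: (a ^+ i) ^ b = a ^- i by rewrite conjXg ab expgVn.
by rewrite conjgE (dihpV dab) => <-; rewrite -!mulgA -expg2; case: dab => _ -> _; rewrite mulg1.
Qed.

Lemma Dh_notin a b i : dihp a b -> (a ^+ i * b \in <[a]>) = false.
Proof. by case=> Ab _ _; rewrite groupMl ?mem_cycle //; apply: negbTE. Qed.

Lemma dihp_refl a b i : dihp a b -> dihp a (a ^+ i * b).
Proof.
move=> dab; case: (dab) => Ab b2 ab; split.
- by rewrite Dh_notin.
- by rewrite expg2 -mulgA [b * _]mulgA Dh_refl_conj // !mulgA mulgV mul1g -expg2.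
- have ai : a ^ (a ^+ i) = a.
    by apply/conjg_fixP/commgP; apply: commuteX.
  by rewrite conjgM ai.
Qed.

Lemma Dh_reflE a b i : dihp a b -> Dh a (a ^+ i * b) = Dh a b.
Proof.
move=> dab; apply/val_inj/eqP; rewrite eqEsubset; apply/andP; split.
  by rewrite Dh_sub Dh_l groupM ?groupX ?Dh_l ?Dh_r.
rewrite Dh_sub Dh_l -{1}[b](mulKg (a ^+ i)).
by rewrite groupM ?groupV ?groupX ?Dh_l ?Dh_r.
Qed.

Lemma dihp_pow a b s : dihp a b -> dihp (a ^+ s) b.
Proof.
case=> Ab b2 ab; split=> //; last by rewrite conjXg ab expgVn.
by apply: contra Ab; apply/subsetP; rewrite cycle_subG mem_cycle.
Qed.

Lemma Dh_pow_sub a b s : Dh (a ^+ s) b \subset Dh a b.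
Proof. by rewrite Dh_sub groupX ?Dh_l ?Dh_r. Qed.

Lemma Dh_out a b x : dihp a b -> x \in Dh a b -> x \notin <[a]> ->
  exists i, x = a ^+ i * b.
Proof.
move=> dab Dx; case: (DhP dab Dx) => [[i ->]|//].
by rewrite mem_cycle.
Qed.

Lemma Dh_norm_cyc a b s : dihp a b -> <[a ^+ s]> <| Dh a b.
Proof.
move=> dab; rewrite /normal cycle_subG groupX ?Dh_l //= Dh_sub.
rewrite (dihp_norm (dihp_pow s dab)) andbT -cycle_subG.
exact: sub_abelian_norm (cycle_abelian a) (cycleX a s).
Qed.

Lemma cyc_norm_Dh a b (B : {group gT}) : dihp a b -> B \subset <[a]> -> B <| Dh a b.
Proof.
move=> dab sBa.
have: cyclic B by apply: cyclicS sBa (cycle_cyclic a).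
case/cyclicP=> y By; move: sBa; rewrite By cycle_subG => /cycleP[i ->].
exact: Dh_norm_cyc.
Qed.

Lemma Dh_sq a b x : dihp a b -> x \in Dh a b -> x ^+ 2 \in <[a]>.
Proof.
move=> dab Dx; case: (DhP dab Dx) => -[i ->]; first by rewrite -expgM mem_cycle.
by case: (dihp_refl i dab) => _ -> _.
Qed.

Lemma Dh_sq_refl a b x : dihp a b -> x \in Dh a b -> x \notin <[a]> -> x ^+ 2 = 1.
Proof.
by move=> dab Dx /(Dh_out dab Dx)[i ->]; case: (dihp_refl i dab).
Qed.

Lemma Dh_out_dihp a b x : dihp a b -> x \in Dh a b -> x \notin <[a]> ->
  dihp a x /\ Dh a x = Dh a b.
Proof.
by move=> dab Dx /(Dh_out dab Dx)[i ->]; split; [apply: dihp_refl | apply: Dh_reflE].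
Qed.

Lemma sub_Dh a b (B : {group gT}) x : dihp a b -> B \subset Dh a b -> x \in B ->
  x \notin <[a]> -> (B : {set gT}) = (B :&: <[a]>) * <[x]> /\ #|B| = (#|B :&: <[a]>| * 2)%N.
Proof.
move=> dab sB Bx Ax.
have [dax DE] := Dh_out_dihp dab (subsetP sB x Bx) Ax.
have E : (B : {set gT}) = (B :&: <[a]>) * <[x]>.
  rewrite group_modr ?cycle_subG // -(DhE dax) DE.
  by apply/esym/setIidPl.
split=> //; rewrite {1}E TI_cardMg -?orderE ?(dihp_ord dax) //.
by rewrite -setIA (dihp_ti dax) (setIidPr (sub1G _)).
Qed.

End Dih.

(** * Exact factorizations and homomorphisms to Z/2 *)

(** Only the relations are kept: [#[a]] may be 1 or 2, so that the notion passes to subgroups <a^s,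
    b><c^t, d> and to quotients, as the inductions require. *)
Definition exact (gT : finGroupType) (X : {group gT}) (a b c d : gT) : Prop :=
  [/\ dihp a b, dihp c d, Dh a b * Dh c d = X & Dh a b :&: Dh c d = 1].

Definition index2 (gT : finGroupType) (K X : {group gT}) : Prop :=
  K \subset X /\ (#|K| * 2 = #|X|)%N.

Definition index2_over (gT : finGroupType) (X : {group gT}) (a b c d : gT) : Prop :=
  exists2 K : {group gT}, index2 K X & (Dh a b \subset K) || (Dh c d \subset K).

(* A homomorphism from K to Z/2; the values of f outside K are irrelevant. *)
Definition hom2 (gT : finGroupType) (K : {set gT}) (f : gT -> bool) : Prop :=
  {in K &, forall x y, f (x * y) = f x (+) f y}.

Section Exact.
Variable gT : finGroupType.
Implicit Types (a b c d x y : gT) (X K L M : {group gT}).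

Lemma exactC X a b c d : exact X a b c d -> exact X c d a b.
Proof.
case=> dab dcd E I; split=> //; last by rewrite setIC.
by rewrite -E; rewrite -(comm_group_setP _) // E groupP.
Qed.

Lemma index2_overC X a b c d : index2_over X a b c d -> index2_over X c d a b.
Proof. by case=> K hK; rewrite orbC; exists K. Qed.

Section Ex.
Variables (X : {group gT}) (a b c d : gT).
Hypothesis hX : exact X a b c d.

Lemma ex_l : Dh a b \subset X.
Proof. by case: hX => _ _ <- _; apply: mulG_subl. Qed.
Lemma ex_r : Dh c d \subset X.
Proof. by case: hX => _ _ <- _; apply: mulG_subr. Qed.
Lemma ex_a : a \in X. Proof. exact: subsetP ex_l _ (Dh_l _ _). Qed.
Lemma ex_b : b \in X. Proof. exact: subsetP ex_l _ (Dh_r _ _). Qed.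
Lemma ex_c : c \in X. Proof. exact: subsetP ex_r _ (Dh_l _ _). Qed.
Lemma ex_d : d \in X. Proof. exact: subsetP ex_r _ (Dh_r _ _). Qed.

Lemma ex_card : #|X| = (#|Dh a b| * #|Dh c d|)%N.
Proof. by case: hX => _ _ <- I; rewrite TI_cardMg. Qed.

Lemma ex_card4 : #|X| = (4 * (#[a] * #[c]))%N.
Proof. by rewrite ex_card; case: hX => dab dcd _ _; rewrite !card_Dh //; lia. Qed.

Lemma ex_dab : dihp a b. Proof. by case: hX. Qed.
Lemma ex_dcd : dihp c d. Proof. by case: hX. Qed.

Lemma ex_gen : (X : {set gT}) = <<[set a; b; c; d]>>.
Proof.
apply/eqP; rewrite eqEsubset gen_subG !subUset !sub1set ex_a ex_b ex_c ex_d !andbT.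
case: hX => _ _ <- _; apply: mul_subG; rewrite Dh_sub;
by rewrite !mem_gen // !inE eqxx ?orbT.
Qed.

Lemma ex_modr M : Dh c d \subset M -> M \subset X ->
  (M : {set gT}) = (Dh a b :&: M) * Dh c d /\ #|M| = (#|Dh a b :&: M| * #|Dh c d|)%N.
Proof.
move=> sHM sMX; case: hX => _ _ E I.
have EM : (M : {set gT}) = (Dh a b :&: M) * Dh c d.
  by rewrite setIC group_modr // E; apply/esym/setIidPl.
split=> //; rewrite {1}EM TI_cardMg // -setIA (setIC M) setIA I.
by rewrite (setIidPl (sub1G _)).
Qed.

Lemma ex_normX (P : {set gT}) : a \in 'N(P) -> b \in 'N(P) -> c \in 'N(P) -> d \in 'N(P) ->
  X \subset 'N(P).
Proof.
by move=> na nb nc nd; rewrite ex_gen gen_subG !subUset !sub1set na nb nc nd.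
Qed.

End Ex.

Lemma exact_reflL X a b c d i : exact X a b c d -> exact X a (a ^+ i * b) c d.
Proof.
case=> dab dcd E I; split; rewrite ?(Dh_reflE i dab) //; exact: dihp_refl.
Qed.

Lemma exact_reflR X a b c d i : exact X a b c d -> exact X a b c (c ^+ i * d).
Proof. by move/exactC/(exact_reflL i)/exactC. Qed.

Lemma ex_modl X a b c d M : exact X a b c d -> Dh a b \subset M -> M \subset X ->
  (M : {set gT}) = (Dh c d :&: M) * Dh a b /\ #|M| = (#|Dh c d :&: M| * #|Dh a b|)%N.
Proof. by move/exactC/ex_modr; apply. Qed.

(** The intersection stays trivial, so the product set already has [4 * (#[a'] * #[c'])] elements,
    and the bound on [#|K|] makes it all of [K]. *)
Lemma exact_sub X K a b c d a' b' c' d' : exact X a b c d ->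
  dihp a' b' -> dihp c' d' -> Dh a' b' \subset Dh a b -> Dh c' d' \subset Dh c d ->
  Dh a' b' \subset K -> Dh c' d' \subset K -> #|K| <= 4 * (#[a'] * #[c']) ->
  exact K a' b' c' d'.
Proof.
case=> _ _ _ I dab dcd sD sE sDK sEK le.
have I' : Dh a' b' :&: Dh c' d' = 1.
  by apply/trivgP; rewrite /= -I; apply: setISS.
split=> //; apply/eqP; rewrite eqEcard mul_subG //= TI_cardMg // !card_Dh //.
by apply: leq_trans le _; lia.
Qed.

Lemma half_norm K X : index2 K X -> K <| X.
Proof.
case=> sK cK; apply: index2_normal => //.
by apply/eqP; rewrite -(eqn_pmul2l (cardG_gt0 K)) Lagrange // cK.
Qed.

End Exact.

(** * Homomorphisms to Z/2: kernels, conjugates and extensions *)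

Section Hom2.
Variable gT : finGroupType.
Implicit Types (a b c d x y : gT) (K L X Y : {group gT}) (f : gT -> bool).

Lemma hom2_1 K f : hom2 K f -> f 1 = false.
Proof. by move=> hf; have := hf 1 1 (group1 K) (group1 K); rewrite mulg1; case: (f 1). Qed.

Lemma hom2V K f x : hom2 K f -> x \in K -> f x^-1 = f x.
Proof.
move=> hf Kx; have := hf x x^-1 Kx (groupVr Kx).
by rewrite mulgV (hom2_1 hf); case: (f x); case: (f _).
Qed.

Lemma hom2X K f x n : hom2 K f -> x \in K -> f (x ^+ n) = odd n && f x.
Proof.
move=> hf Kx; elim: n => [|n IH]; first by rewrite (hom2_1 hf).
by rewrite expgS hf ?groupX //= IH; case: (odd n); case: (f x).
Qed.

Lemma hom2J K f x y : hom2 K f -> x \in K -> y \in K -> f (x ^ y) = f x.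
Proof.
move=> hf Kx Ky; rewrite conjgE !hf ?groupM ?groupV // (hom2V hf Ky).
by case: (f x); case: (f y).
Qed.

Lemma hom2S K L f : L \subset K -> hom2 K f -> hom2 L f.
Proof. by move=> /subsetP s hf x y Lx Ly; apply: hf; apply: s. Qed.

Lemma hom2D K f g : hom2 K f -> hom2 K g -> hom2 K (fun x => f x (+) g x).
Proof.
by move=> hf hg x y Kx Ky; rewrite hf // hg //; case: (f x); case: (f y); case: (g x); case: (g y).
Qed.

Lemma hom2_conj K f g : g \in 'N(K) -> hom2 K f -> hom2 K (fun x => f (x ^ g)).
Proof. by move=> ng hf x y Kx Ky; rewrite conjMg hf ?memJ_norm. Qed.

Lemma hom2_gen K (S : {set gT}) f g : hom2 K f -> hom2 K g -> S \subset K ->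
  K \subset <<S>> -> {in S, f =1 g} -> {in K, f =1 g}.
Proof.
move=> hf hg sSK sKS e x Kx.
have gP : group_set [set x in K | f x == g x].
  apply/group_setP; split; first by rewrite inE group1 (hom2_1 hf) (hom2_1 hg) eqxx.
  move=> u v; rewrite !inE => /andP[Ku /eqP fu] /andP[Kv /eqP fv].
  by rewrite groupM //= hf // hg // fu fv eqxx.
have: x \in Group gP.
  apply: subsetP Kx; apply: subset_trans sKS _; rewrite gen_subG.
  by apply/subsetP=> u Su; rewrite inE (subsetP sSK) // e // eqxx.
by rewrite inE => /andP[_ /eqP].
Qed.

Definition hkset K f := [set x in K | ~~ f x].

Lemma hk_group K f : hom2 K f -> group_set (hkset K f).
Proof.
move=> hf; apply/group_setP; split; first by rewrite inE group1 (hom2_1 hf).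
by move=> u v; rewrite !inE => /andP[Ku /negbTE fu] /andP[Kv /negbTE fv]; rewrite groupM // hf // fu fv.
Qed.

Definition hker K f (hf : hom2 K f) : {group gT} := Group (hk_group hf).

Lemma hkerE K f (hf : hom2 K f) x : (x \in hker hf) = (x \in K) && ~~ f x.
Proof. by rewrite inE. Qed.

Lemma hker_sub K f (hf : hom2 K f) : hker hf \subset K.
Proof. by apply/subsetP=> x; rewrite hkerE => /andP[]. Qed.

Lemma hker_half K f (hf : hom2 K f) x : x \in K -> f x -> index2 (hker hf) K.
Proof.
move=> Kx fx; split; first exact: hker_sub.
have E : (K :\: hker hf : {set gT}) = hker hf :* x.
  apply/setP=> y; rewrite inE mem_rcoset !hkerE negb_and negbK.
  case Ky: (y \in K); last by rewrite groupMr ?groupV // Ky andbF.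
  by rewrite groupM ?groupV //= hf ?groupV // (hom2V hf Kx) fx; case: (f y).
have := cardsID (hker hf) K; rewrite E card_rcoset (setIidPr (hker_sub hf)); move=> <-; by rewrite muln2 addnn.
Qed.

Lemma half_hom2 K L : index2 K L -> hom2 L (fun x => x \notin K).
Proof.
move=> hK x y Lx Ly; have [sK cK] := hK.
case Kx: (x \in K); first by rewrite groupMl.
case Ky: (y \in K); first by rewrite groupMr // Kx.
have iE : #|L : K| = 2.
  by apply/eqP; rewrite -(eqn_pmul2l (cardG_gt0 K)) Lagrange // cK.
have E u : u \in L -> u \notin K -> L :\: K = K :* u.
  by move=> Lu Ku; apply/esym/rcoset_index2; rewrite // inE Ku.
have: y \in K :* x^-1 by rewrite -E ?inE ?Ky ?groupV ?Kx.
rewrite mem_rcoset invgK => yx.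
have xyE : x * y = (y * x) ^ x^-1 by rewrite conjgE invgK !mulgA mulgK.
have nx : x^-1 \in 'N(K) by rewrite groupV (subsetP (normal_norm (half_norm hK))).
by rewrite xyE memJ_norm // yx.
Qed.

Lemma half_notin K L x y : index2 K L -> x \in L -> y \in L -> x \notin K -> y \notin K ->
  x * y \in K.
Proof.
move=> hK Lx Ly Kx Ky; have := half_hom2 hK Lx Ly.
by rewrite Kx Ky /= => /negbFE.
Qed.

Lemma hker_norm K f (hf : hom2 K f) g : g \in 'N(K) -> {in K, forall x, f (x ^ g) = f x} ->
  g \in 'N(hker hf).
Proof.
move=> ng e; rewrite inE; apply/subsetP=> y /imsetP[x].
by rewrite !hkerE => /andP[Kx fx] ->; rewrite memJ_norm // Kx e.
Qed.

Lemma hker_normK K f (hf : hom2 K f) : K \subset 'N(hker hf).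
Proof.
apply/subsetP=> y Ky; apply: hker_norm; first exact: subsetP (normG K) _ Ky.
by move=> x Kx; apply: hom2J hf Kx Ky.
Qed.

Lemma norm_hker K L f (hf : hom2 K f) x g : (forall y, (y \in L) = (y \in K) && ~~ f y) ->
  g \in 'N(K) -> g \in 'N(L) -> x \in K -> f (x ^ g) = f x.
Proof.
move=> LE nK nL Kx; have := memJ_norm x nL; rewrite !LE memJ_norm // Kx /=.
by move/negb_inj.
Qed.

(** Elements of [Y] outside [K] have the form k g with k in [K], and h(k g) = f(k) is the only
    choice with value 0 at [g]. Since (k g)(l g) = k l^(g^-1) g^2, it is multiplicative by the two
    conditions on [f]. *)
Lemma hom2_ext K Y f g : index2 K Y -> g \in Y -> g \notin K -> hom2 K f ->
  {in K, forall x, f (x ^ g) = f x} -> f (g ^+ 2) = false ->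
  exists2 h, hom2 Y h & {in K, h =1 f} /\ h g = false.
Proof.
move=> hK Yg Kg hf inv f2; have nK := half_norm hK.
have ng : g \in 'N(K) by apply: subsetP Yg; apply: normal_norm.
have Y2 : {in Y, forall x, x \notin K -> x * g^-1 \in K}.
  by move=> x Yx Kx; apply: (half_notin hK); rewrite ?groupV.
have invV : {in K, forall x, f (x ^ g^-1) = f x}.
  by move=> x Kx; rewrite -[in RHS](conjgKV g x) inv // memJ_norm ?groupV.
have sK : {subset K <= Y} by apply/subsetP; case: hK.
have Kg2 : g ^+ 2 \in K by rewrite expg2; apply: (half_notin hK).
exists (fun x => if x \in K then f x else f (x * g^-1)).
  move=> x y Yx Yy.
  case Kx: (x \in K); case Ky: (y \in K).
  - by rewrite groupM // hf.
  - have KY := Y2 y Yy (negbT Ky).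
    by rewrite groupMl // Ky -mulgA [LHS]hf.
  - have KX := Y2 x Yx (negbT Kx).
    rewrite groupMr // Kx; have -> : x * y * g^-1 = (x * g^-1) * y ^ g^-1.
      by rewrite conjgE invgK !mulgA mulgKV.
    by rewrite [LHS]hf ?invV ?memJ_norm ?groupV.
  - have KX := Y2 x Yx (negbT Kx); have KY := Y2 y Yy (negbT Ky).
    have Kxy : x * y \in K by apply: (half_notin hK); rewrite ?Kx ?Ky.
    have KYg : (y * g^-1) ^ g^-1 \in K by rewrite memJ_norm ?groupV.
    rewrite Kxy; have -> : x * y = (x * g^-1) * (y * g^-1) ^ g^-1 * g ^+ 2.
      by rewrite conjgE invgK expg2 !mulgA !mulgKV.
    have KM := groupM KX KYg.
    by rewrite (hf _ _ KM Kg2) f2 addbF (hf _ _ KX KYg) invV.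
split=> [x -> // | ]; by rewrite (negbTE Kg) mulgV (hom2_1 hf).
Qed.

End Hom2.

(** * The sign of the action on cosets *)

Section Sign.
Variable gT : finGroupType.
Implicit Types (a b c d x y g : gT) (C K L M X Y : {group gT}).

Definition cosorb (M X C : {set gT}) := [set orbit 'Rs C A | A in rcosets M X].

(** The sign of the permutation induced by [x] on the cosets of [M]: a permutation of n points with
    k cycles is odd when n + k is odd. *)
Definition sgX M X x := odd (#|X : M| + #|cosorb M X <[x]>|).

Lemma acts_cos M X C : C \subset X -> [acts C, on rcosets M X | 'Rs].
Proof.
move=> sCX; apply/actsP=> x /(subsetP sCX) Xx A /=; apply/rcosetsP/rcosetsP=> -[y Xy].
  move=> E; exists (y * x^-1); first by rewrite groupM ?groupV.
  by rewrite rcosetM -E rcosetE rcosetK.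
by move=> ->; exists (y * x); rewrite ?groupM // rcosetE rcosetM.
Qed.

Let p M X x : {perm {set gT}} := restr_perm (rcosets M X) (actperm 'Rs x).

Let actN M X x : x \in X -> actperm 'Rs x \in 'N(rcosets M X | 'P).
Proof.
move=> Xx; rewrite inE in_setT /=; rewrite inE; apply/subsetP=> A SA; rewrite inE /=.
rewrite apermE actpermE /=.
have := acts_act (acts_cos M (subxx X)) Xx A => /=.
by rewrite SA.
Qed.

Let pM M X : {in X &, {morph p M X : x y / x * y}}.
Proof.
move=> x y Xx Xy; rewrite /p actpermM ?inE //.
by rewrite morphM ?actN.
Qed.

Let pX M X x i A : x \in X -> A \in rcosets M X -> (p M X x ^+ i) A = A :* x ^+ i.
Proof.
move=> Xx SA; elim: i => [|i IH]; first by rewrite !expg0 perm1 mulg1.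
have SAi : A :* x ^+ i \in rcosets M X.
  have := acts_act (acts_cos M (subxx X)) (groupX i Xx) A => /=.
  by rewrite SA rcosetE.
by rewrite expgSr permM IH restr_permE ?actN // actpermE /= rcosetE -rcosetM -expgSr.
Qed.

Let p_orb M X x A : x \in X -> A \in rcosets M X -> porbit (p M X x) A = orbit 'Rs <[x]> A.
Proof.
move=> Xx SA; apply/setP=> B; apply/porbitP/orbitP.
  by case=> i ->; exists (x ^+ i); rewrite ?mem_cycle // pX //= rcosetE.
by case=> g /cycleP[i ->] <-; exists i; rewrite pX //= rcosetE.
Qed.

(** [p M X x] permutes all sets of group elements and fixes those that are not cosets of [M] in [X].
    Each of these counts once as a point and once as a cycle, so the parity is unchanged. *)
Let p_sgn M X x : x \in X -> odd_perm (p M X x) = sgX M X x.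
Proof.
move=> Xx; set S := rcosets M X.
have E : porbits (p M X x) = cosorb M X <[x]> :|: [set [set A] | A in ~: S].
  apply/setP=> O; rewrite inE; apply/imsetP/orP.
    case=> A _ ->; case SA: (A \in S); first by left; apply/imsetP; exists A; rewrite ?p_orb.
    right; apply/imsetP; exists A; first by rewrite inE SA.
    have pA : p M X x A = A.
      have := restr_perm_on S (actperm 'Rs x); rewrite /perm_on => /subsetP h.
      by apply/eqP; apply: contraFT SA => h1; apply: h; rewrite inE.
    apply/setP=> B; rewrite inE; apply/porbitP/eqP; last by move=> ->; exists 0; rewrite expg0 perm1.
    case=> i ->; elim: i => [|i IH]; first by rewrite expg0 perm1.
    by rewrite expgSr permM IH.
  case=> /imsetP[A SA ->]; exists A => //; first by rewrite p_orb.
  move: SA; rewrite inE => SA.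
  have pA : p M X x A = A.
    have := restr_perm_on S (actperm 'Rs x); rewrite /perm_on => /subsetP h.
    by apply/eqP; apply: contraNT SA => h1; apply: h; rewrite inE.
  apply/setP=> B; rewrite inE; apply/eqP/porbitP; first by move=> ->; exists 0; rewrite expg0 perm1.
  case=> i ->; elim: i => [|i IH]; first by rewrite expg0 perm1.
  by rewrite expgSr permM IH.
have D : [disjoint cosorb M X <[x]> & [set [set A] | A in ~: S]].
  rewrite disjoints_subset; apply/subsetP=> O /imsetP[A SA ->]; rewrite inE.
  apply/negP=> /imsetP[B]; rewrite inE => SB E'.
  have: A \in [set B] by rewrite -E' orbit_refl.
  by rewrite inE => /eqP AB; rewrite -AB SA in SB.
rewrite /odd_perm E /sgX cardsU (disjoint_setI0 D) cards0 subn0.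
rewrite (card_imset _ (@set1_inj _)).
rewrite -(cardsC S) !oddD -/S.
by case: (odd #|S|); case: (odd #|~: S|); case: (odd _).
Qed.

Lemma sgX_hom2 M X : hom2 X (sgX M X).
Proof.
move=> x y Xx Xy; rewrite -!p_sgn ?groupM // pM // odd_permM.
by [].
Qed.

(** The stabilizers of cosets in [<[x]>] are its intersections with conjugates of [M], so all cycles
    of [x] have length [#[x]]. *)
Lemma sgX_semireg M X x : M \subset X -> x \in X ->
  (forall y, y \in X -> <[x]> :&: M :^ y = 1) -> sgX M X x = odd (#|X : M| + #|X : M| %/ #[x]).
Proof.
move=> sMX Xx ti; rewrite /sgX; congr (odd (_ + _)).
have sxX : <[x]> \subset X by rewrite cycle_subG.
have P := orbit_partition (acts_cos M sxX).
suff U : {in cosorb M X <[x]>, forall O : {set {set gT}}, #|O| = #[x]}.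
  have E : #|X : M| = (#|cosorb M X <[x]>| * #[x])%N := card_uniform_partition U P.
  by rewrite [in #|X : M| %/ _]E mulnK ?order_gt0.
move=> O /imsetP[A /rcosetsP[y Xy ->] ->]; rewrite card_orbit.
suff -> : 'C_(<[x]>)[M :* y | 'Rs] = 1 by rewrite indexg1.
apply/trivgP; rewrite /= -(ti y Xy) setIS //; apply/subsetP=> g /astab1P /= E.
have: y * g \in M :* y by rewrite -E rcosetE -rcosetM rcoset_refl.
by rewrite mem_rcoset mem_conjg conjgE invgK mulgA.
Qed.

End Sign.

(** * Maximal subgroups with trivial core *)

Section Count.
Variables (gT : finGroupType) (X M C : {group gT}).
Hypothesis maxM : maximal M X.
Hypothesis coreM : gcore M X = 1.
Hypothesis cycC : cyclic C.
Hypothesis nCM : C <| M.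
Hypothesis sqM : forall y, y \in M -> y ^+ 2 \in C.
Hypothesis ntC : C != 1%G.

Let sMX : M \subset X. Proof. by case/maxgroupP: maxM => /proper_sub. Qed.

Lemma max_corefree_norm (K : {group gT}) : K \subset M -> X \subset 'N(K) -> K :=: 1.
Proof. by move=> sK nK; apply/trivgP; rewrite /= -coreM; apply: gcore_max. Qed.

Let maxE (K : {group gT}) : M \subset K -> K \subset X -> K :=: M \/ K :=: X.
Proof.
move=> sMK sKX; case/maxgroupP: maxM => _ h.
case: (eqVneq (K : {set gT}) X) => [->|ne]; first by right.
by left; apply: h => //; rewrite properEneq ne.
Qed.

Let selfN x : x \in X -> x \notin M -> M :^ x \subset M -> False.
Proof.
move=> Xx Mx sM.
have Nx : x \in 'N_X(M) by rewrite inE Xx inE.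
case: (@maxE 'N_X(M)%G); rewrite /= ?subsetIl ?subsetI ?sMX ?normG //= => E.
  by rewrite E (negbTE Mx) in Nx.
have M1 : M :=: 1 by apply: max_corefree_norm => //; rewrite -E subsetIr.
have C1 : C :=: 1 by apply/trivgP; rewrite -M1; apply: normal_sub nCM.
by case/eqP: ntC; apply: val_inj.
Qed.

(** A subgroup of the cyclic group [C] is normal in [M], and one of [C :^ x] is normal in [M :^ x],
    so both normalize [B]. As [M :^ x] is not inside the maximal subgroup [M], all of [X] does, and
    the core is trivial. *)
Lemma corefree_TI (B : {group gT}) x : x \in X -> x \notin M ->
  B \subset C -> B \subset C :^ x -> B :=: 1.
Proof.
move=> Xx Mx sB sBx.
have nM : M \subset 'N(B).
  by apply: char_norm_trans (normal_norm nCM); rewrite sub_cyclic_char.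
have nMx : M :^ x \subset 'N(B).
  have cycCx : cyclic (C :^ x) by rewrite cyclicJ.
  have chB : B \char (C :^ x)%G by rewrite sub_cyclic_char.
  by apply: char_norm_trans chB _; rewrite /= normJ conjSg normal_norm.
have sBM : B \subset M := subset_trans sB (normal_sub nCM).
case: (@maxE 'N_X(B)%G); rewrite /= ?subsetIl ?subsetI ?sMX //= => E.
  exfalso; apply: (selfN Xx Mx).
  apply: (subset_trans (_ : _ \subset 'N_X(B))); last by rewrite E.
  by rewrite subsetI nMx andbT -(conjGid Xx) conjSg.
by apply: max_corefree_norm => //; rewrite -E subsetIr.
Qed.

(** Squares in [M :^ x] lie in [C :^ x], so [y ^+ 2] generates a subgroup of both [C] and
    [C :^ x]. *)
Lemma corefree_sq x y : x \in X -> x \notin M -> y \in C :&: M :^ x -> y ^+ 2 = 1.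
Proof.
move=> Xx Mx /setIP[Cy Mxy].
have: <[y ^+ 2]> = 1.
  apply: (corefree_TI Xx Mx); rewrite cycle_subG; first exact: groupX.
  by rewrite mem_conjg conjXg sqM // -mem_conjg.
by move/eqP; rewrite cycle_eq1 => /eqP.
Qed.

Lemma corefree_cap x : x \in X -> x \notin M -> #|C :&: M :^ x| = 1%N \/
   #|C :&: M :^ x| = 2 /\ ~~ odd #|C|.
Proof.
move=> Xx Mx; have cI : cyclic (C :&: M :^ x) by apply: cyclicS cycC; apply: subsetIl.
case/cyclicP: (cI) => y E.
have y2 : y ^+ 2 = 1 by apply: (corefree_sq Xx Mx); rewrite E cycle_id.
have dv : #[y] %| 2 by rewrite order_dvdn y2.
have cE : #|C :&: M :^ x| = #[y] by rewrite E.
have p2 : prime 2 by [].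
have /primeP[_ h] := p2; rewrite cE; case/pred2P: (h _ dv) => o; [by left|right].
split=> //; rewrite -dvdn2 -o -cE; apply: cardSg; exact: subsetIl.
Qed.

(** Otherwise every [C :&: M :^ x] with [x] outside [M] has order 2. The cyclic group [C] has only
    one such subgroup, so its involution lies in all conjugates of [M], hence in the core. *)
Lemma corefree_ex : exists x, [/\ x \in X, x \notin M & C :&: M :^ x = 1].
Proof.
case: (boolP [exists x in X, (x \notin M) && (C :&: M :^ x == 1)]) => [/existsP[x]|h].
  by case/and3P=> Xx Mx /eqP E; exists x.
have h1 x : x \in X -> x \notin M -> #|C :&: M :^ x| = 2.
  move=> Xx Mx; case: (corefree_cap Xx Mx) => [c1|[]//]; case/negP: h.
  apply/existsP; exists x; rewrite Xx Mx /=.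
  by apply/eqP/trivgP; apply/trivGP/val_inj/eqP => /=; rewrite trivg_card1 c1.
have [x0 Xx0 Mx0] : exists2 x0, x0 \in X & x0 \notin M.
  by case/maxgroupP: maxM => /properP[_ [x0 ? ?]] _; exists x0.
have [v [Cv v1]] : exists v, v \in C :&: M :^ x0 /\ v != 1.
  have: C :&: M :^ x0 != 1 by rewrite trivg_card1 h1.
  by case/trivgPn=> v ? ?; exists v.
have cov x : x \in X -> v \in M :^ x.
  move=> Xx; case Mx: (x \in M).
    by rewrite conjGid //; case/setIP: Cv => Cv _; apply: subsetP Cv; apply: normal_sub.
  have E : (C :&: M :^ x)%G = (C :&: M :^ x0)%G.
    apply/val_inj/eqP; rewrite (eq_subG_cyclic cycC) ?subsetIl //= !h1 ?Mx //.
  by have := Cv; rewrite -[C :&: _]/(gval (C :&: M :^ x0)%G) -E => /setIP[].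
have: v \in gcore M X by apply/bigcapP.
by rewrite coreM inE (negbTE v1).
Qed.

Lemma stab_rcos x : 'C_C[M :* x | 'Rs] = C :&: M :^ x.
Proof.
apply/setP=> g; rewrite in_setI [RHS]in_setI; congr (_ && _).
apply/idP/idP => [/astab1P /= E|].
  rewrite rcosetE in E; have: x * g \in M :* x by rewrite -E -rcosetM rcoset_refl.
  by rewrite mem_rcoset mem_conjg conjgE invgK mulgA.
rewrite mem_conjg conjgE invgK mulgA => h; apply/astab1P; rewrite /= rcosetE.
by rewrite -rcosetM; apply/rcoset_eqP; rewrite mem_rcoset.
Qed.

(** A regular orbit of [C] misses the coset [M], which [C] fixes. *)
Lemma corefree_leq : #|C| < #|X : M|.
Proof.
case: corefree_ex => x [Xx Mx I].
have sCX : C \subset X := subset_trans (normal_sub nCM) sMX.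
have oE : #|orbit 'Rs C (M :* x)| = #|C|.
  by rewrite card_orbit stab_rcos I indexg1.
rewrite -oE; apply: proper_card; apply/properP; split.
  by rewrite acts_sub_orbit ?acts_cos //; apply/rcosetsP; exists x.
exists (M : {set gT}); first by apply/rcosetsP; exists 1; rewrite ?group1 ?mulg1.
apply/orbitP=> -[g Cg /=]; rewrite rcosetE -rcosetM => E.
have: x * g \in M by rewrite -E rcoset_refl.
by rewrite groupMr ?(negbTE Mx) // (subsetP (normal_sub nCM)).
Qed.

(** Apart from the fixed coset [M], the stabilizers in [C] have order 1 or 2: there are [u] regular
    orbits and [v] of half that length. *)
Lemma corefree_count : exists u v,
  [/\ #|X : M| = (1 + #|C| * u + #|C|./2 * v)%N,
      #|cosorb M X C| = (1 + u + v)%N, 0 < u & odd #|C| -> v = 0].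
Proof.
have sCX : C \subset X := subset_trans (normal_sub nCM) sMX.
have P := orbit_partition (acts_cos M sCX).
have SM : (M : {set gT}) \in rcosets M X.
  by apply/rcosetsP; exists 1; rewrite ?group1 ?mulg1.
have oM : orbit 'Rs C M = [set (M : {set gT})].
  apply/setP=> B; rewrite inE; apply/orbitP/eqP => [[g Cg <-] /=|->].
    by rewrite rcosetE rcoset_id // (subsetP (normal_sub nCM)).
  by exists 1; rewrite ?group1 //= rcosetE mulg1.
have OM : [set (M : {set gT})] \in cosorb M X C.
  by rewrite -oM; apply/imsetP; exists (M : {set gT}).
pose O' := cosorb M X C :\ [set (M : {set gT})].
pose O1 := [set O in O' | #|O| == #|C|].
pose O2 := O' :\: O1.
have O'P O : O \in O' -> exists x, [/\ x \in X, x \notin M & O = orbit 'Rs C (M :* x)].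
  rewrite !inE => /andP[ne /imsetP[A /rcosetsP[x Xx ->] E]]; exists x; split=> //.
  by apply: contra ne => Mx; rewrite E rcoset_id // oM.
have oc x : #|orbit 'Rs C (M :* x)| = #|C : C :&: M :^ x|.
  by rewrite card_orbit stab_rcos.
have O2P O : O \in O2 -> #|O| = #|C|./2 /\ ~~ odd #|C|.
  rewrite inE => /andP[n1 OO']; move: n1; rewrite inE OO' /=.
  case: (O'P O OO') => x [Xx Mx ->]; rewrite oc.
  case: (corefree_cap Xx Mx) => [c1|[c2 ->] _].
    by rewrite -divgS ?subsetIl // c1 divn1 eqxx.
  by rewrite -divgS ?subsetIl // c2 divn2.
exists #|O1|, #|O2|; split.
- have := card_partition P; rewrite (big_setD1 _ OM) /= cards1 -/O'.
  rewrite (big_setID O1) /= => E; rewrite -addnA; rewrite /indexg E; congr (_ + _)%N; congr (_ + _)%N.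
    have -> : O' :&: O1 = O1 by apply/setIidPr; apply/subsetP=> O; rewrite inE => /andP[].
    rewrite mulnC -sum_nat_const; apply: eq_bigr => O; rewrite inE => /andP[_ /eqP//].
  by rewrite mulnC -sum_nat_const; apply: eq_bigr => O /O2P[].
- have := cardsD1 [set (M : {set gT})] (cosorb M X C); rewrite OM -/O' => ->.
  rewrite -addnA; congr (_ + _)%N; rewrite -(cardsID O1 O'); congr (_ + _)%N.
  have -> : O' :&: O1 = O1 by apply/setIidPr; apply/subsetP=> O; rewrite inE => /andP[].
  by [].
- case: corefree_ex => x [Xx Mx I]; apply/card_gt0P; exists (orbit 'Rs C (M :* x)).
  rewrite !inE oc I indexg1 eqxx andbT; apply/andP; split; last first.
    by apply/imsetP; exists (M :* x) => //; apply/rcosetsP; exists x.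
  apply/eqP=> E; have: M :* x \in [set (M : {set gT})] by rewrite -E orbit_refl.
  rewrite inE => /eqP E'; have: x \in M by rewrite -E' rcoset_refl.
  by rewrite (negbTE Mx).
- move=> oC; apply/eqP; rewrite cards_eq0; apply/set0Pn=> -[O /O2P[_]].
  by rewrite oC.
Qed.

End Count.

(** * Normal subgroups identifying two reflections *)

Section Twin.
Variable gT : finGroupType.
Implicit Types (a b c d x y : gT) (K L X Y P : {group gT}) (f r u v : gT -> bool).

Lemma adjoin_card K x q : prime q -> x \in 'N(K) -> x \notin K -> x ^+ q \in K ->
  (#|K| * q)%N = #|K <*> <[x]>|.
Proof.
move=> pq nx Kx Kxq; have nX : <[x]> \subset 'N(K) by rewrite cycle_subG.
have oq : #[coset K x] = q.
  apply: nt_prime_order => //; first by rewrite -morphX //= coset_id.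
  by apply: contra Kx => /eqP; rewrite -[coset K x]/(coset K x) => /coset_idr; apply.
have nY : K <*> <[x]> \subset 'N(K) by rewrite join_subG normG.
have := Lagrange (joing_subl K <[x]>); rewrite /= -(card_quotient nY) quotientYidl //.
by rewrite quotient_cycle // -orderE oq.
Qed.

Lemma half_adjoin K x : x \in 'N(K) -> x \notin K -> x ^+ 2 \in K -> index2 K (K <*> <[x]>).
Proof. by move=> nx Kx Kx2; split; [apply: joing_subl | apply: adjoin_card]. Qed.

Lemma half_outside K L x : K \subset L -> x \in 'N(K) -> x \notin K -> x ^+ 2 \in K ->
  L :=: K <*> <[x]> -> index2 K L.
Proof. by move=> sK nx Kx x2 E; rewrite /index2 E; apply: half_adjoin. Qed.

(* P meets the factors in groups of rotations, but contains the product of the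
   reflections b and d. *)
Definition twin X P a b c d s t : Prop :=
  [/\ P <| X, P :&: Dh a b = <[a ^+ s]>, P :&: Dh c d = <[c ^+ t]>, b * d \in P &
      #|P| = (2 * (#[a ^+ s] * #[c ^+ t]))%N].

Lemma twinC X P a b c d s t : exact X a b c d -> twin X P a b c d s t ->
  twin X P c d a b t s.
Proof.
move=> [dab dcd _ _] [nP PG PH Pbd cP]; split=> //; last by rewrite cP [(#[c ^+ t] * _)%N]mulnC.
by rewrite -groupV invMg (dihpV dab) (dihpV dcd).
Qed.

Section Action.
Variables (X P : {group gT}) (a b c d : gT) (s t : nat).
Hypothesis hX : exact X a b c d.
Hypothesis hP : twin X P a b c d s t.

Let nPX : X \subset 'N(P). Proof. by case: hP => /normal_norm. Qed.
Let Pa : a ^+ s \in P. Proof. by case: hP => _ PG _ _ _; have := cycle_id (a ^+ s); rewrite -PG => /setIP[]. Qed.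
Let Pc : c ^+ t \in P. Proof. by case: hP => _ _ PG _ _; have := cycle_id (c ^+ t); rewrite -PG => /setIP[]. Qed.
Let Pbd : b * d \in P. Proof. by case: hP. Qed.

Lemma twin_b_notin : b \notin P.
Proof.
apply/negP=> Pb; case: hP => _ PG _ _ _.
have: b \in P :&: Dh a b by rewrite inE Pb Dh_r.
rewrite PG => /(subsetP (cycleX a s)); apply/negP; by case: (ex_dab hX).
Qed.

(** The product set [<[a ^+ s]> * <[c ^+ t]>] fills half of [P]. If the three elements generated a
    proper subgroup, it would equal this set, and b d = x y would put x^-1 b = y d^-1 in both
    dihedral factors, making [b] a rotation. *)
Lemma twin_gen : P \subset <<[set a ^+ s; c ^+ t; b * d]>>.
Proof.
set W := <<_>>.
have sWP : W \subset P by rewrite gen_subG !subUset !sub1set Pa Pc Pbd.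
have sU : <[a ^+ s]> * <[c ^+ t]> \subset W.
  by apply: mul_subG; rewrite cycle_subG mem_gen // !inE eqxx ?orbT.
have cU : #|<[a ^+ s]> * <[c ^+ t]>| = (#[a ^+ s] * #[c ^+ t])%N.
  rewrite TI_cardMg -?orderE //; case: hX => _ _ _ I; apply/trivgP; rewrite /= -I.
  by apply: setISS; rewrite cycle_subG groupX ?Dh_l.
case: (eqVneq W P) => [->//|ne].
have dv : #|P| = (#|W| * #|P : W|)%N by rewrite Lagrange.
have i1 : 1 < #|P : W| by rewrite indexg_gt1; apply: contra ne => sPW; rewrite eqEsubset sWP.
have E : <[a ^+ s]> * <[c ^+ t]> = W.
  apply/eqP; rewrite eqEcard sU cU /=; case: hP => _ _ _ _ cP.
  have := cP; rewrite dv; have := cardG_gt0 [group of W]; move: i1 => /=; set i := #|P : W|; set w := #|W|; nia.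
have: b * d \in W by rewrite mem_gen // !inE eqxx orbT.
rewrite -E => /mulsgP[x y Ax Cy e].
have E1 : x^-1 * b = y * d^-1 by rewrite -[b](mulgK d) e !mulgA mulVg mul1g.
have I1 : x^-1 * b \in Dh a b :&: Dh c d.
  have sA : <[a ^+ s]> \subset Dh a b by rewrite cycle_subG groupX ?Dh_l.
  have sC : <[c ^+ t]> \subset Dh c d by rewrite cycle_subG groupX ?Dh_l.
  by rewrite inE {2}E1 !groupM ?groupV ?Dh_r ?(subsetP sA x) ?(subsetP sC y).
case: hX => [[Ab _ _] _ _ I]; rewrite I inE -eq_mulVg1 in I1.
by case/negP: Ab; rewrite -(eqP I1) (subsetP (cycleX a s)).
Qed.

Lemma twin_eq f u : hom2 P f -> hom2 P u -> f (a ^+ s) = u (a ^+ s) ->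
  f (c ^+ t) = u (c ^+ t) -> f (b * d) = u (b * d) -> {in P, f =1 u}.
Proof.
move=> hf hu ea ec ebd; apply: (hom2_gen hf hu _ twin_gen).
  by rewrite !subUset !sub1set Pa Pc Pbd.
by move=> x; rewrite !inE => /orP[/orP[]|] /eqP ->.
Qed.

(** On the generators, [b] inverts [a ^+ s] and [b * d]. On [c ^+ t] it acts as b d, which lies in
    [P], followed by [d], which inverts it. *)
Lemma twin_act_b f : hom2 P f -> {in P, forall x, f (x ^ b) = f x}.
Proof.
move=> hf; have nb := subsetP nPX b (ex_b hX); have nd := subsetP nPX d (ex_d hX).
have [dab dcd] := (ex_dab hX, ex_dcd hX).
apply: (twin_eq (hom2_conj nb hf) hf).
- by case: (dab) => _ _ ab; rewrite conjXg ab expgVn (hom2V hf).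
- have -> : b = b * d * d by rewrite -mulgA -expg2; case: dcd => _ -> _; rewrite mulg1.
  rewrite conjgM (hom2J (hom2_conj nd hf)) //.
  by case: (dcd) => _ _ cd; rewrite conjXg cd expgVn (hom2V hf).
- by rewrite conjgE mulgA mulgA mulVg mul1g -(hom2V hf Pbd) invMg (dihpV dab) (dihpV dcd).
Qed.

(** The normal closure of [b] together with [P]. It acts trivially on Hom(P, Z/2): [P] does, and a
    conjugate of [b] acts as [b] does on a conjugate homomorphism. So only the classes of [a] and
    [c] act, both of square 1 because a^2 = b b^a and c^2 = d d^c. *)
Definition kerQ : {group gT} := (P <*> <<b ^: X>>)%G.

Lemma kerQ_sub : kerQ \subset X.
Proof.
rewrite join_subG (normal_sub (_ : P <| X)); last by case: hP.
by rewrite gen_subG class_subG ?(ex_b hX).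
Qed.

Lemma kerQ_norm : kerQ <| X.
Proof.
rewrite /normal kerQ_sub normsY //.
by apply: norms_gen; apply: class_norm.
Qed.

Lemma kerQP : P \subset kerQ. Proof. exact: joing_subl. Qed.

Lemma kerQb : b \in kerQ.
Proof. by apply: (subsetP (joing_subr _ _)); rewrite mem_gen ?class_refl. Qed.

Lemma kerQd : d \in kerQ.
Proof. by rewrite -(groupMl _ kerQb) (subsetP kerQP). Qed.

Lemma kerQa2 : a ^+ 2 \in kerQ.
Proof.
have E : a ^+ 2 = b * b ^ a.
  have [dab] := ex_dab hX => _ ab; rewrite conjgE !mulgA.
  have -> : b * a^-1 * b = a by rewrite -{1}(dihpV (ex_dab hX)) -mulgA -conjgE conjVg ab invgK.
  by rewrite expg2.
by rewrite E groupM ?kerQb // memJ_norm ?kerQb // (subsetP (normal_norm kerQ_norm)) ?(ex_a hX).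
Qed.

Lemma kerQc2 : c ^+ 2 \in kerQ.
Proof.
have E : c ^+ 2 = d * d ^ c.
  have [dab] := ex_dcd hX => _ ab; rewrite conjgE !mulgA.
  have -> : d * c^-1 * d = c by rewrite -{1}(dihpV (ex_dcd hX)) -mulgA -conjgE conjVg ab invgK.
  by rewrite expg2.
by rewrite E groupM ?kerQd // memJ_norm ?kerQd // (subsetP (normal_norm kerQ_norm)) ?(ex_c hX).
Qed.

Lemma kerQ_act f : hom2 P f -> {in kerQ & P, forall x y, f (y ^ x) = f y}.
Proof.
move=> hf x y Qx Py.
pose S := [set x in X | [forall g in X, [forall y in P, f ((y ^ x) ^ g) == f (y ^ g)]]].
have Sg : group_set S.
  apply/group_setP; split.
    rewrite inE group1; apply/forall_inP=> g Xg; apply/forall_inP=> z Pz.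
    by rewrite conjg1.
  move=> x1 x2; rewrite !inE => /andP[Xx1 /forall_inP h1] /andP[Xx2 /forall_inP h2].
  rewrite groupM //=; apply/forall_inP=> g Xg; apply/forall_inP=> z Pz.
  have Pzx : z ^ x1 \in P by rewrite memJ_norm // (subsetP nPX).
  rewrite conjgM (eqP (forall_inP (h2 g Xg) _ Pzx)); exact: (forall_inP (h1 g Xg) _ Pz).
suff: x \in Group Sg.
  rewrite inE => /andP[_ /forall_inP /(_ 1 (group1 X)) /forall_inP /(_ y Py) /eqP].
  by rewrite !conjg1.
apply: subsetP Qx; rewrite join_subG gen_subG; apply/andP; split.
  apply/subsetP=> z Pz; rewrite inE; have Xz : z \in X by apply: subsetP Pz; case: hP => /normal_sub.
  rewrite Xz; apply/forall_inP=> g Xg; apply/forall_inP=> w Pw; apply/eqP.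
  by rewrite (hom2J (hom2_conj (subsetP nPX g Xg) hf)).
apply/subsetP=> z /imsetP[k Xk ->]; rewrite inE groupJ ?(ex_b hX) //.
apply/forall_inP=> g Xg; apply/forall_inP=> w Pw; apply/eqP.
have hfkg := hom2_conj (subsetP nPX _ (groupM Xk Xg)) hf.
have Pwk : w ^ k^-1 \in P by rewrite memJ_norm // groupV (subsetP nPX).
have -> : (w ^ (b ^ k)) ^ g = ((w ^ k^-1) ^ b) ^ (k * g).
  by rewrite -!conjgM /conjg !mulgA.
by rewrite (twin_act_b hfkg) // conjgM conjgKV.
Qed.

Lemma kerQ_gen : (X : {set gT}) = kerQ * (<[a]> * <[c]>).
Proof.
have nQ := normal_norm kerQ_norm.
apply/eqP; rewrite eqEsubset; apply/andP; split; last first.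
  by rewrite !mul_subG ?kerQ_sub // cycle_subG ?(ex_a hX) ?(ex_c hX).
have [dab dcd] := (ex_dab hX, ex_dcd hX).
have sA : <[a]> \subset X by rewrite cycle_subG (ex_a hX).
have sC : <[c]> \subset X by rewrite cycle_subG (ex_c hX).
have GE : Dh a b \subset kerQ * <[a]>.
  rewrite (DhE dab) -(normC (subset_trans sA nQ)); apply: mulgS.
  by rewrite cycle_subG kerQb.
have HE : Dh c d \subset kerQ * <[c]>.
  rewrite (DhE dcd) -(normC (subset_trans sC nQ)); apply: mulgS.
  by rewrite cycle_subG kerQd.
case: hX => _ _ <- _; apply: subset_trans (mulgSS GE HE) _.
rewrite -mulgA (mulgA <[a]>) (normC (subset_trans sA nQ)) !mulgA.
by rewrite mulGid.
Qed.

Lemma kerQ_subG K : kerQ \subset K -> a \in K -> c \in K -> X \subset K.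
Proof.
move=> sQ Ka Kc; rewrite -[X \subset K]/((X : {set gT}) \subset K) kerQ_gen.
by rewrite !mul_subG ?cycle_subG.
Qed.

Lemma cyc2_mod x : x ^+ 2 \in kerQ -> <[x]> \subset kerQ :|: kerQ :* x.
Proof.
move=> x2; apply/subsetP=> y /cycleP[i ->]; rewrite inE mem_rcoset.
have -> : x ^+ i = (x ^+ 2) ^+ i./2 * x ^+ (odd i).
  by rewrite -expgM mul2n -expgD addnC odd_double_half.
by case: (odd i); rewrite ?expg0 ?mulg1 ?expg1 ?mulgK groupX ?orbT.
Qed.

(** Let A and C be the images of [a] and [c] modulo [kerQ]. Every element of the quotient is A^i
    C^j, and A^2 = C^2 = 1. Hence C A is one of 1, A, C, A C, and each of these forces A and C to
    commute. *)
Lemma kerQ_comm : [~ a, c] \in kerQ.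
Proof.
have nQ := normal_norm kerQ_norm.
have [na nc] := (subsetP nQ a (ex_a hX), subsetP nQ c (ex_c hX)).
pose A := coset kerQ a; pose C := coset kerQ c.
have A2 : A * A = 1 by rewrite -morphM //= -expg2 coset_id ?kerQa2.
have C2 : C * C = 1 by rewrite -morphM //= -expg2 coset_id ?kerQc2.
have e x : x \in 'N(kerQ) -> coset kerQ x * coset kerQ x = 1 -> forall i,
    coset kerQ (x ^+ i) = 1 \/ coset kerQ (x ^+ i) = coset kerQ x.
  move=> nx x2; elim=> [|i IH]; first by left; rewrite morph1.
  rewrite expgS morphM ?groupX //=; case: IH => ->; [right | left] => //.
  by rewrite mulg1.
have [y [z [yE zE CA]]] : exists (y z : coset_of kerQ), [/\ y = 1 \/ y = A, z = 1 \/ z = C & C * A = y * z].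
  have: c * a \in kerQ * (<[a]> * <[c]>) by rewrite -kerQ_gen groupM ?(ex_a hX) ?(ex_c hX).
  case/mulsgP=> q w Qq /mulsgP[u v /cycleP[i ->] /cycleP[j ->] ->] E.
  exists (coset kerQ (a ^+ i)), (coset kerQ (c ^+ j)); split; [exact: e|exact: e|].
  rewrite -morphM // E /= !morphM ?groupM ?groupX //=; first by rewrite (coset_id Qq) mul1g.
  by rewrite (subsetP (normG kerQ)).
have cAC : C * A = A * C.
  case: yE zE CA => -> [] -> CA.
  - have EC : C = A^-1 by apply: (mulIg A); rewrite CA mulg1 mulVg.
    by rewrite EC mulVg mulgV.
  - have EA : A = 1 by apply: (mulgI C); rewrite CA mul1g mulg1.
    by rewrite EA mulg1 mul1g.
  - have EC : C = 1 by apply: (mulIg A); rewrite CA mulg1 mul1g.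
    by rewrite EC mulg1 mul1g.
  - by [].
apply: coset_idr; first by rewrite groupR.
by rewrite morphR //=; apply/eqP/commgP.
Qed.

Lemma kerQ_comm_act f : hom2 P f -> {in P, forall y, f (y ^ (a * c)) = f (y ^ (c * a))}.
Proof.
move=> hf y Py; rewrite commgC conjgM.
apply: (kerQ_act hf kerQ_comm).
by rewrite memJ_norm // (subsetP nPX) // groupM ?(ex_a hX) ?(ex_c hX).
Qed.

Lemma kerQ_half x : x \in X -> forall K, kerQ \subset K -> x ^+ 2 \in kerQ -> K \subset X ->
  X :=: K <*> <[x]> -> x \notin K -> index2 K X.
Proof.
move=> Xx K sQK x2 sKX E Kx; apply: (half_outside sKX _ Kx _ E); last exact: subsetP x2.
have nQ := normal_norm kerQ_norm.
have aX : abelian (X / kerQ).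
  rewrite kerQ_gen quotientMidl quotientMl ?cycle_subG ?(subsetP nQ) ?(ex_a hX) //.
  rewrite !quotient_cycle ?(subsetP nQ) ?(ex_a hX) ?(ex_c hX) //.
  rewrite abelianM !cycle_abelian /= cent_cycle cycle_subG; apply/cent1P.
  have := kerQ_comm; move/coset_id; rewrite morphR ?(subsetP nQ) ?(ex_a hX) ?(ex_c hX) //= => /eqP/commgP.
  by move/commute_sym.
apply: subsetP Xx; apply: normal_norm; apply: sub_der1_normal => //.
apply: subset_trans sQK; exact: der1_min.
Qed.

(** Modulo [kerQ] the group is abelian, generated by [a] and [c] of order at most 2. If [a] were not
    in [kerQ <*> <[c]>], that group would have index 2 and contain [c] and [d]; symmetrically for
    [c]. So each is a power of the other modulo [kerQ], and their product is trivial there. *)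
Lemma kerQ_ac : ~ index2_over X a b c d -> a * c \in kerQ.
Proof.
move=> nI.
have nQ := normal_norm kerQ_norm; have sQ := kerQ_sub.
have jl (K : {group gT}) x : K \subset K <*> <[x]> /\ x \in K <*> <[x]>.
  by rewrite joing_subl -cycle_subG joing_subr.
have Xc : kerQ <*> <[c]> = X.
  have [l r] := jl kerQ c.
  have sYX : kerQ <*> <[c]> \subset X by rewrite join_subG sQ cycle_subG (ex_c hX).
  case Ka: (a \in kerQ <*> <[c]>).
    by apply/eqP; rewrite eqEsubset sYX kerQ_subG.
  have [l' r'] := jl (kerQ <*> <[c]>)%G a.
  case: nI; exists (kerQ <*> <[c]>)%G; last first.
    by rewrite orbC Dh_sub r (subsetP l) // kerQd.
  apply: (@kerQ_half a); rewrite ?(ex_a hX) ?kerQa2 ?Ka //.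
  apply/eqP; rewrite eqEsubset join_subG sYX cycle_subG (ex_a hX) !andbT.
  by rewrite kerQ_subG // ?(subset_trans l) ?(subsetP l').
have Xa : kerQ <*> <[a]> = X.
  have [l r] := jl kerQ a.
  have sYX : kerQ <*> <[a]> \subset X by rewrite join_subG sQ cycle_subG (ex_a hX).
  case Ka: (c \in kerQ <*> <[a]>).
    by apply/eqP; rewrite eqEsubset sYX kerQ_subG.
  have [l' r'] := jl (kerQ <*> <[a]>)%G c.
  case: nI; exists (kerQ <*> <[a]>)%G; last first.
    by rewrite Dh_sub r (subsetP l) // kerQb.
  apply: (@kerQ_half c); rewrite ?(ex_c hX) ?kerQc2 ?Ka //.
  apply/eqP; rewrite eqEsubset join_subG sYX cycle_subG (ex_c hX) !andbT.
  by rewrite kerQ_subG // ?(subset_trans l) ?(subsetP l').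
have nc : <[c]> \subset 'N(kerQ) by rewrite cycle_subG (subsetP nQ) ?(ex_c hX).
have: a \in kerQ <*> <[c]> by rewrite Xc (ex_a hX).
rewrite norm_joinEr // => /mulsgP[q y Qq Cy aE]; rewrite aE.
have Xq : X = kerQ :> {set gT} -> q * y * c \in kerQ.
  move=> <-; rewrite !groupM ?(ex_c hX) ?(subsetP sQ q Qq) //.
  by apply: subsetP Cy; rewrite cycle_subG (ex_c hX).
have := subsetP (cyc2_mod kerQc2) y Cy; rewrite inE => /orP[Qy|].
  apply: Xq; rewrite -Xa; apply/joing_idPl; rewrite cycle_subG.
  by rewrite aE groupM.
rewrite mem_rcoset => Qyc; have -> : q * y * c = q * (y * c^-1) * c ^+ 2.
  by rewrite expg2 !mulgA mulgKV.
exact: groupM (groupM Qq Qyc) kerQc2.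
Qed.

End Action.
End Twin.

(** * Homomorphisms splitting a twin subgroup *)

Section LemmaR.
Variable gT : finGroupType.
Implicit Types (a b c d x y : gT) (K L X Y P : {group gT}) (f r u v : gT -> bool).

Lemma index2_over_refl X a b c d i : exact X a b c d ->
  index2_over X a (a ^+ i * b) c d -> index2_over X a b c d.
Proof. by move=> hX; rewrite /index2_over (Dh_reflE i (ex_dab hX)). Qed.

Definition splits P a b c d s t : Prop :=
  exists2 r, hom2 P r & [/\ r (a ^+ s) = false, r (c ^+ t) = false & r (b * d) = true].

Lemma splitsC P a b c d s t : dihp a b -> dihp c d -> b * d \in P ->
  splits P a b c d s t -> splits P c d a b t s.
Proof.
move=> dab dcd Pbd [r hr [ra rc rbd]]; exists r => //; split=> //.
by rewrite -(dihpV dab) -(dihpV dcd) -invMg (hom2V hr).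
Qed.

Lemma hom2_0 P : hom2 P (fun=> false). Proof. by []. Qed.

Section InvOrSplit.
Variables (X P : {group gT}) (a b c d : gT) (s t : nat).
Hypothesis hX : exact X a b c d.
Hypothesis hP : twin X P a b c d s t.

Let nPX : X \subset 'N(P). Proof. by case: hP => /normal_norm. Qed.
Let Pa : a ^+ s \in P. Proof. by case: hP => _ PG _ _ _; have := cycle_id (a ^+ s); rewrite -PG => /setIP[]. Qed.
Let Pc : c ^+ t \in P. Proof. by case: hP => _ _ PG _ _; have := cycle_id (c ^+ t); rewrite -PG => /setIP[]. Qed.
Let Pbd : b * d \in P. Proof. by case: hP. Qed.
Let na : a \in 'N(P). Proof. exact: subsetP nPX _ (ex_a hX). Qed.
Let nc : c \in 'N(P). Proof. exact: subsetP nPX _ (ex_c hX). Qed.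

Definition inv_ac f := {in P, forall y, f (y ^ a) = f y} /\ {in P, forall y, f (y ^ c) = f y}.

(* The value at a^s is fixed by a and that at c^t by c, which leaves little
   room for the conjugates of u. *)
Lemma inv_or_split u : hom2 P u -> u (a ^+ s) -> u (c ^+ t) = false ->
  splits P a b c d s t \/
  exists2 v, hom2 P v & inv_ac v /\
     ((v (a ^+ s) /\ v (c ^+ t) = false) \/ (v (a ^+ s) = false /\ v (c ^+ t))).
Proof.
move=> hu ua uc.
have hua := hom2_conj na hu; have huc := hom2_conj nc hu.
have ca : (a ^+ s) ^ a = a ^+ s by apply/conjg_fixP/commgP/commute_sym/commuteX.
have cc : (c ^+ t) ^ c = c ^+ t by apply/conjg_fixP/commgP/commute_sym/commuteX.
have splitP f : hom2 P f -> f (a ^+ s) = false -> f (c ^+ t) = false -> f (b * d) ->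
  splits P a b c d s t by move=> hf fa fc fbd; exists f.
pose f1 := fun y => u (y ^ c); pose f2 := fun y => u (y ^ a).
have f1c : f1 (c ^+ t) = false by rewrite /f1 cc.
have f2a : f2 (a ^+ s) by rewrite /f2 ca.
have [f1a|/negbTE f1a] := boolP (f1 (a ^+ s)); last first.
  left; apply: (splitP f1) => //; apply/negbNE/negP=> /negbTE f1bd.
  have z : {in P, f1 =1 xpred0} by apply: (twin_eq hX hP huc (@hom2_0 P)).
  have := z ((a ^+ s) ^ c^-1); rewrite /f1 conjgKV ua.
  by rewrite memJ_norm ?groupV // => /(_ Pa).
have [e1|ne1] := eqVneq (f1 (b * d)) (u (b * d)); last first.
  left; apply: (splitP (fun y => f1 y (+) u y)); rewrite ?f1a ?ua ?f1c ?uc //.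
    exact: hom2D.
  by case: (f1 (b * d)) (u (b * d)) ne1 => [] [].
have invc : {in P, forall y, u (y ^ c) = u y}.
  by apply: (twin_eq hX hP huc hu); rewrite ?uc ?ua.
have [f2c|/negbTE f2c] := boolP (f2 (c ^+ t)); last first.
  have [e2|ne2] := eqVneq (f2 (b * d)) (u (b * d)); last first.
    left; apply: (splitP (fun y => f2 y (+) u y)); rewrite ?f2a ?ua ?f2c ?uc //.
      exact: hom2D.
    by case: (f2 (b * d)) (u (b * d)) ne2 => [] [].
  right; exists u => //; split; last by left.
  split=> //; apply: (twin_eq hX hP hua hu); rewrite ?ua ?uc //.
(* Here [u] is [c]-invariant and f2 + u is nonzero at [c ^+ t] only among the two rotations. It is
   invariant under [a] because a^2 acts trivially, and under [c] because the actions of [a] and [c]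
   commute. *)
right; exists (fun y => f2 y (+) u y); first exact: hom2D.
split; last by right; rewrite f2a ua f2c uc.
have a2 y : y \in P -> u ((y ^ a) ^ a) = u y.
  by move=> Py; rewrite -conjgM -expg2 (kerQ_act hX hP hu) ?(kerQa2 hX hP).
split=> y Py; rewrite /f2.
  by rewrite a2 // addbC.
rewrite invc // -conjgM -(kerQ_comm_act hX hP hu) // conjgM invc //.
by rewrite memJ_norm.
Qed.

End InvOrSplit.

Section Descent.
Variables (X : {group gT}) (a c : gT).

(** Either alternative makes [a ^+ s] act trivially on the homomorphism to be extended in [descend]:
    even powers of [a] lie in [kerQ], and otherwise [act_fix] applies. Both survive the doubling of
    [s] and a change of reflection. *)
Definition par_ok b d s t := (~~ odd s /\ ~~ odd t) \/ ~ index2_over X a b c d.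

(** Since a c acts trivially, [a] acts as c^-1. Thus the conjugate of [r] by [a] still kills
    [a ^+ s], fixed by [a], and [c ^+ t], fixed by [c]; at most one nonzero homomorphism on [P] does
    so. *)
Lemma act_fix P b d s t r : exact X a b c d -> twin X P a b c d s t -> ~ index2_over X a b c d ->
  hom2 P r -> r (a ^+ s) = false -> r (c ^+ t) = false ->
  {in P, forall y, r (y ^ a) = r y} /\ {in P, forall y, r (y ^ c) = r y}.
Proof.
move=> hX hP nI hr ra rc.
have nPX : X \subset 'N(P) by case: hP => /normal_norm.
have Pc : c ^+ t \in P by case: hP => _ _ PG _ _; have := cycle_id (c ^+ t); rewrite -PG => /setIP[].
have Pa : a ^+ s \in P by case: hP => _ PG _ _ _; have := cycle_id (a ^+ s); rewrite -PG => /setIP[].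
have Pbd : b * d \in P by case: hP.
have na := subsetP nPX a (ex_a hX).
have nc := subsetP nPX c (ex_c hX).
have ncV : c^-1 \in 'N(P) by rewrite groupV.
have ca : (a ^+ s) ^ a = a ^+ s by apply/conjg_fixP/commgP/commute_sym/commuteX.
have cc : (c ^+ t) ^ c^-1 = c ^+ t by apply/conjg_fixP/commgP/commuteV/commute_sym/commuteX.
have aE y : y \in P -> r (y ^ a) = r (y ^ c^-1).
  move=> Py; rewrite -[a](mulgK c) conjgM.
  by rewrite (kerQ_act hX hP (hom2_conj ncV hr)) // (kerQ_ac hX hP nI).
have inva : {in P, forall y, r (y ^ a) = r y}.
  have hra := hom2_conj na hr.
  have r1a : r ((a ^+ s) ^ a) = false by rewrite ca.
  have r1c : r ((c ^+ t) ^ a) = false by rewrite aE // cc.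
  have [rbd|/negbTE rbd] := boolP (r (b * d)); last first.
    have z : {in P, r =1 xpred0} by apply: (twin_eq hX hP hr (@hom2_0 P)).
    by move=> y Py; rewrite !z // memJ_norm.
  apply: (twin_eq hX hP hra hr); rewrite ?r1a ?r1c //.
  rewrite rbd; apply/negbNE/negP=> /negbTE h.
  have z : {in P, (fun y => r (y ^ a)) =1 xpred0}.
    by apply: (twin_eq hX hP hra (@hom2_0 P)).
  have Pz : (b * d) ^ a^-1 \in P by rewrite memJ_norm ?groupV.
  by have := z _ Pz; rewrite conjgKV rbd.
split=> // y Py; have Pyc : y ^ c \in P by rewrite memJ_norm.
by rewrite -(inva _ Pyc) aE // conjgK.
Qed.

(** The kernel of the invariant [v] is again a twin subgroup, with [s] doubled. A splitting
    homomorphism on it extends to [P] with value 0 at [a ^+ s]. *)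
Lemma descend P b d s t v : exact X a b c d -> twin X P a b c d s t -> par_ok b d s t ->
  hom2 P v -> {in P, forall y, v (y ^ a) = v y} -> {in P, forall y, v (y ^ c) = v y} ->
  v (a ^+ s) -> v (c ^+ t) = false ->
  (forall P' b', exact X a b' c d -> twin X P' a b' c d (s * 2) t ->
     par_ok b' d (s * 2) t -> #|P'| < #|P| -> splits P' a b' c d (s * 2) t) ->
  splits P a b c d s t.
Proof.
move=> hX hP ok hv va vc vas vct IH.
have nPX : X \subset 'N(P) by case: hP => /normal_norm.
have Pc : c ^+ t \in P by case: hP => _ _ PG _ _; have := cycle_id (c ^+ t); rewrite -PG => /setIP[].
have Pa : a ^+ s \in P by case: hP => _ PG _ _ _; have := cycle_id (a ^+ s); rewrite -PG => /setIP[].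
have Pbd : b * d \in P by case: hP.
have na := subsetP nPX a (ex_a hX).
have nc := subsetP nPX c (ex_c hX).
have vb := twin_act_b hX hP hv.
have vd : {in P, forall y, v (y ^ d) = v y}.
  by move=> y Py; rewrite (kerQ_act hX hP hv) // (kerQd hP).
pose P' := hker hv.
have hP' : index2 P' P by apply: (hker_half hv Pa).
have P'E y : (y \in P') = (y \in P) && ~~ v y by rewrite hkerE.
(* As [v (a ^+ s)] holds, one of the reflections [b] and [a ^+ s * b] has its product with [d] in
   the kernel of [v]. *)
pose b' := if v (b * d) then a ^+ s * b else b.
have [i b'E] : exists i, b' = a ^+ i * b.
  by rewrite /b'; case: ifP => _; [exists s | exists 0; rewrite mul1g].
have hX' : exact X a b' c d by rewrite b'E; apply: exact_reflL.
have P'b'd : b' * d \in P'.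
  rewrite P'E /b'; case: ifP => vbd; last by rewrite Pbd vbd.
  by rewrite -mulgA groupM //= hv // vas vbd.
have oddas : #[a ^+ s] = (#[a ^+ (s * 2)] * 2)%N.
  have ev : 2 %| #[a ^+ s].
    rewrite dvdn2; apply/negP=> od; have := hom2X #[a ^+ s] hv Pa.
    by rewrite expg_order (hom2_1 hv) od vas.
  by rewrite expgM (orderXdiv ev) divnK.
have hT : twin X P' a b' c d (s * 2) t.
  have nP'X : X \subset 'N(P').
    apply: (ex_normX hX); apply: hker_norm => //.
    + exact: subsetP nPX _ (ex_b hX).
    + exact: subsetP nPX _ (ex_d hX).
  case: hP => nP PG PH _ cP; split.
  - by rewrite /normal nP'X andbT (subset_trans (hker_sub hv)) ?normal_sub.
  - rewrite b'E (Dh_reflE i (ex_dab hX)); apply/eqP; rewrite eqEsubset; apply/andP; split; last first.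
      rewrite cycle_subG in_setI; apply/andP; split; last by rewrite groupX ?Dh_l.
      by rewrite P'E expgM groupX //= (hom2X _ hv).
    apply/subsetP=> x; rewrite in_setI P'E => /andP[/andP[Px vx] Gx].
    have: x \in P :&: Dh a b by rewrite inE Px.
    rewrite PG => /cycleP[j xE]; move: vx; rewrite xE (hom2X _ hv) // vas andbT => ej.
    by rewrite -[j]odd_double_half (negbTE ej) add0n -mul2n expgM -!expgM mulnA expgM mem_cycle.
  - apply/eqP; rewrite eqEsubset; apply/andP; split; last first.
      by rewrite cycle_subG in_setI P'E Pc vct groupX ?Dh_l.
    by rewrite -PH setSI // hker_sub.
  - exact: P'b'd.
  - by case: hP' => _ c2; move: cP; rewrite -c2 oddas; clear; lia.
have ok' : par_ok b' d (s * 2) t.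
  case: ok => [[es et]|nI]; [left | right]; first by rewrite oddM andbF.
  by rewrite b'E => /(index2_over_refl hX).
have [|r' hr' [r'a r'c r'bd]] := IH P' b' hX' hT ok'.
  by case: hP' => _ <-; have := cardG_gt0 P'; clear; lia.
have nas : {in P', forall y, r' (y ^ (a ^+ s)) = r' y}.
  case: ok => [[es et]|nI].
    move=> y P'y; rewrite (kerQ_act hX' hT hr') //.
    rewrite -[s]odd_double_half (negbTE es) add0n -mul2n expgM groupX //.
    exact: kerQa2 hX' hT.
  have nI' : ~ index2_over X a b' c d by rewrite b'E => /(index2_over_refl hX).
  have [inva _] := act_fix hX' hT nI' hr' r'a r'c.
  have nP'a : a \in 'N(P').
    by apply: subsetP (ex_a hX); case: hT => /normal_norm.
  suff all_k k : {in P', forall y, r' (y ^ (a ^+ k)) = r' y} by apply: all_k.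
  elim: k => [|k IHk] y P'y; first by rewrite conjg1.
  by rewrite expgSr conjgM inva ?IHk // memJ_norm // groupX.
have [||h hh [hE ha]] := hom2_ext hP' Pa _ hr' nas.
  by rewrite P'E Pa vas.
  by rewrite -expgM.
exists h => //; split=> //.
  by rewrite hE // P'E Pc vct.
have hbd : h (a ^+ s * (b * d)) = h (b * d) by rewrite (hh _ _ Pa Pbd) ha.
by have := hE _ P'b'd; rewrite r'bd /b'; case: ifP => // _; rewrite -mulgA hbd.
Qed.

End Descent.

(** The bound on [#|P|] makes P <b> an exact product of smaller order than [X], so it has a nonzero
    homomorphism [u] killing either [a ^+ s] and [b] or [c ^+ t] and [d]. If [u] kills both
    rotations, it is nonzero at b d. Otherwise it is nonzero at exactly one rotation, and
    [inv_or_split] gives a splitting or an invariant homomorphism for [descend]. *)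
Lemma twin_splits (N : nat) X P a b c d s t :
  (forall K a' b' c' d', exact K a' b' c' d' -> #|K| < #|X| -> index2_over K a' b' c' d') ->
  #|P| < N -> #|P| * 2 < #|X| ->
  exact X a b c d -> twin X P a b c d s t -> par_ok X a c b d s t ->
  splits P a b c d s t.
Proof.
move=> IHI; elim: N P a b c d s t => // N IH.
have key P a b c d s t u : #|P| <= N -> (#|P| * 2 < #|X|)%N ->
  exact X a b c d -> twin X P a b c d s t -> par_ok X a c b d s t ->
  hom2 P u -> u (a ^+ s) -> u (c ^+ t) = false -> splits P a b c d s t.
  move=> lP lX hX hP ok hu ua uc.
  have [//|[v hv [[va vc] [[vas vct]|[vas vct]]]]] := inv_or_split hX hP hu ua uc.
    apply: (descend hX hP ok hv va vc vas vct) => P' b' hX' hP' ok' lt.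
    apply: IH => //; first exact: leq_trans lt _.
    by apply: leq_ltn_trans lX; rewrite leq_mul2r /= ltnW.
  have hXC := exactC hX; have hPC := twinC hX hP.
  have okC : par_ok X c a d b t s.
    by case: ok => [[]|nI]; [left | right => /index2_overC].
  apply: splitsC; [exact: ex_dcd hX | exact: ex_dab hX | by case: hPC|].
  apply: (descend hXC hPC okC hv vc va vct vas) => P' b' hX' hP' ok' lt.
  apply: IH => //; first exact: leq_trans lt _.
  by apply: leq_ltn_trans lX; rewrite leq_mul2r /= ltnW.
move=> P a b c d s t; rewrite ltnS => lP lX hX hP ok.
have Pb := twin_b_notin hX hP.
have nPX : X \subset 'N(P) by case: hP => /normal_norm.
have nb := subsetP nPX b (ex_b hX).
have [dab dcd] := (ex_dab hX, ex_dcd hX).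
have Pc : c ^+ t \in P by case: hP => _ _ PG _ _; have := cycle_id (c ^+ t); rewrite -PG => /setIP[].
have Pa : a ^+ s \in P by case: hP => _ PG _ _ _; have := cycle_id (a ^+ s); rewrite -PG => /setIP[].
have Pbd : b * d \in P by case: hP.
pose K := (P <*> <[b]>)%G.
have hK : index2 P K.
  by apply: half_adjoin => //; case: dab => _ -> _.
have sPK : P \subset K by apply: joing_subl.
have Kb : b \in K by rewrite -cycle_subG joing_subr.
have Kd : d \in K by rewrite -(groupMl _ Kb) (subsetP sPK).
have exK : exact K (a ^+ s) b (c ^+ t) d.
  apply: (exact_sub hX); rewrite ?Dh_pow_sub ?Dh_sub ?Kb ?Kd ?(subsetP sPK) //.
  - exact: dihp_pow.
  - exact: dihp_pow.
  - by case: hK => _ <-; case: hP => _ _ _ _ ->; clear; lia.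
have [|K' hK' sub] := IHI K _ _ _ _ exK; first by have [_ cK] := hK; move: lX; rewrite cK.
pose u := fun x => x \notin K'.
have huK : hom2 K u by apply: half_hom2.
have hu : hom2 P u := hom2S sPK huK.
have nsub : ~~ (K \subset K').
  by case: hK' => sK cK; apply/negP=> /subset_leq_card; rewrite -cK; have := cardG_gt0 K'; clear; lia.
have genK x1 x2 x3 x4 : exact K x1 x2 x3 x4 -> x1 \in K' -> x2 \in K' -> x3 \in K' -> x4 \in K' -> K \subset K'.
  by move=> e k1 k2 k3 k4; case: e => _ _ <- _; rewrite mul_subG ?Dh_sub ?k1 ?k2 ?k3.
have ubd : u (b * d) = u b (+) u d by rewrite huK.
case/orP: sub; rewrite Dh_sub => /andP[k1 k2].
  have [uc|/negbTE uc] := boolP (u (c ^+ t)).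
    have hXC := exactC hX; have hPC := twinC hX hP.
    have okC : par_ok X c a d b t s by case: ok => [[]|nI]; [left | right => /index2_overC].
    apply: splitsC; [exact: dcd | exact: dab | by case: hPC|].
    by apply: (key P c d a b t s u); rewrite // /u k1.
  exists u => //; split=> //; first by rewrite /u k1.
  rewrite ubd {1}/u k2 /=; apply: contra nsub => k4.
  by apply: (genK _ _ _ _ exK) => //; apply: negbFE.
have [ua|/negbTE ua] := boolP (u (a ^+ s)).
  by apply: (key P a b c d s t u); rewrite // /u k1.
exists u => //; split=> //; first by rewrite /u k1.
rewrite ubd addbC {1}/u k2 /=; apply: contra nsub => k4.
by apply: (genK _ _ _ _ exK) => //; apply: negbFE.
Qed.

End LemmaR.

(** * The core-free case *)

Section CoreFree.
Variable gT : finGroupType.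
Implicit Types (a b c d x y : gT) (K L X Y M N : {group gT}) (f : gT -> bool).

Lemma hom2_index2_over X a b c d f : exact X a b c d -> hom2 X f ->
  f a = false -> f b = false -> f c || f d -> index2_over X a b c d.
Proof.
move=> hX hf fa fb fcd.
have [x Xx fx] : exists2 x, x \in X & f x.
  by case/orP: fcd => h; [exists c | exists d]; rewrite // ?(ex_c hX) ?(ex_d hX).
exists (hker hf); first exact: hker_half fx.
by rewrite Dh_sub !hkerE fa fb (ex_a hX) (ex_b hX).
Qed.

Lemma ex_mulC X a b c d : exact X a b c d -> Dh c d * Dh a b = X.
Proof. by case/exactC. Qed.

(** For y = h g with h in [Dh c d] and g in [Dh a b], this is the conjugate by g of the trivial
    intersection. *)
Lemma ex_conj X a b c d y : exact X a b c d -> y \in X -> Dh a b :&: Dh c d :^ y = 1.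
Proof.
move=> hX; rewrite -[y \in X]/(y \in (X : {set gT})) -(ex_mulC hX) => /mulsgP[h g Hh Gg ->].
rewrite conjsgM (conjGid Hh) -{1}(conjGid Gg) -conjIg.
by case: hX => _ _ _ ->; rewrite conjs1g.
Qed.

Lemma ex_index X a b c d : exact X a b c d -> #|X : Dh c d| = (#[a] * 2)%N.
Proof.
move=> hX; rewrite -divgS ?(ex_r hX) // (ex_card hX) mulnK ?cardG_gt0 //.
by rewrite (card_Dh (ex_dab hX)).
Qed.

(** [Dh a b] is regular on the cosets of [Dh c d], so only the number of cycles of [x] matters, the
    number of cosets being even. *)
Lemma sg_regular X a b c d x : exact X a b c d -> x \in Dh a b ->
  sgX (Dh c d) X x = odd (#[a] * 2 %/ #[x]).
Proof.
move=> hX Gx; rewrite sgX_semireg ?(ex_r hX) ?(subsetP (ex_l hX)) //.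
  by rewrite (ex_index hX) oddD muln2 odd_double.
move=> y Xy; apply/trivgP; rewrite /= -(ex_conj hX Xy) setSI //.
by rewrite cycle_subG.
Qed.

Lemma sg_a X a b c d : exact X a b c d -> sgX (Dh c d) X a = false.
Proof. by move=> hX; rewrite (sg_regular hX) ?Dh_l // mulKn. Qed.

Lemma sg_b X a b c d : exact X a b c d -> sgX (Dh c d) X b = odd #[a].
Proof. by move=> hX; rewrite (sg_regular hX) ?Dh_r // (dihp_ord (ex_dab hX)) mulnK. Qed.

(** A conjugate of [N] by g h, with g in [Dh a b] and h in [Dh c d], is [N :^ h] and contains K^h =
    K. *)
Lemma core_incl X a b c d N K : exact X a b c d -> Dh a b \subset N ->
  Dh c d \subset 'N(K) -> K \subset N -> K \subset gcore N X.
Proof.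
move=> hX sGN nK sKN; apply/bigcapsP=> x.
case: (hX) => _ _ <- _ /mulsgP[g h Gg Hh ->].
rewrite conjsgM conjGid ?(subsetP sGN) //.
by rewrite -(normP (subsetP nK h Hh)) conjSg.
Qed.

Lemma core_sub X a b c d N K : exact X a b c d -> Dh a b \subset N ->
  Dh c d \subset 'N(K) -> K \subset N -> gcore N X = 1 -> K :=: 1.
Proof. by move=> hX sGN nK sKN core; apply/trivgP; rewrite /= -core; apply: (core_incl hX). Qed.

(** The rotations of [Dh c d] in [N] form a normal subgroup of [Dh c d], which lies in the core and
    is trivial. So [Dh c d :&: N] has at most one element besides 1, a reflection. *)
Lemma core_over X a b c d N : exact X a b c d -> maximal N X -> gcore N X = 1 ->
  Dh a b \subset N ->
  N = Dh a b \/ exists d0, [/\ d0 \in Dh c d, d0 \notin <[c]>, d0 \in N,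
     (N : {set gT}) = <[d0]> * Dh a b & #|N| = (4 * #[a])%N].
Proof.
move=> hX maxN core sGN; have dcd := ex_dcd hX; have dab := ex_dab hX.
have sNX : N \subset X by case/maxgroupP: maxN => /proper_sub.
have [NE cN] := ex_modl hX sGN sNX.
have EC : (Dh c d :&: N) :&: <[c]> = 1.
  apply: (core_sub hX sGN _ _ core); last by rewrite /= -setIA setICA subsetIl.
  by apply: normal_norm; apply: cyc_norm_Dh dcd _; apply: subsetIr.
case: (boolP (Dh c d :&: N \subset <[c]>)) => sC.
  left; apply/val_inj; rewrite /= NE; have -> : Dh c d :&: N = 1; last by rewrite mul1g.
  by rewrite -EC; apply/esym/setIidPl.
right; case/subsetPn: sC => d0 Ed0 Cd0; exists d0.
case: (setIP Ed0) => Hd0 Nd0.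
have [E cE] := @sub_Dh _ c d (Dh c d :&: N)%G d0 dcd (subsetIl _ _) Ed0 Cd0.
rewrite /= EC mul1g cards1 mul1n in E cE.
split=> //; first by rewrite NE E.
by rewrite cN cE card_Dh //; clear; lia.
Qed.

(** If [Dh a b] has index 2 in [N], the conjugates of [a] under [N] stay in it and have order above
    2, so they are rotations. An element d0 g squares to g^d0 g, a product of two rotations or of
    two reflections. *)
Lemma core_over_norm X a b c d N : exact X a b c d -> maximal N X -> gcore N X = 1 ->
  Dh a b \subset N -> N = Dh a b \/ 2 < #[a] ->
  <[a]> <| N /\ {in N, forall y, y ^+ 2 \in <[a]>}.
Proof.
move=> hX maxN core sGN alt; have dab := ex_dab hX.
have nAG : <[a]> <| Dh a b by apply: cyc_norm_Dh dab _; apply: subxx.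
case: (core_over hX maxN core sGN) => [->|[d0 [Hd0 Cd0 Nd0 NE cN]]].
  by split=> // y; apply: Dh_sq.
have a3 : 2 < #[a].
  case: alt => // NG; move: cN; rewrite NG card_Dh //; have := order_gt0 a; clear; lia.
have d02 : d0 ^+ 2 = 1 by apply: Dh_sq_refl Hd0 Cd0; apply: ex_dcd hX.
have nGN : Dh a b <| N.
  apply: index2_normal => //; rewrite -divgS // cN card_Dh // -[(4 * _)%N]mulnC.
  by have := order_gt0 a; rewrite (_ : 4 = 2 * 2)%N // mulnA mulKn ?muln_gt0 ?order_gt0.
have nA x : x \in N -> <[a]> :^ x = <[a]>.
  move=> Nx; rewrite -cycleJ; apply/eqP; rewrite eqEcard -!orderE orderJ leqnn andbT cycle_subG.
  have Gax : a ^ x \in Dh a b by rewrite memJ_norm ?Dh_l // (subsetP (normal_norm nGN)).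
  case Aax: (a ^ x \in <[a]>) => //; have := Dh_sq_refl dab Gax (negbT Aax).
  move/eqP; rewrite -order_dvdn orderJ => /dvdn_leq; move: a3; clear; lia.
have nAN : <[a]> <| N.
  rewrite /normal cycle_subG (subsetP sGN) ?Dh_l //=.
  by apply/normsP=> x; apply: nA.
split=> // y; rewrite -[y \in N]/(y \in (N : {set gT})) NE => /mulsgP[u g].
have o2 : #[d0] = 2.
  by apply: nt_prime_order => //; apply: contraNneq Cd0 => ->.
rewrite (cycle2g o2) !inE => /orP[]/eqP -> Gg ->; first by rewrite mul1g (Dh_sq dab).
have nd0 : d0 \in 'N(<[a]>) by rewrite (subsetP (normal_norm nAN)).
have -> : (d0 * g) ^+ 2 = g ^ d0 * g.
  have d0V : d0^-1 = d0 by apply/eqP; rewrite eq_invg_mul -expg2 d02.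
  by rewrite expg2 conjgE d0V !mulgA.
case Ag: (g \in <[a]>); first by rewrite groupM // memJ_norm.
have Ggd : g ^ d0 \in Dh a b by rewrite memJ_norm // (subsetP (normal_norm nGN)).
have Agd : g ^ d0 \notin <[a]> by rewrite memJ_norm // Ag.
have [j ->] := Dh_out dab Ggd Agd; have [i ->] := Dh_out dab Gg (negbT Ag).
rewrite -mulgA (mulgA b) (Dh_refl_conj _ dab) -mulgA -expg2.
by case: dab => _ -> _; rewrite mulg1 groupM ?groupV ?mem_cycle.
Qed.

End CoreFree.

Section Tight.
Variable gT : finGroupType.
Implicit Types (a b c d x y : gT) (K L X Y M N : {group gT}) (f : gT -> bool).

(* With two orbits of C on the cosets of H, one of them regular of odd size,
   the reflection d fixes exactly two cosets. *)
Lemma two_orbits_sg X a b c d : exact X a b c d -> maximal (Dh c d) X ->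
  gcore (Dh c d) X = 1 -> odd #[c] -> 1 < #[c] ->
  #|cosorb (Dh c d) X <[c]>| = 2 -> #|X : Dh c d| = (1 + #[c])%N ->
  sgX (Dh c d) X d = odd (#[a] + 1).
Proof.
move=> hX maxH core oc c1 orb2 iH; have dcd := ex_dcd hX; have dab := ex_dab hX.
set H := Dh c d in maxH core orb2 iH *; set S := rcosets H X.
have sHX : H \subset X := ex_r hX.
have sCH : <[c]> \subset H := cyc_Dh c d.
have sCX : <[c]> \subset X := subset_trans sCH sHX.
have Xd := ex_d hX.
have sdX : <[d]> \subset X by rewrite cycle_subG.
have P := orbit_partition (acts_cos H sdX).
set O := cosorb H X <[d]>.
pose O1 := [set o in O | #|o| == 1%N].
have od : #[d] = 2 := dihp_ord dcd.
have cardO o : o \in O -> #|o| = 1%N \/ #|o| = 2.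
  case/imsetP=> A _ ->; have p2 : prime 2 by [].
  have /primeP[_ h] := p2; have := dvdn_indexg <[d]> 'C_(<[d]>)[A | 'Rs].
  by rewrite -card_orbit -orderE od => /h /pred2P[]; [left | right].
have cO1 : O :&: O1 = O1 by apply/setIidPr; apply/subsetP=> o; rewrite inE => /andP[].
have sumS : (#|X : H| = #|O1| + 2 * #|O :\: O1|)%N.
  rewrite /indexg (card_partition P) (big_setID O1) /= cO1; congr (_ + _)%N.
    by rewrite -sum1_card; apply: eq_bigr => o; rewrite inE => /andP[_ /eqP].
  rewrite mulnC -sum_nat_const; apply: eq_bigr => o; rewrite !inE => /andP[n1 Oo].
  by rewrite Oo /= in n1; case: (cardO o Oo) => // e; rewrite e in n1.
have cO : #|O| = (#|O1| + #|O :\: O1|)%N by rewrite -(cardsID O1 O) cO1.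
have SH : (H : {set gT}) \in S by apply/rcosetsP; exists 1; rewrite ?group1 ?mulg1.
have fixO1 o : o \in O1 -> exists A, [/\ A \in S, o = [set A] & A :* d = A].
  rewrite inE => /andP[/imsetP[A SA ->] /cards1P[B E]]; exists A.
  have AB : A = B by apply/set1P; rewrite -E orbit_refl.
  rewrite E AB; split=> //; first by rewrite -AB.
  by apply/set1P; rewrite -E -AB -rcosetE; apply: mem_orbit; apply: cycle_id.
have HO1 : [set (H : {set gT})] \in O1.
  rewrite inE cards1 eqxx andbT; apply/imsetP; exists (H : {set gT}) => //.
  apply/setP=> B; rewrite inE; apply/eqP/orbitP => [->|[g dg <-]].
    by exists 1; rewrite ?group1 //= rcosetE mulg1.
  by rewrite /= rcosetE rcoset_id //; apply: subsetP dg; rewrite cycle_subG Dh_r.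
(* The number of cosets is even, so the number of those fixed by [d] is even too, and [H] is one of
   them. *)
have [A0 [SA0 A0H A0O A0d]] : exists A0, [/\ A0 \in S, A0 != H, [set A0] \in O1 & A0 :* d = A0].
  have c2 : 1 < #|O1|.
    have ev : ~~ odd #|O1|.
      by have := congr1 odd sumS; rewrite (ex_index hX) oddD !oddM andbF addbF => <-.
    have pos : 0 < #|O1| by apply/card_gt0P; exists [set (H : {set gT})].
    by move: ev pos; case: #|O1| => [|[|]].
  have /subsetPn[o Oo] : ~~ (O1 \subset [set [set (H : {set gT})]]).
    by apply/negP=> /subset_leq_card; rewrite cards1 leqNgt c2.
  rewrite inE => oH; have [A [SA oE Ad]] := fixO1 o Oo.
  exists A; split=> //; last by rewrite -oE.
  by apply: contra oH => /eqP <-; rewrite oE.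
have [x Xx A0E] := rcosetsP SA0.
have Hx : x \notin H by apply: contra A0H => Hx; rewrite A0E rcoset_id.
have orbH : orbit 'Rs <[c]> H = [set (H : {set gT})].
  apply/setP=> B; rewrite inE; apply/orbitP/eqP => [[g Cg <-]|->].
    by rewrite /= rcosetE rcoset_id // (subsetP sCH).
  by exists 1; rewrite ?group1 //= rcosetE mulg1.
have one (A : {set gT}) : A \in S -> A != H -> orbit 'Rs <[c]> A = orbit 'Rs <[c]> A0.
  move=> SA AH; have /cards2P[o1 [o2 [_ E]]] : #|cosorb H X <[c]>| == 2 by rewrite orb2.
  have inO (B : {set gT}) : B \in S -> (orbit 'Rs <[c]> B == o1) || (orbit 'Rs <[c]> B == o2).
    by move=> SB; have := imset_f (orbit 'Rs <[c]>) SB; rewrite -/(cosorb H X <[c]>) E !inE.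
  have ne (B : {set gT}) : B != H -> orbit 'Rs <[c]> B != orbit 'Rs <[c]> H.
    apply: contra => /eqP eB; have : B \in orbit 'Rs <[c]> H by rewrite -eB orbit_refl.
    by rewrite orbH inE.
  have := ne _ AH; have := ne _ A0H.
  case/orP: (inO _ SH) => /eqP ->; case/orP: (inO _ SA) => /eqP ->;
  case/orP: (inO _ SA0) => /eqP ->; by rewrite ?eqxx.
have O12 : O1 = [set [set (H : {set gT})]; [set A0]].
  apply/eqP; rewrite eqEsubset; apply/andP; split; last first.
    by apply/subsetP=> o; rewrite !inE => /orP[]/eqP ->; [move: HO1 | move: A0O]; rewrite inE.
  apply/subsetP=> o Oo; have [A [SA oE Ad]] := fixO1 o Oo.
  rewrite oE !inE; case: (eqVneq A H) => [->|AH]; first by rewrite eqxx.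
  apply/orP; right; apply/eqP; congr [set _].
  have: A \in orbit 'Rs <[c]> A0 by rewrite -(one A SA AH) orbit_refl.
  case/orbitP=> y /cycleP[i ->] /=; rewrite rcosetE => AE.
  (* If [d] fixes both A0 and A0 c^i, then c^(2 i) fixes A0. The stabilizer of A0 in [<[c]>] is
     trivial and [#[c]] is odd, so c^i = 1. *)
  have dci : c ^+ i * d = d * c ^- i.
    rewrite -[LHS](mulKg d) (mulgA d) (Dh_refl_conj _ dcd) -mulgA -expg2.
    by case: (dcd) => _ -> _; rewrite mulg1 (dihpV dcd).
  have e1 : A0 :* (c ^+ i * c ^+ i) = A0.
    have e2 : A0 :* (c ^+ i * d) = A0 :* c ^+ i by rewrite rcosetM AE.
    by rewrite rcosetM -e2 -rcosetM dci -mulgA mulVg mulg1.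
  have: c ^+ i * c ^+ i \in <[c]> :&: H :^ x.
    rewrite inE groupM ?mem_cycle //=; have: x * (c ^+ i * c ^+ i) \in H :* x.
      by rewrite -A0E -e1 A0E -rcosetM rcoset_refl.
    by rewrite mem_rcoset mem_conjg conjgE invgK !mulgA.
  have ntC : [group of <[c]>] != 1%G.
    by apply: contraTneq c1 => E; rewrite orderE -[<[c]>]/(gval [group of <[c]>]) E cards1.
  have [cap1|[_]] := @corefree_cap _ X H [group of <[c]>] maxH core (cycle_cyclic c) (cyc_norm_Dh dcd (subxx _)) (fun y => @Dh_sq _ c d y dcd) ntC x Xx Hx; last by rewrite -orderE oc.
  have -> : <[c]> :&: H :^ x = 1.
    by apply/eqP; rewrite trivg_card1 cap1.
  rewrite inE -expgD addnn -muln2 -order_dvdn Gauss_dvdl ?coprimen2 //.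
  by rewrite order_dvdn => /eqP ci; rewrite -AE ci mulg1.
have cO12 : #|O1| = 2.
  rewrite O12 cards2; case: eqP => // /set1_inj E.
  by case/eqP: A0H.
have iE : #|X : H| = (#[a] * 2)%N := ex_index hX.
move: sumS cO; rewrite cO12 iE; set z := #|O :\: O1| => zE cO.
have -> : sgX H X d = odd (#|X : H| + #|O|)%N by exact: erefl.
rewrite iE cO; have -> : #[a] = (1 + z)%N by move: zE; clear; lia.
by rewrite !oddD oddM andbF; case: (odd z).
Qed.

End Tight.

(** * Excluding core-free maximal subgroups over both factors *)

Section Alpha.
Variable gT : finGroupType.
Implicit Types (a b c d x y : gT) (K L X Y M N : {group gT}) (f : gT -> bool).

Lemma cyc_nt c : 1 < #[c] -> [group of <[c]>] != 1%G.
Proof. by apply: contraTneq => E; rewrite orderE -[<[c]>]/(gval [group of <[c]>]) E cards1. Qed.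

Lemma order5_invol x y : #[x] = 5 -> y ^+ 2 = 1 -> x ^ y \in <[x]> ->
  x ^ y = x \/ x ^ y = x^-1.
Proof.
move=> o5 y2 /cycleP[j xy].
have xjj : x ^+ (j * j) = x ^+ 1.
  by rewrite expgM -{1}xy -conjXg -xy -conjgM -expg2 y2 conjg1.
have mj : x ^+ j = x ^+ (j %% 5) by rewrite -o5 -expg_mod_order.
have : j * j == 1 %[mod 5] by rewrite -o5 -eq_expg_mod_order xjj.
rewrite -modnMm xy mj; have : j %% 5 < 5 by rewrite ltn_mod.
have x5 : x ^+ 5 = 1 by rewrite -o5 expg_order.
case: (j %% 5) => [|[|[|[|[|]]]]] //= _ _; [by left|right].
by apply/eqP; rewrite eq_sym eq_invg_mul -expgS x5.
Qed.

(* The exceptional parameters: N has order 20 and index 6, and an element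
   outside A centralizes A, which is regular on the other five cosets. *)
Lemma no_order_120 X N a b d0 : maximal N X -> gcore N X = 1 -> dihp a b ->
  Dh a b \subset N -> #[a] = 5 -> <[a]> <| N -> {in N, forall y, y ^+ 2 \in <[a]>} ->
  d0 \in N -> d0 \notin Dh a b -> d0 ^+ 2 = 1 -> #|X : N| = 6 -> False.
Proof.
move=> maxN core dab sGN a5 nAN sq Nd0 Gd0 d02 iN.
have sNX : N \subset X by case/maxgroupP: maxN => /proper_sub.
have sAN : <[a]> \subset N := normal_sub nAN.
have sAG : <[a]> \subset Dh a b := cyc_Dh a b.
have [e [Ne Ge ae]] : exists e, [/\ e \in N, e \notin Dh a b & a ^ e = a].
  have Aad : a ^ d0 \in <[a]> by rewrite memJ_norm ?cycle_id // (subsetP (normal_norm nAN)).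
  case: (order5_invol a5 d02 Aad) => E; first by exists d0.
  (* If [d0] inverts [a], then [b * d0] centralizes it. *)
  exists (b * d0); split; first by rewrite groupM // (subsetP sGN) ?Dh_r.
    by rewrite (groupMl _ (Dh_r a b)).
  by rewrite conjgM; case: dab => _ _ ->; rewrite conjVg E invgK.
have a1 : 1 < #[a] by rewrite a5.
have [x [Xx Nx I]] := @corefree_ex _ X N [group of <[a]>] maxN core (cycle_cyclic a) nAN sq (cyc_nt a1).
have sAX : <[a]> \subset X := subset_trans sAN sNX.
have cosx y : y \in X -> y \notin N -> exists k, N :* y = N :* (x * a ^+ k).
  move=> Xy Ny; pose o := orbit 'Rs <[a]> (N :* x).
  have co : #|o| = 5 by rewrite card_orbit stab_rcos I indexg1 -orderE.
  have so : o \subset rcosets N X :\ (N : {set gT}).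
    apply/subsetP=> A Ao; rewrite !inE; apply/andP; split; last first.
      apply: subsetP Ao; rewrite acts_sub_orbit ?acts_cos //.
      by apply/rcosetsP; exists x.
    case/orbitP: Ao => g Ag <-; rewrite /= rcosetE -rcosetM; apply/eqP=> E.
    have: x * g \in N by rewrite -E rcoset_refl.
    by rewrite groupMr ?(negbTE Nx) // (subsetP sAN).
  have eo : o = rcosets N X :\ (N : {set gT}).
    apply/eqP; rewrite eqEcard so co.
    have := cardsD1 (N : {set gT}) (rcosets N X).
    have -> : (N : {set gT}) \in rcosets N X by apply/rcosetsP; exists 1; rewrite ?group1 ?mulg1.
    rewrite -[#|rcosets N X|]/(#|X : N|) iN; set z := #|_ :\ _|.
    by move=> E; rewrite -ltnS -[z.+1]/(true + z)%N -E.
  have: N :* y \in o.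
    rewrite eo !inE; apply/andP; split; last by apply/rcosetsP; exists y.
    by apply: contra Ny => /eqP E; have : y \in N by rewrite -E rcoset_refl.
  by case/orbitP=> g /cycleP[k ->] <-; exists k; rewrite /= rcosetE -rcosetM.
have [k kE] : exists k, N :* (x * e) = N :* (x * a ^+ k).
  apply: cosx; first by rewrite groupM // (subsetP sNX).
  by rewrite groupMr.
(* The power of [a] is chosen to make [e'] fix the coset [N :* x]. Commuting with [a], it then fixes
   the whole orbit of that coset, and so lies in the core. *)
pose e' := e * a ^- k.
have ce : commute a e by apply/commgP/conjg_fixP.
have ce' i : a ^+ i * e' = e' * a ^+ i.
  apply/commute_sym/commuteX/commute_sym; rewrite /e'.
  by apply: commuteM => //; apply/commuteV/commuteX.
have fx : N :* (x * e') = N :* x.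
  by rewrite /e' mulgA rcosetM kE -rcosetM mulgK.
have Ne' : e' \in N by rewrite groupM ?groupV ?groupX // (subsetP sAN) ?cycle_id.
have e1 : e' = 1.
  suff : e' \in gcore N X by rewrite core inE => /eqP.
  apply/bigcapP=> y Xy; case Ny: (y \in N); first by rewrite conjGid.
  have [i iE'] := cosx y Xy (negbT Ny).
  have fy : N :* (y * e') = N :* y.
    by rewrite rcosetM iE' -rcosetM -mulgA ce' mulgA rcosetM fx -rcosetM.
  have: y * e' \in N :* y by rewrite -fy rcoset_refl.
  by rewrite mem_rcoset mem_conjg conjgE invgK !mulgA.
case/negP: Ge; have -> : e = a ^+ k by apply/eqP; rewrite eq_mulgV1 -/e' e1.
by rewrite groupX ?Dh_l.
Qed.

(** As [#[a] <= #[c]], the count 2 #[a] = 1 + u #[c] + v #[c] / 2 leaves u = 1 and v = 0 or 1. If v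
    = 0, then [a] and [c] act evenly and exactly one of [b] and [d] oddly. If v = 1, then [c] acts
    oddly and [a] evenly, so [b] must act oddly and [#[a]] is odd; the relation 4 #[a] = 2 + 3 #[c]
    is then confronted with the count for [N]. *)
Lemma corefree_maximal_false X a b c d N : exact X a b c d -> ~ index2_over X a b c d ->
  maximal (Dh c d) X -> gcore (Dh c d) X = 1 -> 1 < #[c] -> #[a] <= #[c] ->
  maximal N X -> gcore N X = 1 -> Dh a b \subset N -> False.
Proof.
move=> hX nI maxH coreH c1 ac maxN coreN sGN.
have [dab dcd] := (ex_dab hX, ex_dcd hX).
have nCH := cyc_norm_Dh dcd (subxx <[c]>).
have [u [v [iE0 oE0 u0 vodd0]]] := @corefree_count _ X (Dh c d) [group of <[c]>] maxH coreH (cycle_cyclic c) nCH (fun y => @Dh_sq _ c d y dcd) (cyc_nt c1).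
have iE : #|X : Dh c d| = (1 + #[c] * u + #[c]./2 * v)%N := iE0.
have oE : #|cosorb (Dh c d) X <[c]>| = (1 + u + v)%N := oE0.
have vodd : odd #[c] -> v = 0 := vodd0.
have sgh := @sgX_hom2 gT (Dh c d) X.
have fa := sg_a hX; have fb := sg_b hX.
have c2 := odd_double_half #[c].
have iX := ex_index hX.
rewrite iX in iE.
have u1 : u = 1%N.
  move: iE ac u0 c1; clear; case: u => [|[|u]] //; nia.
have fcE : sgX (Dh c d) X c = odd (#[a] * 2 + (1 + u + v)) by rewrite /sgX iX oE.
rewrite u1 in iE oE fcE.
case v0: (v == 0)%N.
  rewrite (eqP v0) in iE oE fcE.
  have oc : odd #[c].
    by move: iE; rewrite muln1 muln0; clear; lia.
  have sd : sgX (Dh c d) X d = odd (#[a] + 1).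
    apply: (two_orbits_sg hX maxH coreH oc c1 oE); rewrite iX iE; clear; lia.
  have fc : sgX (Dh c d) X c = false by rewrite fcE !oddD oddM andbF.
  apply: nI; case oa: (odd #[a]).
    apply: index2_overC; apply: (hom2_index2_over (exactC hX) sgh) => //; last by rewrite fb oa orbT.
    by rewrite sd oddD oa.
  by apply: (hom2_index2_over hX sgh) => //; rewrite ?fb // sd oddD oa orbT.
have ec : ~~ odd #[c] by apply/negP=> /vodd z; rewrite z in v0.
have ec' : #[c] = (2 * (#[c])./2)%N by rewrite -[LHS]c2 (negbTE ec) add0n mul2n.
have v1 : v = 1%N.
  move: iE ac c1 v0 ec'; set h := (#[c])./2; clear; case: v => [|[|v]] //; nia.
rewrite v1 in iE fcE vodd.
have fc : sgX (Dh c d) X c by rewrite fcE !oddD oddM andbF.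
case oa: (odd #[a]); last by apply: nI; apply: (hom2_index2_over hX sgh); rewrite ?fb ?fc.
have a3 : 2 < #[a] by move: iE ec' c1 oa; clear; case: #[a] => [|[|[|]]] //; lia.
have [nAN sqN] := core_over_norm hX maxN coreN sGN (or_intror a3).
have [u' [v' [iE' _ u0' vodd']]] := @corefree_count _ X N [group of <[a]>] maxN coreN (cycle_cyclic a) nAN sqN (cyc_nt (ltnW a3)).
rewrite /= -!orderE in iE' vodd'; rewrite (vodd' oa) muln0 addn0 in iE'.
case: (core_over hX maxN coreN sGN) => [NE|[d0 [Hd0 Cd0 Nd0 NE cN]]].
  have i2 : #|X : N| = (#[c] * 2)%N by rewrite NE (ex_index (exactC hX)).
  rewrite i2 in iE'.
  (* That is, #[a] (8 - 3 u') = 7, which has no solution with [#[a]] at least 3. *)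
  have k : (#[a] * 8 = 7 + 3 * (#[a] * u'))%N by move: iE iE' ec'; clear; lia.
  move: k a3 oa; clear; case: u' => [|[|[|u]]]; nia.
have iN : (#|X : N| * 2 = #[c] * 2)%N.
  have L := Lagrange (_ : N \subset X); have sNX : N \subset X by case/maxgroupP: maxN => /proper_sub.
  have := L sNX; rewrite cN (ex_card4 hX); have := order_gt0 a; set z := #|X : N|; clear; nia.
(* That is, #[a] (4 - 3 u') = 5, so #[a] = 5 and u' = 1; then #[c] = 6 and [X] has order 120. *)
have k : (#[a] * 4 = 5 + 3 * (#[a] * u'))%N.
  move: iE iE' ec' iN; set z := #|X : N|; clear; lia.
have [a5 u'1] : #[a] = 5 /\ u' = 1%N.
  move: k a3; clear; case: u' => [|[|u]]; nia.
apply: (@no_order_120 X N a b d0 maxN coreN dab sGN a5 nAN sqN Nd0).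
- apply: contra Cd0 => Gd0; have: d0 \in Dh a b :&: Dh c d by rewrite inE Gd0.
  by case: hX => _ _ _ ->; rewrite inE => /eqP ->; apply: group1.
- exact: Dh_sq_refl dcd Hd0 Cd0.
- by rewrite iE' u'1 a5.
Qed.

(** If neither maximal subgroup is a dihedral factor, then |X : M| = #[a] and |X : N| = #[c], and
    [corefree_leq] gives #[c] < #[a] and #[a] < #[c]. If just one is, the inequality for the other
    gives the comparison that [corefree_maximal_false] needs. A factor whose rotation has order 2 is
    abelian, which forces the maximal subgroup over the opposite factor to be that factor. *)
Lemma corefree_false X a b c d M N : exact X a b c d -> 1 < #[a] -> 1 < #[c] ->
  maximal M X -> gcore M X = 1 -> Dh c d \subset M ->
  maximal N X -> gcore N X = 1 -> Dh a b \subset N -> ~ index2_over X a b c d -> False.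
Proof.
move=> hX a1 c1 maxM coreM sHM maxN coreN sGN nI.
have hXC := exactC hX; have nIC : ~ index2_over X c d a b by move/index2_overC.
have [dab dcd] := (ex_dab hX, ex_dcd hX).
have caseH : M = Dh c d -> #[a] <= #[c] -> False.
  move=> E le; rewrite E in maxM coreM.
  exact: (corefree_maximal_false hX nI maxM coreM c1 le maxN coreN sGN).
have caseG : N = Dh a b -> #[c] <= #[a] -> False.
  move=> E le; rewrite E in maxN coreN.
  exact: (corefree_maximal_false hXC nIC maxN coreN a1 le maxM coreM sHM).
have small K Y a' b' c' d' : exact Y a' b' c' d' -> maximal K Y -> gcore K Y = 1 ->
    Dh a' b' \subset K -> #[c'] = 2 -> K = Dh a' b'.
  move=> hY maxK coreK sG c2; apply/val_inj => /=.
  have sKY : K \subset Y by case/maxgroupP: maxK => /proper_sub.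
  have [KE _] := ex_modl hY sG sKY.
  rewrite KE; have -> : Dh c' d' :&: K = 1; last by rewrite mul1g.
  have aH : abelian (Dh c' d').
    by apply: (@card_p2group_abelian _ 2) => //; rewrite (card_Dh (ex_dcd hY)) c2.
  apply: (core_sub hY sG _ (subsetIr _ _) coreK).
  by apply: sub_abelian_norm aH (subsetIl _ _).
have [c2|c2] := ltnP 2 #[c]; last first.
  have c2' : #[c] = 2 by apply/eqP; rewrite eqn_leq c2.
  by apply: caseG; rewrite ?c2' //; apply: small hX maxN coreN sGN c2'.
have [a2|a2] := ltnP 2 #[a]; last first.
  have a2' : #[a] = 2 by apply/eqP; rewrite eqn_leq a2.
  by apply: caseH; rewrite ?a2' //; apply: small hXC maxM coreM sHM a2'.
have [nCM sqM] := core_over_norm hXC maxM coreM sHM (or_intror c2).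
have [nAN sqN] := core_over_norm hX maxN coreN sGN (or_intror a2).
have leC := @corefree_leq _ X M [group of <[c]>] maxM coreM (cycle_cyclic c) nCM sqM (cyc_nt c1).
have leA := @corefree_leq _ X N [group of <[a]>] maxN coreN (cycle_cyclic a) nAN sqN (cyc_nt a1).
rewrite /= -!orderE in leC leA.
have idx K : K \subset X -> #|K| = (4 * #[a])%N -> (#|X : K| = #[c])%N.
  move=> sK cK; have := Lagrange sK; rewrite cK (ex_card4 hX).
  have := order_gt0 a; set z := #|X : K|; clear; nia.
have idx' K : K \subset X -> #|K| = (4 * #[c])%N -> (#|X : K| = #[a])%N.
  move=> sK cK; have := Lagrange sK; rewrite cK (ex_card4 hX).
  have := order_gt0 c; set z := #|X : K|; clear; nia.
have sMX : M \subset X by case/maxgroupP: maxM => /proper_sub.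
have sNX : N \subset X by case/maxgroupP: maxN => /proper_sub.
case: (core_over hX maxN coreN sGN) => [NE|[d0 [_ _ _ _ cN]]];
case: (core_over hXC maxM coreM sHM) => [ME|[b0 [_ _ _ _ cM]]].
- by case: (leqP #[a] #[c]) => h; [apply: caseH | apply: caseG => //; apply: ltnW].
- by apply: caseG => //; apply: ltnW; rewrite -(idx' M).
- by apply: caseH => //; apply: ltnW; rewrite -(idx N).
- by rewrite (idx' M) // in leC; rewrite (idx N) // in leA; move: leC leA; clear; lia.
Qed.

End Alpha.

(** * Passing to a quotient *)

Section Factor.
Variable gT : finGroupType.
Implicit Types (a b c d x y : gT) (K L X Y M N R : {group gT}).

Lemma index2_over_dec X a b c d : index2_over X a b c d \/ ~ index2_over X a b c d.
Proof.
case: (boolP [exists K : {group gT}, [&& K \subset X, (#|K| * 2 == #|X|)%N &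
   (Dh a b \subset K) || (Dh c d \subset K)]]) => [/existsP[K /and3P[sK /eqP cK sub]]|nE].
  by left; exists K.
right=> -[K [sK cK] sub]; case/negP: nE; apply/existsP; exists K.
by rewrite sK cK eqxx.
Qed.

Lemma index2_joing X R K : K \subset X -> R <| X ->
  (#|K| * #|R| * 2 = #|X| * #|R :&: K|)%N -> index2 (K <*> R)%G X.
Proof.
move=> sK nR e; split; first by rewrite join_subG sK normal_sub.
rewrite /= norm_joinEl; last exact: subset_trans sK (normal_norm nR).
have := mul_cardG K R; rewrite setIC => e2.
have p : 0 < #|R :&: K| by apply: cardG_gt0.
by apply/eqP; rewrite -(eqn_pmul2r p) -e mulnAC -e2.
Qed.

Section OneSide.
Variables (X R : {group gT}) (a b c d : gT).
Hypothesis hX : exact X a b c d.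
Hypothesis nR : R <| X.
Hypothesis fR : #|R| = (#|R :&: Dh a b| * #|R :&: Dh c d|)%N.

(** A reflection x in [R] puts a^2 = x x^a in [R]. So either [R] contains [Dh a b], or
    [R :&: Dh a b] has index 2 in it, and then the product of [Dh c d] and [R] has index 2 in
    [X]. *)
Lemma factor_refl : ~~ (R :&: Dh a b \subset <[a]>) -> index2_over X a b c d \/ Dh a b \subset R.
Proof.
have [dab dcd] := (ex_dab hX, ex_dcd hX).
case/subsetPn=> x /setIP[Rx Gx] Ax.
have [dax DE] := Dh_out_dihp dab Gx Ax.
have na : a \in 'N(R) := subsetP (normal_norm nR) _ (ex_a hX).
have a2 : a ^+ 2 = x * x ^ a.
  have [_ _ ax] := dax; rewrite conjgE !mulgA.
  have -> : x * a^-1 * x = a by rewrite -{1}(dihpV dax) -mulgA -conjgE conjVg ax invgK.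
  by rewrite expg2.
have Ra2 : a ^+ 2 \in R by rewrite a2 groupM // memJ_norm.
case Ra: (a \in R); first by right; rewrite -DE Dh_sub Ra.
left; exists (Dh c d <*> R)%G; last by rewrite joing_subl orbT.
apply: index2_joing => //; first exact: ex_r hX.
have iG : index2 (R :&: Dh a b)%G (Dh a b).
  have k1 : a \in 'N(R :&: Dh a b).
    rewrite inE; apply/subsetP=> y /imsetP[z /setIP[Rz Gz] ->].
    by rewrite inE memJ_norm // Rz groupJ ?Dh_l.
  have k2 : a \notin R :&: Dh a b by rewrite inE Ra.
  have k3 : a ^+ 2 \in R :&: Dh a b by rewrite inE Ra2 groupX ?Dh_l.
  have k4 : (Dh a b : {set gT}) = (R :&: Dh a b) <*> <[a]>.
    apply/eqP; rewrite eqEsubset join_subG subsetIr cycle_subG Dh_l !andbT.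
    rewrite -{1}DE Dh_sub -cycle_subG joing_subr.
    by rewrite (subsetP (joing_subl _ _)) // inE Rx.
  exact: (@half_outside _ (R :&: Dh a b)%G (Dh a b) a (subsetIr _ _) k1 k2 k3 k4).
have cG : (#|R :&: Dh a b| * 2 = #|Dh a b|)%N by case: iG.
rewrite fR (ex_card hX) -cG; clear; lia.
Qed.

Lemma factor_full : Dh a b \subset R -> ~~ (X \subset R) -> R :&: Dh c d \subset <[c]> ->
  index2_over X a b c d.
Proof.
move=> sGR nXR sC; have [dab dcd] := (ex_dab hX, ex_dcd hX).
exists (<[c]> <*> R)%G; last by rewrite (subset_trans sGR) ?joing_subr.
apply: index2_joing; rewrite ?cycle_subG ?(ex_c hX) //.
have -> : R :&: <[c]> = R :&: Dh c d.
  apply/eqP; rewrite eqEsubset setIS ?cyc_Dh //= subsetI subsetIl //.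
by rewrite fR (setIidPr sGR) (ex_card hX) [#|Dh c d|](card_Dh dcd) -orderE; clear; lia.
Qed.

End OneSide.

Lemma card_quo R K : K \subset 'N(R) -> (#|K / R| * #|R :&: K| = #|K|)%N.
Proof.
move=> nK; have p : 0 < #|R| by apply: cardG_gt0.
have nY : K <*> R \subset 'N(R) by rewrite join_subG nK normG.
have := Lagrange (joing_subr K R); rewrite /= -(card_quotient nY) quotientYidr //= norm_joinEl // => L.
have := mul_cardG K R; rewrite -L setIC => e.
by apply/eqP; rewrite -(eqn_pmul2r p) e mulnC mulnA.
Qed.

Lemma quo_Dh R a b : a \in 'N(R) -> b \in 'N(R) ->
  Dh a b / R = Dh (coset R a) (coset R b).
Proof.
move=> na nb; rewrite !Dh_unlock /quotient /= morphim_gen ?subUset ?sub1set ?na //.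
by rewrite morphimU !morphim_set1.
Qed.

Lemma quo_dihp R a b : dihp a b -> a \in 'N(R) -> b \in 'N(R) ->
  R :&: Dh a b \subset <[a]> -> dihp (coset R a) (coset R b).
Proof.
move=> dab na nb sR; case: (dab) => Ab b2 ab; split.
- apply: contra Ab => /cycleP[i]; rewrite -morphX // => e.
  have: b * a ^- i \in R.
    by apply: coset_idr; rewrite ?groupM ?groupV ?groupX // morphM ?groupV ?groupX //= e morphV ?groupX //= mulgV.
  move=> Rb; have: b * a ^- i \in R :&: Dh a b by rewrite inE Rb groupM ?Dh_r ?groupV ?groupX ?Dh_l.
  by move/(subsetP sR); rewrite groupMr // groupV mem_cycle.
- by rewrite -morphX // b2 morph1.
- by rewrite -morphJ // ab morphV.
Qed.

(** Since [R] is factorized, the orders of the images of the two factors multiply to that of X / R,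
    so the images meet trivially. *)
Lemma factor_quo X R a b c d : exact X a b c d -> R <| X ->
  #|R| = (#|R :&: Dh a b| * #|R :&: Dh c d|)%N ->
  R :&: Dh a b \subset <[a]> -> R :&: Dh c d \subset <[c]> ->
  exact (X / R)%G (coset R a) (coset R b) (coset R c) (coset R d).
Proof.
move=> hX nR fR sA sC; have [dab dcd] := (ex_dab hX, ex_dcd hX).
have nX := subsetP (normal_norm nR).
have [na nb] := (nX a (ex_a hX), nX b (ex_b hX)); have [nc nd] := (nX c (ex_c hX), nX d (ex_d hX)).
have nG : Dh a b \subset 'N(R) by rewrite Dh_sub na nb.
have nH : Dh c d \subset 'N(R) by rewrite Dh_sub nc nd.
have E : Dh (coset R a) (coset R b) * Dh (coset R c) (coset R d) = X / R.
  by rewrite -!quo_Dh // -quotientMl //; case: hX => _ _ -> _.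
split; [exact: quo_dihp | exact: quo_dihp | exact: E |].
apply/eqP; rewrite trivg_card1; apply/eqP.
have := mul_cardG (Dh (coset R a) (coset R b)) (Dh (coset R c) (coset R d)).
have cR := card_quotient (normal_norm nR); have L := Lagrange (normal_sub nR).
rewrite E -!quo_Dh //= => e.
have := card_quo nG; have := card_quo nH; have := card_quo (normal_norm nR).
rewrite (setIidPl (normal_sub nR)) (ex_card hX) fR => eX eH eG.
have p1 : 0 < #|R :&: Dh a b| by apply: cardG_gt0.
have p2 : 0 < #|R :&: Dh c d| by apply: cardG_gt0.
have p3 : 0 < #|X / R| by apply: cardG_gt0.
move: e eX; rewrite -eG -eH; set g := #|Dh a b / R|; set h := #|Dh c d / R|.
set x := #|X / R|; set i := #|(Dh a b / R) :&: (Dh c d / R)|; set u := #|R :&: Dh a b|; set v := #|R :&: Dh c d|.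
move=> e eX; have {}eX : (x * (u * v) = g * h * (u * v))%N by rewrite eX; clear; lia.
have xgh : x = (g * h)%N by apply/eqP; rewrite -(@eqn_pmul2r (u * v)) ?muln_gt0 ?p1 //; apply/eqP.
by apply/eqP; rewrite -(eqn_pmul2l p3) muln1 -!quo_Dh //= -/x -/i -e xgh.
Qed.

Lemma factor_good X R a b c d :
  (forall (rT : finGroupType) (K : {group rT}) (a' b' c' d' : rT),
     exact K a' b' c' d' -> #|K| < #|X| -> index2_over K a' b' c' d') ->
  exact X a b c d -> R <| X -> #|R| = (#|R :&: Dh a b| * #|R :&: Dh c d|)%N ->
  R :!=: 1 -> ~~ (X \subset R) -> index2_over X a b c d.
Proof.
move=> IH hX nR fR ntR nXR; have hXC := exactC hX.
have fRC : #|R| = (#|R :&: Dh c d| * #|R :&: Dh a b|)%N by rewrite mulnC.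
case: (boolP (R :&: Dh a b \subset <[a]>)) => sA; last first.
  case: (factor_refl hX nR fR sA) => // sGR.
  case: (boolP (R :&: Dh c d \subset <[c]>)) => sC; first exact: (factor_full hX nR fR).
  case: (factor_refl hXC nR fRC sC) => [/index2_overC//|sHR].
  case/negP: nXR; rewrite -[X \subset R]/((X : {set gT}) \subset R).
  by case: hX => _ _ <- _; rewrite mul_subG.
case: (boolP (R :&: Dh c d \subset <[c]>)) => sC; last first.
  by case: (factor_refl hXC nR fRC sC) => [/index2_overC//|sHR]; apply/index2_overC/(factor_full hXC nR fRC).
have lt : #|X / R| < #|X| by rewrite ltn_quotient ?normal_sub.
have [K [sK cK] sub] := IH _ _ _ _ _ _ (factor_quo hX nR fR sA sC) lt.
have nX := subsetP (normal_norm nR).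
exists (coset R @*^-1 K)%G.
  split; first by rewrite /= -(quotientGK nR) morphpreS.
  rewrite /= card_cosetpre -mulnA cK card_quotient ?normal_norm //.
  exact: Lagrange (normal_sub nR).
have sp a1 b1 : a1 \in X -> b1 \in X -> Dh (coset R a1) (coset R b1) \subset K ->
    Dh a1 b1 \subset coset R @*^-1 K.
  move=> Xa Xb s; rewrite -quo_Dh ?nX // in s.
  by rewrite -sub_quotient_pre // Dh_sub !nX.
case/orP: sub => s; apply/orP; [left | right]; apply: sp => //.
- exact: ex_a hX.
- exact: ex_b hX.
- exact: ex_c hX.
- exact: ex_d hX.
Qed.

End Factor.

(** * Subgroups with a nontrivial core *)

Section Beta.
Variable gT : finGroupType.
Implicit Types (a b c d x y : gT) (K L X Y M N R : {group gT}).

(** If [R] contained [Dh a b :&: M], Dedekind's law would factorize it, so some reflection b1 in [M]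
    is outside [R]. A reflection x of [Dh a b] in [R] would make b1 x a rotation in [M], hence in
    [R], and put b1 in [R]. Finally the product of [R] and [Dh c d] contains b1, as otherwise orders
    would factorize [R]; so it is all of [M]. *)
Lemma nonfactorized X a b c d M R : exact X a b c d -> M \subset X -> Dh c d \subset M ->
  R \subset M -> M \subset 'N(R) -> M :&: <[a]> \subset R ->
  #|R| != (#|R :&: Dh a b| * #|R :&: Dh c d|)%N ->
  [/\ R :&: Dh a b = M :&: <[a]>, (M : {set gT}) = R * Dh c d,
      #|R| = (2 * (#|M :&: <[a]>| * #|R :&: Dh c d|))%N,
      (#|X : M| * #|M :&: <[a]>| = #[a])%N &
      exists b1, [/\ b1 \in Dh a b, b1 \in M, b1 \notin <[a]> & b1 \notin R]].
Proof.
move=> hX sMX sHM sRM nRM sAR nf; have [dab dcd] := (ex_dab hX, ex_dcd hX).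
have [ME cM] := ex_modr hX sHM sMX.
have I : Dh a b :&: Dh c d = 1 by case: hX.
have nD : ~~ (Dh a b :&: M \subset R).
  apply: contra nf => sD; have RE : (R : {set gT}) = (Dh a b :&: M) * (R :&: Dh c d).
    by rewrite [R :&: _]setIC group_modl // -ME; apply/esym/setIidPr.
  have DE : R :&: Dh a b = Dh a b :&: M.
    by apply/eqP; rewrite eqEsubset [R :&: _]setIC setIS //= subsetI subsetIl.
  rewrite {1}RE DE TI_cardMg //; apply/trivgP; rewrite /= -I.
  by apply: setISS; rewrite ?subsetIl ?subsetIr.
case/subsetPn: nD => b1 /setIP[Gb1 Mb1] Rb1.
have Ab1 : b1 \notin <[a]> by apply: contra Rb1 => Ab; rewrite (subsetP sAR) // inE Mb1.
have Db1 : b1 \in Dh a b :&: M by rewrite inE Gb1.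
have [DE cD] := @sub_Dh _ a b (Dh a b :&: M)%G b1 dab (subsetIl _ _) Db1 Ab1.
have DA : (Dh a b :&: M) :&: <[a]> = M :&: <[a]>.
  by rewrite setIC setIA (setIidPl (cyc_Dh a b)) setIC.
rewrite /= DA in DE cD.
have RG : R :&: Dh a b = M :&: <[a]>.
  apply/eqP; rewrite eqEsubset; apply/andP; split; last first.
    by rewrite subsetI sAR subIset // cyc_Dh orbT.
  apply/subsetP=> x /setIP[Rx Gx]; have Mx := subsetP sRM x Rx.
  rewrite inE Mx /=; apply/negPn/negP=> Ax.
  have [i bE] := Dh_out dab Gb1 Ab1; have [j xE] := Dh_out dab Gx Ax.
  case/negP: Rb1; have : b1 * x \in M :&: <[a]>.
    rewrite inE groupM //= bE xE -mulgA (mulgA b) (Dh_refl_conj _ dab) -mulgA -expg2.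
    by case: dab => _ -> _; rewrite mulg1 groupM ?groupV ?mem_cycle.
  by move/(subsetP sAR); rewrite groupMr.
have pR : 0 < #|R :&: Dh c d| by apply: cardG_gt0.
have pH : 0 < #|Dh c d| by apply: cardG_gt0.
have nHR : Dh c d \subset 'N(R) := subset_trans sHM nRM.
pose L := (R <*> Dh c d)%G.
have LE : (L : {set gT}) = R * Dh c d by rewrite /= norm_joinEr.
have sLM : L \subset M by rewrite join_subG sRM.
have [LD cL] := ex_modr hX (joing_subr R (Dh c d)) (subset_trans sLM sMX).
have cRH : (#|R| * #|Dh c d| = #|L| * #|R :&: Dh c d|)%N by rewrite LE mul_cardG.
have cR : #|R| = (#|Dh a b :&: L| * #|R :&: Dh c d|)%N.
  by apply/eqP; rewrite -(eqn_pmul2r pH) cRH cL mulnAC.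
have sb : M :&: <[a]> \subset Dh a b :&: L.
  by rewrite -RG setIC setIS // joing_subl.
have Lb1 : b1 \in L.
  apply/negPn/negP=> nL; case/negP: nf; rewrite cR RG.
  suff -> : Dh a b :&: L = M :&: <[a]> by [].
  apply/eqP; rewrite eqEsubset sb andbT; apply/subsetP=> x /setIP[Gx Lx].
  have Mx := subsetP sLM x Lx; rewrite inE Mx /=; apply/negPn/negP=> Ax.
  have [i bE] := Dh_out dab Gb1 Ab1; have [j xE] := Dh_out dab Gx Ax.
  case/negP: nL; have : b1 * x \in M :&: <[a]>.
    rewrite inE groupM //= bE xE -mulgA (mulgA b) (Dh_refl_conj _ dab) -mulgA -expg2.
    by case: dab => _ -> _; rewrite mulg1 groupM ?groupV ?mem_cycle.
  by move/(subsetP sAR)/(subsetP (joing_subl R (Dh c d))); rewrite -/L groupMr.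
have DL : Dh a b :&: L = Dh a b :&: M.
  apply/eqP; rewrite eqEsubset setIS //= DE mul_subG // cycle_subG inE Gb1.
  exact: Lb1.
have eLM : (L : {set gT}) = M by rewrite LD DL -ME.
split=> //; first by rewrite -eLM LE.
- by rewrite cR DL cD [(_ * 2)%N]mulnC mulnA.
- have := Lagrange sMX; rewrite cM cD (ex_card hX) (card_Dh dab).
  move=> e; apply/eqP; rewrite -(eqn_pmul2r pH) -(eqn_pmul2r (isT : 0 < 2)); apply/eqP.
  rewrite [RHS]mulnAC -e; move: #|X : M| #|M :&: <[a]>| #|Dh c d|; clear=> i u v; lia.
- by exists b1.
Qed.

(** This is [corefree_leq] in X / R, where M / R is core-free and equals the image of [Dh c d]; the
    index on the left is the order of the image of [<[c]>]. *)
Lemma core_quo_lt X c d M R : maximal M X -> gcore M X = R -> R <| X ->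
  dihp c d -> (M : {set gT}) = R * Dh c d -> R :&: Dh c d \subset <[c]> ->
  1 < #|<[c]> : R :&: <[c]>| -> #|<[c]> : R :&: <[c]>| < #|X : M|.
Proof.
move=> maxM core nR dcd ME sRC gt1.
have sMX : M \subset X by case/maxgroupP: maxM => /proper_sub.
have sRM : R \subset M by rewrite -core gcore_sub.
have nRM : R <| M by apply: normalS nR.
have sHM : Dh c d \subset M by rewrite -[_ \subset M]/(_ \subset (M : {set gT})) ME mulG_subr.
have sCM : <[c]> \subset M := subset_trans (cyc_Dh c d) sHM.
have nX := normal_norm nR; have nM := normal_norm nRM.
have cE : #|<[c]> / R| = #|<[c]> : R :&: <[c]>|.
  rewrite setIC card_quotient ?indexgI //; exact: subset_trans sCM nM.
have iE : #|X / R : M / R| = #|X : M| by apply: index_quotient_eq => //; rewrite subIset ?sRM ?orbT.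
rewrite -cE -iE.
have MRE : M / R = Dh c d / R by rewrite ME quotientMidl.
apply: (@corefree_leq _ (X / R)%G (M / R)%G (<[c]> / R)%G).
- by rewrite /= quotient_maximal.
- apply/trivgP; apply/subsetP=> x Kx.
  have := subsetP (gcore_sub _ _) x Kx => /morphimP[y Ny My xE].
  have nK : gcore (M / R) (X / R) <| X / R by apply: gcore_normal; apply: quotientS.
  have sub : coset R @*^-1 (gcore (M / R) (X / R)) \subset gcore M X.
    have sM : coset R @*^-1 gcore (M / R) (X / R) \subset M.
      by apply: subset_trans (morphpreS _ (gcore_sub _ _)) _; rewrite /= quotientGK.
    apply: gcore_max => //.
    by have := cosetpre_normal (gcore (M / R) (X / R))%G (X / R)%G; rewrite nK quotientGK // => /normal_norm.
  have: y \in gcore M X by apply: (subsetP sub); apply: mem_morphpre => //; rewrite -xE.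
  by rewrite core => Ry; rewrite xE /= coset_id ?set11.
- exact: quotient_cyclic (cycle_cyclic c).
- by rewrite /= MRE; apply: quotient_normal; apply: cyc_norm_Dh dcd (subxx _).
- move=> y; rewrite -[y \in _]/(y \in M / R) MRE => /morphimP[z Nz Hz ->].
  by rewrite -morphX //= mem_quotient // (Dh_sq dcd).
- by apply: contraTneq gt1 => E; rewrite -cE -[<[c]> / R]/(gval (<[c]> / R)%G) E cards1.
Qed.

Lemma index2_over_small X a b c d : exact X a b c d -> #[a] <= 1 -> index2_over X a b c d.
Proof.
move=> hX a1; exists (Dh c d); last by rewrite subxx orbT.
split; first exact: ex_r hX.
by rewrite (ex_card hX) (card_Dh (ex_dab hX)); have := order_gt0 a; move: a1; clear; nia.
Qed.

(* X / R is dihedral of order 2p, and the image of <c, d> in it is generated by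
   that of b. *)
Definition dihq X R a b c d p : Prop :=
  [/\ R <| X, prime p, odd p, R :&: Dh a b = <[a ^+ p]> & #[a] = (#[a ^+ p] * p)%N]
  /\ [/\ b \notin R, #|X| = (2 * p * #|R|)%N, #|Dh c d| = (2 * #|R :&: Dh c d|)%N
     & Dh c d \subset R <*> <[b]>].

Lemma maxcore_dihq X a b c d M :
  (forall (rT : finGroupType) (K : {group rT}) (a' b' c' d' : rT),
     exact K a' b' c' d' -> #|K| < #|X| -> index2_over K a' b' c' d') ->
  exact X a b c d -> ~ index2_over X a b c d -> maximal M X -> Dh c d \subset M ->
  (forall N, maximal N X -> (Dh a b \subset N) || (Dh c d \subset N) ->
     #|gcore N X| <= #|gcore M X|) ->
  exists R i p, dihq X R a (a ^+ i * b) c d p.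
Proof.
move=> IH hX nI maxM sHM maxcore; have [dab dcd] := (ex_dab hX, ex_dcd hX).
have hXC := exactC hX.
have sMX : M \subset X by case/maxgroupP: maxM => /proper_sub.
have nXM : ~~ (X \subset M) by case/maxgroupP: maxM; rewrite properE => /andP[].
have a1 : 1 < #[a] by rewrite ltnNge; apply/negP=> /(index2_over_small hX).
have c1 : 1 < #[c] by rewrite ltnNge; apply/negP=> /(index2_over_small hXC)/index2_overC.
have [R coreR] : exists R : {group gT}, gcore M X = R by exists (gcore_group M X).
have nR : R <| X by have := gcore_normal sMX; rewrite coreR.
have sRM : R \subset M by rewrite -coreR gcore_sub.
have nXR : ~~ (X \subset R) by apply: contra nXM => s; apply: subset_trans s sRM.
have sGX := ex_l hX; have sHX := ex_r hX.
have [E|ntR] := eqVneq (R : {set gT}) 1.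
  have [GX|[N maxN sGN]] := maximal_exists sGX.
    have := ex_card hX; rewrite -GX (card_Dh dcd); have := cardG_gt0 (Dh a b).
    by move: c1; clear; nia.
  have coreN : gcore N X = 1.
    have := maxcore N maxN; rewrite sGN coreR E cards1 => /(_ isT).
    by rewrite -[gcore N X]/(gval (gcore_group N X)) => /card_le1_trivg.
  by case: (corefree_false hX a1 c1 maxM (etrans coreR E) sHM maxN coreN sGN nI).
have nf : #|R| != (#|R :&: Dh a b| * #|R :&: Dh c d|)%N.
  by apply/eqP=> f; apply: nI; apply: (factor_good IH hX nR f).
have nfC : #|R| != (#|R :&: Dh c d| * #|R :&: Dh a b|)%N by rewrite mulnC.
have sAR : M :&: <[a]> \subset R.
  rewrite -coreR; apply: (core_incl hXC sHM _ (subsetIl _ _)).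
  by apply: normal_norm; apply: cyc_norm_Dh dab _; apply: subsetIr.
have nRM : M \subset 'N(R) := subset_trans sMX (normal_norm nR).
have [RG ME cR iM [b1 [Gb1 Mb1 Ab1 Rb1]]] := nonfactorized hX sMX sHM sRM nRM sAR nf.
have sRGA : R :&: Dh a b \subset <[a]> by rewrite RG subsetIr.
(* Otherwise take a maximal N over G R. By the choice of [M] its core is again [R], so M = R H and N
   = R G are both core-free modulo [R], and [core_quo_lt] gives |X : N| < |X : M| < |X : N|. *)
have GR : Dh a b <*> R = X.
  have sJ : (Dh a b <*> R)%G \subset X by rewrite join_subG sGX normal_sub.
  have [//|[N maxN sGRN]] := maximal_exists sJ.
  have [sGN sRN] : Dh a b \subset N /\ R \subset N by apply/andP; rewrite -join_subG.
  have sNX : N \subset X by case/maxgroupP: maxN => /proper_sub.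
  have coreN : gcore N X = R.
    apply/esym/eqP; rewrite eqEcard gcore_max ?normal_norm //=.
    by rewrite -coreR; apply: maxcore; rewrite ?sGN.
  have nRN : N \subset 'N(R) := subset_trans sNX (normal_norm nR).
  have sCR : N :&: <[c]> \subset R.
    rewrite -coreN; apply: (core_incl hX sGN _ (subsetIl _ _)).
    by apply: normal_norm; apply: cyc_norm_Dh dcd _; apply: subsetIr.
  have [RH NE _ iN _] := nonfactorized hXC sNX sGN sRN nRN sCR nfC.
  have sRHC : R :&: Dh c d \subset <[c]> by rewrite RH subsetIr.
  have capA : R :&: <[a]> = M :&: <[a]>.
    by rewrite -RG -(setIidPr (cyc_Dh a b)) setIA RG -setIA setIid.
  have capC : R :&: <[c]> = N :&: <[c]>.
    by rewrite -RH -(setIidPr (cyc_Dh c d)) setIA RH -setIA setIid.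
  have jA : #|<[a]> : R :&: <[a]>| = #|X : M|.
    rewrite capA; apply/eqP; rewrite -(eqn_pmul2r (cardG_gt0 (M :&: <[a]>))) iM mulnC.
    by rewrite orderE Lagrange ?subsetIr.
  have jC : #|<[c]> : R :&: <[c]>| = #|X : N|.
    rewrite capC; apply/eqP; rewrite -(eqn_pmul2r (cardG_gt0 (N :&: <[c]>))) iN mulnC.
    by rewrite orderE Lagrange ?subsetIr.
  have gM : 1 < #|X : M| by rewrite indexg_gt1.
  have gN : 1 < #|X : N|.
    by rewrite indexg_gt1; case/maxgroupP: maxN; rewrite properE => /andP[].
  have := core_quo_lt maxM coreR nR dcd ME sRHC.
  have := core_quo_lt maxN coreN nR dab NE sRGA.
  rewrite jA jC => /(_ gM) l1 /(_ gN) l2.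
  by move: l1 l2; clear; lia.
have cX : (#|X| * #|M :&: <[a]>| = #[a] * 2 * #|R|)%N.
  rewrite -GR norm_joinEl; last exact: subset_trans sGX (normal_norm nR).
  by rewrite -RG [R :&: _]setIC -mul_cardG (card_Dh dab).
set al := #|M :&: <[a]>| in cR iM cX; set k := #|X : M| in iM.
have al0 : 0 < al by apply: cardG_gt0.
have R0 : 0 < #|R| by apply: cardG_gt0.
have cX2 : #|X| = (2 * k * #|R|)%N.
  by apply/eqP; rewrite -(eqn_pmul2r al0) cX -iM; apply/eqP; clear; lia.
have cH : #|Dh c d| = (2 * #|R :&: Dh c d|)%N.
  have := ex_card hX; rewrite (card_Dh dab) cX2 cR -iM.
  have k0 : 0 < k by apply: indexg_gt0.
  have p : 0 < k * al * 2 by rewrite !muln_gt0 k0 al0.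
  move=> e; apply/eqP; rewrite -(eqn_pmul2l p) -e; apply/eqP.
  move: #|R :&: Dh c d| (k) (al); clear=> u v w; lia.
have k1 : 1 < k by rewrite indexg_gt1.
have akn : k %| #[a] by rewrite -iM dvdn_mulr.
have MA : M :&: <[a]> = <[a ^+ k]>.
  have := @eq_subG_cyclic _ [group of <[a]>] (M :&: <[a]>)%G [group of <[a ^+ k]>] (cycle_cyclic a) (subsetIr _ _) (cycleX a k).
  rewrite /= -/al -orderE orderXdiv // -iM mulKn; last exact: ltnW.
  by rewrite eqxx => /eqP.
have [dab1 DE] := Dh_out_dihp dab Gb1 Ab1.
have b12 : b1 ^+ 2 = 1 by case: dab1.
have nRb : b1 \in 'N(R) by apply: subsetP (normal_norm nR) _ _; apply: subsetP sMX _ _.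
have hM : index2 R M.
  split=> //; have := Lagrange sMX; rewrite -/k cX2; move: k1; clear; nia.
have MRb : M :=: R <*> <[b1]>.
  have Rb12 : b1 ^+ 2 \in R by rewrite b12 group1.
  have [_ c2] := half_adjoin nRb Rb1 Rb12.
  apply/esym/eqP; rewrite eqEcard join_subG sRM cycle_subG Mb1 -c2 /=.
  by case: hM => _ ->.
(* For a prime divisor q of k, the join of [M] and a^q is [M] or [X]. The first gives k <= q; the
   second is impossible, as R <a^q, b1> has order at most 2 |R| k / q. *)
have pk : prime k.
  have pq := pdiv_prime k1; have qk := pdiv_dvd k; move: pq qk; set q := pdiv k => pq qk.
  have qn : q %| #[a] := dvdn_trans qk akn.
  have oq : (#[a ^+ q] * q = #[a])%N by rewrite orderXdiv // divnK.
  have maxE : maximal_eq M X by rewrite /maximal_eq maxM orbT.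
  have /maximal_eqP[_ alt] := maxE.
  have [||E|E] := alt (M <*> <[a ^+ q]>)%G.
  - exact: joing_subl.
  - by rewrite join_subG sMX cycle_subG groupX // (ex_a hX).
  - have: <[a ^+ q]> \subset M :&: <[a]> by rewrite subsetI cycleX -{1}E joing_subr.
    move/subset_leq_card; rewrite -orderE -/al => le.
    have : k <= q.
      move: le oq; rewrite -iM; have := order_gt0 (a ^+ q); set o := #[_]; clear -al0.
      by move=> o0 le e; rewrite leqNgt; apply/negP=> lt; move: e; nia.
    have := dvdn_leq (ltnW k1) qk => l1 l2.
    by have -> : k = q by apply/eqP; rewrite eqn_leq l1 l2.
  - pose D := Dh (a ^+ q) b1.
    have nD : D \subset 'N(R).
      by rewrite Dh_sub nRb groupX //; apply: subsetP (normal_norm nR) _ (ex_a hX).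
    have sX : X \subset R <*> D.
      rewrite -[X \subset _]/((X : {set gT}) \subset _) -E /= MRb !join_subG !cycle_subG joing_subl /=.
      by rewrite !(subsetP (joing_subr _ _)) // ?Dh_l ?Dh_r.
    have sk : <[a ^+ k]> \subset R :&: D.
      rewrite subsetI -{1}MA sAR cycle_subG -(divnK qk) mulnC expgM groupX //; exact: Dh_l.
    have := mul_cardG R D; rewrite -norm_joinEr // (card_Dh (dihp_pow q dab1)).
    have := subset_leq_card sX; have := subset_leq_card sk; rewrite -MA -/al cX2.
    set u := #|R :&: D|; set v := #|R <*> D|; have := prime_gt1 pq.
    move: oq R0 al0 k1; rewrite -iM; set r := #|R|; set o := #[_]; clear.
    move=> e r0 al0 k1 q1 l1 l2 e2.
    have: 2 * k * r * al <= r * (o * 2) by rewrite e2 leq_mul.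
    have h: (2 * k * r * al = r * (o * 2) * q)%N by transitivity (r * 2 * (o * q))%N; [rewrite e|]; clear; lia.
    have o0 : 0 < o by case: o e {h e2} => //; rewrite mul0n; move: al0 k1; nia.
    by rewrite h -{2}[(r * (o * 2))%N]muln1 leq_pmul2l ?muln_gt0 ?r0 ?o0 // leqNgt q1.
have [i bE] := Dh_out dab Gb1 Ab1.
exists R, i, k; rewrite -bE; split; split=> //.
- case: (even_prime pk) => // k2; case: nI; exists M; last by rewrite sHM orbT.
  by split=> //; rewrite -k2 Lagrange.
- by rewrite DE RG.
- by rewrite orderXdiv // divnK.
- by rewrite -MRb.
Qed.

Lemma dihq_exists X a b c d :
  (forall (rT : finGroupType) (K : {group rT}) (a' b' c' d' : rT),
     exact K a' b' c' d' -> #|K| < #|X| -> index2_over K a' b' c' d') ->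
  exact X a b c d -> ~ index2_over X a b c d ->
  (exists R i p, dihq X R a (a ^+ i * b) c d p) \/
  (exists R i p, dihq X R c (c ^+ i * d) a b p).
Proof.
move=> IH hX nI.
pose P (N : {group gT}) := maximal N X && ((Dh a b \subset N) || (Dh c d \subset N)).
have [M0 PM0] : exists M0, P M0.
  have [HX|[M maxM sHM]] := maximal_exists (ex_r hX); last by exists M; rewrite /P maxM sHM orbT.
  have := ex_card hX; rewrite -HX (card_Dh (ex_dab hX)); have := cardG_gt0 (Dh c d).
  by have := order_gt0 a; clear; nia.
case: (arg_maxnP (fun N : {group gT} => #|gcore N X|) PM0) => M /andP[maxM sM] h.
have maxcore N : maximal N X -> (Dh a b \subset N) || (Dh c d \subset N) ->
  #|gcore N X| <= #|gcore M X| by move=> mN sN; apply: h; rewrite /P mN.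
case/orP: sM => sM; [right | left].
  apply: (maxcore_dihq IH (exactC hX) _ maxM sM) => [/index2_overC//|N mN sN].
  by apply: maxcore; rewrite // orbC.
exact: (maxcore_dihq IH hX nI maxM sM).
Qed.

End Beta.

(** * The dihedral quotient *)

Section Tri.
Variable gT : finGroupType.
Implicit Types (x y z : gT) (K L Y M N Z J P : {group gT}) (f u v : gT -> bool).
Variables (X R : {group gT}) (a b c d : gT) (p : nat).
Hypothesis hX : exact X a b c d.
Hypothesis nR : R <| X.
Hypothesis pr_p : prime p.
Hypothesis odd_p : odd p.
Hypothesis RG : R :&: Dh a b = <[a ^+ p]>.
Hypothesis oa : #[a] = (#[a ^+ p] * p)%N.
Hypothesis Rb : b \notin R.
Hypothesis cX : #|X| = (2 * p * #|R|)%N.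
Hypothesis cH : #|Dh c d| = (2 * #|R :&: Dh c d|)%N.
Hypothesis sH : Dh c d \subset R <*> <[b]>.
Hypothesis IH : forall K a' b' c' d', exact K a' b' c' d' -> #|K| < #|X| -> index2_over K a' b' c' d'.
Hypothesis nI : ~ index2_over X a b c d.

Let dab := ex_dab hX.
Let dcd := ex_dcd hX.
Let nXR := normal_norm nR.
Let sRX := normal_sub nR.
Let na : a \in 'N(R). Proof. exact: subsetP nXR _ (ex_a hX). Qed.
Let nb : b \in 'N(R). Proof. exact: subsetP nXR _ (ex_b hX). Qed.
Let Ra : a ^+ p \in R.
Proof. by have := cycle_id (a ^+ p); rewrite -RG => /setIP[]. Qed.
Let b2 : b ^+ 2 = 1. Proof. by case: dab. Qed.
Let d2 : d ^+ 2 = 1. Proof. by case: dcd. Qed.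
Let p_gt2 : 2 < p. Proof. by apply: odd_prime_gt2. Qed.

Lemma dihq_cR : #|R| = (2 * (#[a ^+ p] * #[c]))%N.
Proof.
have := ex_card4 hX; rewrite cX oa; have := prime_gt0 pr_p => p0 e.
have q : 0 < 2 * p by rewrite muln_gt0.
by apply/eqP; rewrite -(eqn_pmul2l q) e; apply/eqP; clear; lia.
Qed.

Lemma dihq_aR : a \notin R.
Proof.
apply/negP=> h; have : a \in R :&: Dh a b by rewrite inE h Dh_l.
rewrite RG -cycle_subG => /subset_leq_card; rewrite -!orderE oa.
by have := order_gt0 (a ^+ p); have := prime_gt1 pr_p; clear; nia.
Qed.

Lemma dihq_norm P : R \subset 'N(P) -> a \in 'N(P) -> b \in 'N(P) -> X \subset 'N(P).
Proof.
move=> nRP naP nbP.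
have : Dh c d \subset 'N(P).
  by apply: subset_trans sH _; rewrite join_subG nRP cycle_subG.
by rewrite Dh_sub => /andP[? ?]; apply: (ex_normX hX).
Qed.

Lemma dihq_half : index2 R (R <*> <[b]>).
Proof. by apply: half_adjoin => //; rewrite b2. Qed.

(* If Z is normal of index 2 in R then X / Z is an extension of a group of order
   2 by a dihedral group of order 2p, in which the image of <a, b> has index 2
   as soon as a^p is in Z. *)
Lemma dihq_kill Z : Z <| X -> index2 Z R -> a ^+ p \in Z -> False.
Proof.
move=> nZ [sZR cZ] Za; apply: nI; exists (Dh a b <*> Z)%G; last by rewrite joing_subl.
apply: (index2_joing (ex_l hX) nZ).
have -> : Z :&: Dh a b = <[a ^+ p]>.
  apply/eqP; rewrite eqEsubset -{1}RG setSI //= cycle_subG inE Za.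
  by rewrite groupX ?Dh_l.
by rewrite (card_Dh dab) cX -cZ oa -orderE; clear; lia.
Qed.

(** Here [d] is outside [R] and b d inside, so [R] itself is a twin subgroup with exponents p and 1.
    Its splitting homomorphism is invariant under [X], and [dihq_kill] applies to the kernel. *)
Lemma dihq_case_c : c \in R -> False.
Proof.
move=> Rc; have hRM := dihq_half.
have Mb : b \in (R <*> <[b]>)%G by rewrite -cycle_subG joing_subr.
have Md : d \in (R <*> <[b]>)%G by rewrite (subsetP sH) ?Dh_r.
have H0 : 0 < #|Dh c d| by apply: cardG_gt0.
have Rd : d \notin R.
  apply/negP=> Rd; have sHR : Dh c d \subset R by rewrite Dh_sub Rc.
  by move: cH H0; rewrite (setIidPr sHR); clear; lia.
have Rbd : b * d \in R by apply: (half_notin hRM).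
have RH : R :&: Dh c d = <[c]>.
  apply/esym/eqP; rewrite eqEcard subsetI cycle_subG Rc cyc_Dh /=.
  by rewrite -(leq_pmul2l (isT : 0 < 2)) -cH (card_Dh dcd) orderE mulnC.
have hT : twin X R a b c d p 1.
  by split; rewrite ?expg1 // dihq_cR.
have lt : #|R| * 2 < #|X|.
  by rewrite cX; have := cardG_gt0 R; move: p_gt2; clear; nia.
have [r hr [ra rc rbd]] := twin_splits IH (ltnSn _) lt hX hT (or_intror nI).
have [inva invc] := act_fix hX hT nI hr ra rc.
have nZ : hker hr <| X.
  rewrite /normal (subset_trans (hker_sub hr)) //; apply: (@dihq_norm (hker hr)).
  - exact: hker_normK.
  - by apply: hker_norm.
  - by apply: hker_norm => //; apply: (twin_act_b hX hT hr).
apply: (dihq_kill nZ (hker_half hr Rbd rbd)).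
by rewrite hkerE Ra ra.
Qed.

(** * The case where [R] contains [d] but not [c] *)

Section NotC.
Hypothesis Rc : c \notin R.
Hypothesis Rd : d \in R.

Let M := (R <*> <[b]>)%G.
Let hRM : index2 R M := dihq_half.
Let Mb : b \in M. Proof. by rewrite -cycle_subG joing_subr. Qed.
Let Mc : c \in M. Proof. by rewrite (subsetP sH) ?Dh_l. Qed.
Let sRM : R \subset M. Proof. exact: joing_subl. Qed.
Let Rbc : b * c \in R. Proof. exact: (half_notin hRM). Qed.
Let Rc2 : c ^+ 2 \in R. Proof. by rewrite expg2; apply: (half_notin hRM). Qed.

Lemma dihq_cpow j : (c ^+ j \in R) = ~~ odd j.
Proof.
rewrite -{1}[j]odd_double_half -mul2n expgD expgM.
rewrite (groupMr _ (groupX _ Rc2)).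
by case: (odd j) => /=; rewrite ?expg1 ?(negbTE Rc) ?group1.
Qed.

Lemma dihq_M : exact M (a ^+ p) b c d.
Proof.
apply: (exact_sub hX); rewrite ?Dh_pow_sub ?Dh_sub ?Mb ?Mc ?(subsetP sRM) //.
- exact: dihp_pow.
- by rewrite Dh_l Dh_r.
- have cM : (#|R| * 2 = #|M|)%N by case: hRM.
  by rewrite -cM dihq_cR; clear; lia.
Qed.

Lemma dihq_gen : R \subset <<[set a ^+ p; c ^+ 2; d; b * c]>>.
Proof.
set W := <<_>>.
have Wa : a ^+ p \in W by rewrite mem_gen // !inE eqxx.
have Wc : c ^+ 2 \in W by rewrite mem_gen // !inE eqxx ?orbT.
have Wd : d \in W by rewrite mem_gen // !inE eqxx ?orbT.
have Wbc : b * c \in W by rewrite mem_gen // !inE eqxx ?orbT.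
apply/subsetP=> x Rx; have Mx : x \in M := subsetP sRM x Rx.
have : x \in Dh (a ^+ p) b * Dh c d by case: dihq_M => _ _ ->.
case/mulsgP=> g h Gg Hh xE.
have [e [j hE]] : exists e j, h = c ^+ j * d ^+ (e : bool).
  case: (DhP dcd Hh) => -[j ->]; first by exists false, j; rewrite mulg1.
  by exists true, j.
have Rde : d ^+ e \in R by rewrite groupX.
have Wde : d ^+ e \in W by rewrite groupX.
case: (DhP (dihp_pow p dab) Gg) => -[i gE]; move: Rx; rewrite xE gE hE mulgA.
  rewrite (groupMr _ Rde) (groupMl _ (groupX i Ra)) dihq_cpow => ej.
  apply: groupM => //; apply: groupM; first exact: groupX.
  by rewrite -[j]odd_double_half (negbTE ej) -mul2n expgM groupX.
rewrite (groupMr _ Rde) -(mulgA _ b) (groupMl _ (groupX i Ra)) => Rbcj.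
have oj : odd j.
  apply: contraR Rb => ej; have Rcj : c ^+ j \in R by rewrite dihq_cpow.
  by move: Rbcj; rewrite (groupMr _ Rcj).
apply: groupM => //; apply: groupM; first exact: groupX.
rewrite -[j]odd_double_half oj -mul2n expgD expgM mulgA.
by apply: groupM; last exact: groupX.
Qed.

Lemma dihq_eq f u : hom2 R f -> hom2 R u -> f (a ^+ p) = u (a ^+ p) ->
  f (c ^+ 2) = u (c ^+ 2) -> f d = u d -> f (b * c) = u (b * c) -> {in R, f =1 u}.
Proof.
move=> hf hu ea ec ed ebc; apply: (hom2_gen hf hu _ dihq_gen).
  by rewrite !subUset !sub1set Ra Rc2 Rd Rbc.
by move=> x; rewrite !inE => /orP[/orP[/orP[]|]|] /eqP ->.
Qed.

(** Since [b * c] lies in [R], the conjugate of a homomorphism on [R] by [b] can be computed with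
    [c], where d^c = d c^2. *)
Lemma dihq_bvals f : hom2 R f ->
  [/\ f ((a ^+ p) ^ b) = f (a ^+ p), f ((c ^+ 2) ^ b) = f (c ^+ 2),
      f (d ^ b) = f d (+) f (c ^+ 2) & f ((b * c) ^ b) = f (b * c) (+) f (c ^+ 2)].
Proof.
move=> hf; have [_ _ ab] := dab; have [_ _ cd] := dcd.
have bV := dihpV dab; have dV := dihpV dcd.
have bcb : (b * c) ^ b = c ^+ 2 * (b * c)^-1.
  by rewrite conjgE bV invMg bV !mulgA -expg2 b2 mul1g expg2 mulgK.
have fbc : f ((b * c) ^ b) = f (b * c) (+) f (c ^+ 2).
  by rewrite bcb [LHS]hf ?groupV // (hom2V hf Rbc) addbC.
have Rbcb : (b * c) ^ b \in R by rewrite memJ_norm.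
split=> //.
- by rewrite conjXg ab expgVn (hom2V hf Ra).
- have -> : (c ^+ 2) ^ b = (b * c) * (b * c) ^ b by rewrite conjgE bV bcb invMg bV !mulgA mulgK -(mulgA b) -expg2.
  by rewrite [LHS]hf // fbc addKb.
- have dc : d ^ c = d * c ^+ 2.
    have h : d * c * d = c^-1 by rewrite -cd conjgE dV mulgA.
    by rewrite conjgE -h expg2 !mulgA -(mulgA (d * c)) -expg2 d2 mulg1.
  have -> : d ^ b = (d ^ c) ^ (b * c)^-1 by rewrite -conjgM invMg bV mulgA mulgV mul1g.
  have Rdc : d ^ c \in R by rewrite memJ_norm // (subsetP nXR) ?(ex_c hX).
  by rewrite (hom2J hf) ?groupV // dc hf.
Qed.

Lemma dihq_b_inv f : hom2 R f -> f (c ^+ 2) = false -> {in R, forall x, f (x ^ b) = f x}.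
Proof.
move=> hf fc; have [e1 e2 e3 e4] := dihq_bvals hf; rewrite fc !addbF in e3 e4.
exact: (dihq_eq (hom2_conj nb hf) hf).
Qed.

(* Applied to the conjugates f_i = (f_0)^(a^i), whose conjugates by b are the
   f_(-i), this says that f_i + f_(-i) does not depend on i. *)
Lemma dihq_b_diff f u : hom2 R f -> hom2 R u -> f (c ^+ 2) -> u (c ^+ 2) ->
  {in R, forall x, f (x ^ b) (+) f x = u (x ^ b) (+) u x}.
Proof.
move=> hf hu fc uc; have [e1 e2 e3 e4] := dihq_bvals hf; have [e1' e2' e3' e4'] := dihq_bvals hu.
apply: (dihq_eq (hom2D (hom2_conj nb hf) hf) (hom2D (hom2_conj nb hu) hu)).
- by rewrite e1 e1' !addbb.
- by rewrite e2 e2' !addbb.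
- by rewrite e3 e3' fc uc; case: (f d); case: (u d).
- by rewrite e4 e4' fc uc; case: (f _); case: (u _).
Qed.

Section Theta.
Variable K : {group gT}.
Hypothesis hK : index2 K M.
Hypothesis sK : (Dh (a ^+ p) b \subset K) || (Dh c d \subset K).

Let th x := x \notin K.
Let hth : hom2 M th. Proof. exact: half_hom2. Qed.
Let hthR : hom2 R th. Proof. exact: hom2S sRM hth. Qed.

Lemma dihq_th_nt : exists2 x, x \in R & th x.
Proof.
suff /subsetPn[x] : ~~ (R \subset K) by exists x.
apply/negP=> sRK; have [_ cK] := hK; have [_ cR] := hRM.
have RK : R :=: K by apply/eqP; rewrite eqEcard sRK -(leq_pmul2r (isT : 0 < 2)) cK cR leqnn.
case/orP: sK; rewrite Dh_sub -RK; first by rewrite (negbTE Rb) andbF.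
by rewrite (negbTE Rc).
Qed.

Lemma dihq_th_b : {in R, forall x, th (x ^ b) = th x}.
Proof. by move=> x Rx; apply: (hom2J hth (subsetP sRM _ Rx) Mb). Qed.

(** The kernel J is then normal in [X]. If it contains a^p, [dihq_kill] applies. If not, [K]
    contains [Dh c d], and adjoining to [K] an element of order p modulo J gives a subgroup of index
    2 in [X]. *)
Lemma dihq_th_inv : a \in 'N(hker hthR) -> False.
Proof.
set J := hker hthR => naJ; have [x0 Rx0 thx0] := dihq_th_nt.
have hJ : index2 J R := hker_half hthR Rx0 thx0; have [sJR cJ] := hJ.
have nbJ : b \in 'N(J) by apply: hker_norm => //; apply: dihq_th_b.
have nXJ : X \subset 'N(J) by apply: dihq_norm => //; apply: hker_normK.
have nJ : J <| X by rewrite /normal (subset_trans sJR).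
have [Ja|Ja] := boolP (a ^+ p \in J); first exact: dihq_kill nJ hJ Ja.
have tha : th (a ^+ p) by move: Ja; rewrite hkerE Ra /= negbK.
have sHK : Dh c d \subset K.
  case/orP: sK => //; rewrite Dh_sub => /andP[Ka _].
  by rewrite /th Ka in tha.
have tha_inv x : x \in R -> th (x ^ a) = th x.
  by move=> Rx; apply: (norm_hker hthR (hkerE hthR) na naJ Rx).
(* The exponent is 1 modulo p, so [y] agrees with [a] modulo [R]; it is even, so [y ^+ p], an even
   power of a^p, lies in J. *)
pose y := a ^+ p.+1; pose Y := (J <*> <[y]>)%G.
have Yy : y \in Y by rewrite -cycle_subG joing_subr.
have sJY : J \subset Y by apply: joing_subl.
have nYJ : y \in 'N(J) by apply: groupX.
have nY g : g \in 'N(J) -> y ^ g \in Y -> g \in 'N(Y).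
  move=> ng Yg; rewrite inE /= -genJ conjUg gen_subG subUset (normP ng) sJY /=.
  by rewrite -cycleJ cycle_subG.
have nYR : R \subset 'N(Y).
  apply/subsetP=> x Rx; have nx : x \in 'N(J) by apply: subsetP nXJ _ (subsetP sRX _ Rx).
  apply: nY => //.
  have Jax : [~ a, x] \in J.
    rewrite commgEr hkerE groupM ?memJ_norm ?groupV //= hthR ?memJ_norm ?groupV //.
    by rewrite tha_inv ?groupV // (hom2V hthR Rx) addbb.
  have e : coset J (y ^ x) = coset J y.
    rewrite /y conjXg !morphX ?groupJ //=; congr (_ ^+ _).
    have nJa : [~ a, x] \in 'N(J) := subsetP (normG J) _ Jax.
    by rewrite conjg_mulR morphM //= (coset_id Jax) mulg1.
  have : y ^ x \in J :* y by apply/rcoset_kercosetP; rewrite ?groupJ.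
  by case/rcosetP=> j Jj ->; rewrite groupM // (subsetP sJY).
have nYb : b \in 'N(Y).
  by apply: nY => //; have [_ _ ab] := dab; rewrite conjXg ab expgVn groupV.
have nYM : M \subset 'N(Y) by rewrite join_subG nYR cycle_subG.
have Ry : y \notin R by rewrite /y expgSr groupMl ?dihq_aR.
have Jy : y \notin J by apply: contra Ry; apply: subsetP.
have Jyp : y ^+ p \in J.
  rewrite /y -expgM mulnC expgM hkerE groupX //= (hom2X _ hthR) //.
  by rewrite /= odd_p.
have cY : (#|J| * p = #|Y|)%N by apply: adjoin_card.
have [sKM cK] := hK; have [_ cM] := hRM.
have sJK : J \subset K by apply/subsetP=> x; rewrite hkerE negbK => /andP[].
have cKY : (#|K| * #|Y| = #|K <*> Y| * #|K :&: Y|)%N.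
  by rewrite norm_joinEl ?mul_cardG // (subset_trans sKM).
have J0 : 0 < #|J| by apply: cardG_gt0.
(* The index of J in [K :&: Y] divides both |K : J| = 2 and |Y : J| = p. *)
have cKI : #|K :&: Y| = #|J|.
  have sJI : J \subset K :&: Y by rewrite subsetI sJK.
  have L := Lagrange sJI; set t := #|K :&: Y : J| in L.
  have t2 : t %| 2.
    have := cardSg (subsetIl K Y); rewrite -L.
    have -> : #|K| = (#|J| * 2)%N by apply/eqP; rewrite -(eqn_pmul2r (isT : 0 < 2)) cK cJ cM.
    by rewrite dvdn_pmul2l.
  have dp : t %| p by have := cardSg (subsetIr K Y); rewrite -L -cY dvdn_pmul2l.
  have : t %| gcdn 2 p by rewrite dvdn_gcd t2.
  have -> : gcdn 2 p = 1%N by apply/eqP; rewrite -/(coprime 2 p) coprime2n.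
  by rewrite dvdn1 => /eqP t1; rewrite -L t1 muln1.
apply: nI; exists (K <*> Y)%G; last by rewrite (subset_trans sHK) ?joing_subl ?orbT.
have sMX : M \subset X by rewrite join_subG sRX cycle_subG (ex_b hX).
split.
  rewrite join_subG (subset_trans sKM) // join_subG (subset_trans sJR) //=.
  by rewrite cycle_subG groupX ?(ex_a hX).
have e : (#|K <*> Y| = #|K| * p)%N.
  apply/eqP; rewrite -(eqn_pmul2r J0) -{1}cKI -cKY -cY; apply/eqP; clear; lia.
have -> : #|(K <*> Y)%G| = (#|K| * p)%N by [].
have KR : #|K| = #|R| by apply/eqP; rewrite -(eqn_pmul2r (isT : 0 < 2)) cK cM.
by rewrite KR cX; clear; lia.
Qed.

Section NotInv.
Hypothesis naJ : a \notin 'N(hker hthR).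

Let th_c2 : th (c ^+ 2) = false. Proof. by rewrite (hom2X _ hth). Qed.

Let th_ap k x : x \in R -> th (x ^ (a ^+ (p * k))) = th x.
Proof. by move=> Rx; rewrite (hom2J hthR) // expgM groupX. Qed.

Let th_neg i x : x \in R -> th ((x ^ b) ^ (a ^+ i)) = th (x ^ (a ^- i)).
Proof.
move=> Rx; rewrite -conjgM (Dh_refl_conj _ dab) conjgM dihq_th_b //.
by rewrite memJ_norm // groupV groupX.
Qed.

Let hth_i i : hom2 R (fun x => th (x ^ (a ^+ i))).
Proof. by apply: hom2_conj; rewrite ?groupX. Qed.

(** Write th_i for the conjugate of [th] by a^i; conjugation by [b] turns it into th_(-i). If th_i
    killed c^2, it would be fixed by [b], so [th] would be invariant under a^(2 i). It is also
    invariant under a^p, and 2 i is prime to p, so it would be invariant under [a]. *)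
Lemma dihq_th_c2 i : ~~ (p %| i) -> th ((c ^+ 2) ^ (a ^+ i)).
Proof.
move=> pi; apply/negbNE/negP=> /negbTE E; case/negP: naJ.
have inv x : x \in R -> th (x ^ (a ^+ (2 * i))) = th x.
  move=> Rx; have Rxi : x ^ (a ^+ i) \in R by rewrite memJ_norm ?groupX.
  have := dihq_b_inv (hth_i i) E Rxi; rewrite th_neg // conjgK => ->.
  by rewrite -conjgM -expgD addnn mul2n.
have n1 : a ^+ (2 * i) \in 'N(hker hthR) by apply: hker_norm; rewrite ?groupX.
have n2 : a ^+ p \in 'N(hker hthR) by apply: subsetP (hker_normK hthR) _ Ra.
have i0 : 0 < 2 * i by case: i pi {E inv n1} => //; rewrite dvdn0.
case: (egcdnP p i0) => u v e _.
have g1 : gcdn (2 * i) p = 1%N.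
  apply/eqP; rewrite -/(coprime _ _) coprime_sym coprimeMr coprimen2 odd_p /=.
  by rewrite prime_coprime.
have -> : a = (a ^+ (2 * i)) ^+ u * ((a ^+ p) ^+ v)^-1.
  by apply: (canRL (mulgK _)); rewrite -!expgM -expgS [(2 * i * u)%N]mulnC e g1 addn1 [(p * v)%N]mulnC.
by rewrite groupM ?groupV // groupX.
Qed.

(** By [dihq_b_diff], th_i + th_(-i) is the same for i = 1 and i = 2. At the conjugate of c^2 by [a]
    these sums are the values at c^2 of th_2 + th_0, which is 1, and of th_3 + th_(-1), which is 1
    only if p divides 3. *)
Lemma dihq_p3 : p = 3.
Proof.
have n1 : ~~ (p %| 1) by rewrite dvdn1; move: p_gt2; case: p => [|[]].
have n2 : ~~ (p %| 2) by apply/negP=> /dvdn_leq => /(_ isT); rewrite leqNgt p_gt2.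
have pp : p %| p by [].
(* The additional a^p does not change the values of [th] and keeps all exponents nonnegative. *)
pose x := (c ^+ 2) ^ (a ^+ p.+1).
have Rx : x \in R by rewrite memJ_norm // groupX.
have := dihq_b_diff (hth_i 1) (hth_i 2) (dihq_th_c2 n1) (dihq_th_c2 n2) Rx.
rewrite !th_neg // /x -!conjgM -!expgD.
have -> : a ^+ p.+1 * a ^- 1 = a ^+ (p * 1) by rewrite expgSr muln1 mulgK.
have -> : a ^+ p.+1 * a ^- 2 = a ^+ p.-1.
  apply: (canLR (mulgK _)); rewrite -expgD addn2 prednK //; exact: prime_gt0.
rewrite th_ap // th_c2 (dihq_th_c2 (_ : ~~ (p %| p.+1 + 1))); last first.
  by rewrite addn1 -addn2 dvdn_addr.
have n3 : ~~ (p %| p.-1) by rewrite gtnNdvd //; move: p_gt2; case: p => [|[|q]].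
rewrite (dihq_th_c2 n3).
case h: (p %| 3); last first.
  by rewrite dihq_th_c2 // addSnnS dvdn_addr // h.
by move=> _; move: h; rewrite dvdn_prime2 // => /eqP.
Qed.

(** The sums of two of the three conjugates of [th] form a space invariant under [X]; its common
    kernel T has index 4 in [R], since c^2 and [d] separate [u1] and [u2]. T is a twin subgroup, and
    its splitting homomorphism r extends to some phi on [R] killing [R :&: Dh c d]. The sum of the
    three conjugates of phi under powers of [a] is invariant and restricts to 3 r = r on T. *)
Lemma dihq_sporadic : False.
Proof.
have p3 := dihq_p3.
have Ra3 : a ^+ 3 \in R by rewrite -p3.
have naX i : a ^+ i \in 'N(R) by rewrite groupX.
pose f1 x := th (x ^ (a ^+ 1)); pose f2 x := th (x ^ (a ^+ 2)).
have hf1 : hom2 R f1 := hth_i 1; have hf2 : hom2 R f2 := hth_i 2.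
have th3 x : x \in R -> th (x ^ (a ^+ 3)) = th x by move=> Rx; have := th_ap 1 Rx; rewrite muln1 p3.
have E1 : f1 (c ^+ 2) by apply: dihq_th_c2; rewrite p3.
have E2 : f2 (c ^+ 2) by apply: dihq_th_c2; rewrite p3.
have Rj x g : x \in R -> g \in 'N(R) -> x ^ g \in R by move=> Rx ng; rewrite memJ_norm.
have sw1 x : x \in R -> f1 (x ^ b) = f2 x.
  move=> Rx; rewrite /f1 th_neg // -th3 ?Rj ?groupV // -conjgM; congr (th (x ^ _)).
  by rewrite -[a ^+ 3]/(a ^+ (1 + 2)) expgD mulKg.
have sw2 x : x \in R -> f2 (x ^ b) = f1 x.
  move=> Rx; rewrite /f2 th_neg // -th3 ?Rj ?groupV // -conjgM; congr (th (x ^ _)).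
  by rewrite -[a ^+ 3]/(a ^+ (2 + 1)) expgD mulKg.
have sh0 x : th (x ^ a) = f1 x by rewrite /f1 expg1.
have sh1 x : f1 (x ^ a) = f2 x by rewrite /f1 -conjgM -expgS.
have sh2 x : x \in R -> f2 (x ^ a) = th x by move=> Rx; rewrite /f2 -conjgM -expgS th3.
have Wd : f2 d = ~~ f1 d.
  by have [_ _ e _] := dihq_bvals hf1; move: e; rewrite sw1 // E1 addbT.
pose u1 x := f1 x (+) th x; pose u2 x := f2 x (+) th x.
have hu1 : hom2 R u1 := hom2D hf1 hthR; have hu2 : hom2 R u2 := hom2D hf2 hthR.
have u1c : u1 (c ^+ 2) by rewrite /u1 E1 th_c2.
have u2c : u2 (c ^+ 2) by rewrite /u2 E2 th_c2.
have u12d : u2 d = ~~ u1 d by rewrite /u1 /u2 Wd; case: (f1 d); case: (th d).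
pose U := hker hu1; have hu2U : hom2 U u2 := hom2S (hker_sub hu1) hu2.
have [T TE] : exists T : {group gT}, T = hker hu2U by exists (hker hu2U).
have inT x : (x \in T) = [&& x \in R, ~~ u1 x & ~~ u2 x] by rewrite TE !hkerE andbA.
have sTR : T \subset R by apply/subsetP=> x; rewrite inT => /and3P[].
have cT : (#|T| * 4 = #|R|)%N.
  have [_ c1] : index2 U R := hker_half hu1 Rc2 u1c.
  pose x := if u1 d then d * c ^+ 2 else d.
  have Rx : x \in R by rewrite /x; case: ifP; rewrite // groupM.
  have Ux : x \in U by rewrite hkerE Rx /x; case: ifP => [h|->//]; rewrite hu1 // h u1c.
  have u2x : u2 x by rewrite /x; case: ifP => h; [rewrite hu2 // u12d h u2c | rewrite u12d h].
  have [_ c2] : index2 T U by rewrite TE; apply: (hker_half _ Ux u2x).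
  by rewrite -c1 -c2 -mulnA.
have normT g : (forall y, y \in T -> y ^ g \in T) -> g \in 'N(T).
  by move=> h; rewrite inE; apply/subsetP=> _ /imsetP[y Ty ->]; apply: h.
have nT : T <| X.
  rewrite /normal (subset_trans sTR) //; apply: dihq_norm.
  - apply/subsetP=> x Rx; apply: normT => y; rewrite !inT => /and3P[Ry y1 y2].
    by rewrite groupJ // (hom2J hu1) // (hom2J hu2) // y1.
  - apply: normT => y; rewrite !inT => /and3P[Ry]; rewrite Rj // /u1 /u2 sh0 sh1 sh2 //.
    by case: (f1 y); case: (f2 y); case: (th y).
  - apply: normT => y; rewrite !inT => /and3P[Ry]; rewrite Rj // /u1 /u2 sw1 // sw2 //.
    by rewrite dihq_th_b // => -> ->.
have nTX := normal_norm nT.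
have [naT nbT ncT] : [/\ a \in 'N(T), b \in 'N(T) & c \in 'N(T)].
  by rewrite !(subsetP nTX) ?(ex_a hX) ?(ex_b hX) ?(ex_c hX).
have Ta3 : a ^+ 3 \in T.
  have caa i : (a ^+ 3) ^ (a ^+ i) = a ^+ 3.
    by apply/conjg_fixP/commgP; apply: commuteX2.
  by rewrite inT Ra3 /u1 /u2 /f1 /f2 !caa !addbb.
have c2k k : (c ^+ (2 * k) \in T) = ~~ odd k.
  by rewrite inT expgM groupX // (hom2X _ hu1) // (hom2X _ hu2) // u1c u2c andbT andbb.
have Tc4 : c ^+ 4 \in T by rewrite (c2k 2).
have oc : (#[c ^+ 4] * 4 = #[c])%N.
  have ec : ~~ odd #[c] by rewrite -dihq_cpow expg_order.
  have cE : #[c] = (2 * (#[c])./2)%N by rewrite mul2n -[LHS]odd_double_half (negbTE ec).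
  have : c ^+ (2 * (#[c])./2) \in T by rewrite -cE expg_order.
  rewrite c2k => eh; have d4 : 4 %| #[c].
    by rewrite cE -[4]/(2 * 2)%N dvdn_pmul2l // dvdn2.
  by rewrite orderXdiv // divnK.
have TG : T :&: Dh a b = <[a ^+ 3]>.
  apply/eqP; rewrite eqEsubset -{1}p3 -RG setSI //= cycle_subG inE Ta3.
  by rewrite groupX ?Dh_l.
have TH : T :&: Dh c d = <[c ^+ 4]>.
  apply/eqP; rewrite eqEsubset andbC cycle_subG inE Tc4 groupX ?Dh_l //=.
  apply/subsetP=> x /setIP[Tx Hx]; have Rx := subsetP sTR x Tx.
  have evc j : c ^+ j \in R -> c ^+ j = c ^+ (2 * j./2).
    by rewrite dihq_cpow => /negbTE ej; rewrite -{1}[j]odd_double_half ej mul2n.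
  case: (DhP dcd Hx) => -[j xE]; move: Rx Tx; rewrite xE.
    move/evc=> ->; rewrite c2k => ek.
    by rewrite -[j./2]odd_double_half (negbTE ek) add0n -mul2n mulnA expgM mem_cycle.
  rewrite (groupMr _ Rd) => Rcj; rewrite (evc _ Rcj) inT => /and3P[_].
  rewrite expgM (hu1 _ _ (groupX _ Rc2) Rd) (hu2 _ _ (groupX _ Rc2) Rd) (hom2X _ hu1) // (hom2X _ hu2) // u1c u2c u12d.
  by case: (u1 d); case: (odd _).
(* The values of [u1] and [u2] at b c d agree; if they are 1, a conjugate of c^2 corrects both at
   once. *)
have [j Tbd] : exists j, b * (c ^+ j * d) \in T.
  have wbc : u1 (b * c) = ~~ u2 (b * c).
    have [_ _ _ e] := dihq_bvals hf1; move: e; rewrite sw1 // E1 addbT /u1 /u2 => ->.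
    by case: (f1 _); case: (th _).
  have Rbcd : b * c * d \in R by rewrite groupM.
  have w : u1 (b * c * d) = u2 (b * c * d).
    by rewrite hu1 // hu2 // wbc u12d; case: (u2 _); case: (u1 d).
  case h: (u1 (b * c * d)); last first.
    by exists 1%N; rewrite expg1 mulgA inT Rbcd -w h.
  exists 3; have -> : b * (c ^+ 3 * d) = (c ^+ 2) ^ (b * c)^-1 * (b * c * d).
    have e x y : x * y = y ^ x^-1 * x by rewrite conjgE invgK mulgA mulgKV.
    by rewrite [RHS]mulgA -e expgS !mulgA.
  have R1 : (c ^+ 2) ^ (b * c)^-1 \in R by rewrite groupJ ?groupV.
  rewrite inT groupM //= hu1 // hu2 // -w h.
  by rewrite (hom2J hu1) ?groupV // (hom2J hu2) ?groupV // u1c u2c.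
pose d' := c ^+ j * d; have hX' : exact X a b c d' := exact_reflR j hX.
have DE : Dh c d' = Dh c d := Dh_reflE j dcd.
have cT2 : #|T| = (2 * (#[a ^+ 3] * #[c ^+ 4]))%N.
  by apply/eqP; rewrite -(eqn_pmul2r (isT : 0 < 4)) cT dihq_cR p3 -oc; apply/eqP; clear; lia.
have hT : twin X T a b c d' 3 4 by split; rewrite // DE.
have nI' : ~ index2_over X a b c d' by rewrite /index2_over DE.
have lt : #|T| * 2 < #|X|.
  by rewrite cX p3 -cT; have := cardG_gt0 T; clear; lia.
have [r hr [ra rc rbd]] := twin_splits IH (ltnSn _) lt hX' hT (or_intror nI').
have [inva invc] := act_fix hX' hT nI' hr ra rc.
pose Z := hker hr; have hZ : index2 Z T := hker_half hr Tbd rbd.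
have [sZT cZ] := hZ.
have nbT' := twin_act_b hX' hT hr; have ndT' := twin_act_b (exactC hX') (twinC hX' hT) hr.
have nZX : X \subset 'N(Z).
  apply: (ex_normX hX'); apply: hker_norm => //.
  by rewrite (subsetP nTX) ?(ex_d hX').
have nZR : Z <| R by rewrite /normal (subset_trans sZT) //= (subset_trans sRX).
have Zc4 : c ^+ 4 \in Z by rewrite hkerE Tc4 rc.
(* Z meets [R :&: Dh c d] in [<[c ^+ 4]>], so comparing orders gives index 2; phi is the
   homomorphism with this kernel. *)
have hPhi : index2 ((R :&: Dh c d) <*> Z)%G R.
  apply: (@index2_joing _ R Z (R :&: Dh c d)%G) => //; first exact: subsetIl.
  have -> : Z :&: (R :&: Dh c d) = <[c ^+ 4]>.
    apply/eqP; rewrite eqEsubset; apply/andP; split.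
      by rewrite -TH subsetI subIset ?sZT // setIA subsetIr.
    by rewrite cycle_subG !in_setI Zc4 (subsetP sTR) // groupX ?Dh_l.
  have cRH : #|R :&: Dh c d| = #[c].
    apply/eqP; rewrite -(eqn_pmul2l (isT : 0 < 2)) -cH (card_Dh dcd) mulnC //.
  by rewrite /= cRH -oc -cT -cZ -orderE [RHS]mulnC -!mulnA; congr (_ * _)%N; rewrite mulnCA.
pose phi x := x \notin ((R :&: Dh c d) <*> Z)%G.
have hphi : hom2 R phi := half_hom2 hPhi.
have phi_c2 : phi (c ^+ 2) = false.
  apply/negbF; apply: (subsetP (joing_subl _ _)).
  by rewrite inE Rc2 groupX ?Dh_l.
have phiT x : x \in T -> phi x = r x.
  move=> Tx; have -> : r x = (x \notin Z) by rewrite hkerE Tx negbK.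
  congr (~~ _); apply/idP/idP => [|Zx]; last by apply: (subsetP (joing_subr _ _)).
  rewrite -[x \in _]/(x \in (R :&: Dh c d) <*> Z) norm_joinEl; last first.
    by rewrite subIset // (subset_trans sRX).
  case/mulsgP=> h z /setIP[Rh Hh] Zz xE.
  have: h \in T :&: Dh c d by rewrite inE Hh andbT -(groupMr _ (subsetP sZT _ Zz)) -xE.
  rewrite TH xE => hc; rewrite groupM //; apply: subsetP hc; by rewrite cycle_subG.
have phi_b := dihq_b_inv hphi phi_c2.
have phi3 x : x \in R -> phi (x ^ (a ^+ 3)) = phi x by move=> Rx; rewrite (hom2J hphi).
pose S x := phi x (+) phi (x ^ (a ^+ 1)) (+) phi (x ^ (a ^+ 2)).
have hS : hom2 R S by apply: hom2D; [apply: hom2D|] => //; apply: hom2_conj.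
have Sa x : x \in R -> S (x ^ a) = S x.
  move=> Rx; rewrite /S -!conjgM -!expgS phi3 // expg1.
  by case: (phi x); case: (phi _); case: (phi _).
have pneg i x : x \in R -> phi ((x ^ b) ^ (a ^+ i)) = phi (x ^ (a ^- i)).
  move=> Rx; rewrite -conjgM (Dh_refl_conj _ dab) conjgM phi_b //.
  by rewrite memJ_norm // groupV groupX.
have Sb x : x \in R -> S (x ^ b) = S x.
  move=> Rx; rewrite /S !pneg // phi_b // -[phi (x ^ _)]phi3 ?Rj ?groupV // -[phi (x ^ (a ^- 2))]phi3 ?Rj ?groupV //.
  rewrite -!conjgM; have -> : a ^- 1 * a ^+ 3 = a ^+ 2 by rewrite -[a ^+ 3]/(a ^+ (1 + 2)) expgD mulKg.
  have -> : a ^- 2 * a ^+ 3 = a ^+ 1 by rewrite -[a ^+ 3]/(a ^+ (2 + 1)) expgD mulKg.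
  by case: (phi x); case: (phi _); case: (phi _).
have ST x : x \in T -> S x = r x.
  move=> Tx; have Ti i : x ^ (a ^+ i) \in T by rewrite memJ_norm // groupX.
  have ri i : r (x ^ (a ^+ i)) = r x.
    by elim: i => [|i IHi]; rewrite ?conjg1 // expgSr conjgM inva.
  by rewrite /S !phiT // !ri; case: (r x).
have hJ : index2 (hker hS) R.
  by apply: (@hker_half _ R S hS (b * d')); rewrite ?(subsetP sTR) ?ST.
have nJ : hker hS <| X.
  rewrite /normal (subset_trans (hker_sub hS)) //; apply: (@dihq_norm (hker hS)).
  - exact: hker_normK.
  - exact: hker_norm.
  - exact: hker_norm.
apply: (dihq_kill nJ hJ); rewrite p3 hkerE Ra3 ST //.
by rewrite ra.
Qed.

End NotInv.
End Theta.
Lemma dihq_case_d : False.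
Proof.
have lt : #|M| < #|X|.
  have [_ <-] := hRM; rewrite cX; have := cardG_gt0 R; move: p_gt2; clear; nia.
have [K hK sK] := IH dihq_M lt.
have [h|h] := boolP (a \in 'N(hker (hom2S sRM (half_hom2 hK)))).
  exact: dihq_th_inv hK sK h.
exact: dihq_sporadic h.
Qed.

End NotC.
End Tri.

(** If neither [c] nor [d] lies in [R], then c d does, and taking it as the reflection instead of
    [d] reduces to [dihq_case_d]. *)
Lemma dihq_false (gT : finGroupType) (X R : {group gT}) (a b c d : gT) p :
  (forall (K : {group gT}) a' b' c' d', exact K a' b' c' d' -> #|K| < #|X| ->
     index2_over K a' b' c' d') ->
  exact X a b c d -> ~ index2_over X a b c d -> dihq X R a b c d p -> False.
Proof.
move=> IH hX nI [[nR pp op RG oa] [Rb cX cH sH]].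
have [Rc|Rc] := boolP (c \in R).
  exact: (dihq_case_c hX nR pp op RG oa Rb cX cH sH IH nI Rc).
have [Rd|Rd] := boolP (d \in R).
  exact: (dihq_case_d hX nR pp op RG oa Rb cX cH sH IH nI Rc Rd).
have hRM : index2 R (R <*> <[b]>).
  apply: half_adjoin => //; last by case: (ex_dab hX) => _ -> _.
  exact: subsetP (normal_norm nR) _ (ex_b hX).
have Rcd : c ^+ 1 * d \in R.
  by apply: (half_notin hRM); rewrite ?expg1 // (subsetP sH) ?Dh_l ?Dh_r.
have DE := Dh_reflE 1 (ex_dcd hX).
have hX' := exact_reflR 1 hX.
have nI' : ~ index2_over X a b c (c ^+ 1 * d) by rewrite /index2_over DE.
by apply: (dihq_case_d hX' nR pp op RG oa Rb cX _ _ IH nI' Rc Rcd); rewrite DE.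
Qed.

Theorem exact_index2_over (gT : finGroupType) (X : {group gT}) (a b c d : gT) :
  exact X a b c d -> index2_over X a b c d.
Proof.
have [n] := ubnP #|X|; elim: n => // n IHn in gT X a b c d *.
rewrite ltnS => le hX.
have IH (rT : finGroupType) (K : {group rT}) (a' b' c' d' : rT) :
    exact K a' b' c' d' -> #|K| < #|X| -> index2_over K a' b' c' d'.
  by move=> hK lt; apply: IHn hK; apply: leq_trans lt le.
have [//|nI] := index2_over_dec X a b c d.
have hXC := exactC hX.
case: (dihq_exists IH hX nI) => -[R [i [p hT]]]; exfalso.
  apply: (dihq_false (IH gT) (exact_reflL i hX) _ hT).
  by move/(index2_over_refl hX).
apply: (dihq_false (IH gT) (exact_reflL i hXC) _ hT).
by move/(index2_over_refl hXC)/index2_overC.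
Qed.

(** * Homomorphisms on <a^2, b><c^2, d> *)

Section Forms.
Variable gT : finGroupType.
Implicit Types (a b c d x y : gT) (K L M N X Y Q : {group gT}) (f u v : gT -> bool).

(* The kernel of f in M is <c, d><a>. *)
Definition refl_hom M a b c d : Prop :=
  exists2 f, hom2 M f & [/\ f a = false, f b, f c = false & f d = false].

Definition hom_form3 X a b c d : Prop :=
  exists2 M, index2 M X & [/\ a \notin M, b \in M, Dh c d \subset M & refl_hom M (a ^+ 2) b c d].

(* If 4 does not divide #[c] then <c^4> = <c^2>, and the middle layer of form (4)
   is trivial. *)
Definition hom_form4 X a b c d : Prop :=
  exists2 N, index2 N X & [/\ c \notin N, Dh a b \subset N, d \in N &
    (~~ (4 %| #[c]) /\ refl_hom N (c ^+ 2) d a b) \/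
    exists2 M, index2 M N & [/\ c ^+ 2 \notin M, Dh a b \subset M, d \in M &
      refl_hom M (c ^+ 4) d a b]].

Lemma ex_eq X a b c d f u : exact X a b c d -> hom2 X f -> hom2 X u -> f a = u a ->
  f b = u b -> f c = u c -> f d = u d -> {in X, f =1 u}.
Proof.
move=> hX hf hu ea eb ec ed; apply: (hom2_gen hf hu (S := [set a; b; c; d])).
- by rewrite !subUset !sub1set (ex_a hX) (ex_b hX) (ex_c hX) (ex_d hX).
- by rewrite -(ex_gen hX).
- by move=> x; rewrite !inE => /orP[/orP[/orP[]|]|] /eqP ->.
Qed.

Lemma hom2_inv_dec M f g : {in M, forall x, f (x ^ g) = f x} \/
  exists2 x, x \in M & f (x ^ g) != f x.
Proof.
case: (boolP [forall x in M, f (x ^ g) == f x]) => [/forall_inP h|].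
  by left=> x Mx; apply/eqP/h.
by rewrite negb_forall_in => /exists_inP[x Mx h]; right; exists x.
Qed.

Lemma hom2_sum M f g x : hom2 M f -> g \in 'N(M) -> g ^+ 2 \in M -> x \in M -> f x ->
  exists2 v, hom2 M v & [/\ {in M, forall y, v (y ^ g) = v y},
     exists2 y, y \in M & v y &
     (v =1 f) \/ (v =1 fun y => f (y ^ g) (+) f y)].
Proof.
move=> hf ng g2 Mx fx; case: (hom2_inv_dec M f g) => [inv|[y My fy]].
  by exists f => //; split=> //; [exists x | left].
exists (fun y => f (y ^ g) (+) f y); first exact: hom2D (hom2_conj ng hf) hf.
split; last by right.
  by move=> z Mz; rewrite /= -conjgM -expg2 (hom2J hf Mz g2) addbC.
by exists y => //; case: (f y) (f (y ^ g)) fy => [] [].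
Qed.

Lemma refl_hom_change M a b c d i : a \in M -> b \in M ->
  refl_hom M a (a ^+ i * b) c d -> refl_hom M a b c d.
Proof.
move=> Ma Mb [f hf [fa fb fc fd]]; exists f => //; split=> //.
by move: fb; rewrite hf ?groupX // (hom2X _ hf) // fa andbF.
Qed.

Lemma ev_order X f x : hom2 X f -> x \in X -> f x -> (#[x ^+ 2] * 2 = #[x])%N.
Proof.
move=> hf Xx fx; have e : 2 %| #[x].
  rewrite dvdn2; apply/negP=> o; have := hom2X #[x] hf Xx.
  by rewrite expg_order (hom2_1 hf) o fx.
by rewrite orderXdiv // divnK.
Qed.

Lemma exact_hker X a b c d u (hu : hom2 X u) : exact X a b c d -> u a -> u b = false ->
  u c = false -> u d = false -> exact (hker hu) (a ^+ 2) b c d.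
Proof.
move=> hX ua ub uc ud; have [dab dcd] := (ex_dab hX, ex_dcd hX).
have [Xa Xb Xc Xd] := And4 (ex_a hX) (ex_b hX) (ex_c hX) (ex_d hX).
apply: (exact_sub hX) => //; first exact: dihp_pow.
- exact: Dh_pow_sub.
- by rewrite Dh_sub !hkerE groupX // Xb ub (hom2X _ hu).
- by rewrite Dh_sub !hkerE Xc Xd uc ud.
have [_ c2] := hker_half hu Xa ua.
rewrite -(leq_pmul2r (isT : 0 < 2)) c2 (ex_card4 hX) -(ev_order hu Xa ua).
by clear; lia.
Qed.

Lemma refl_J a b : dihp a b -> b ^ a = b * a ^+ 2.
Proof.
move=> dab; have := Dh_refl_conj 1 dab; rewrite !expg1 => e.
by rewrite conjgE expg2 !mulgA e.
Qed.

(** Let u come from the key fact. More is needed only if u kills [c], [d] but not [a]: then its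
    kernel is an exact product <a^2, b'><c, d>, and induction yields a nonzero f there with f(a^2) =
    0. One of f and f + f^a is [a]-invariant and nonzero, and extends to [X] with value 0 at [a]. *)
Lemma refl_hom_or_trivial X a b c d : exact X a b c d ->
  refl_hom X a b c d \/ exists2 f, hom2 X f & [/\ f a = false, f b = false & f c || f d].
Proof.
have [n] := ubnP #|X|; elim: n => // n IHn in X a b c d *.
rewrite ltnS => le hX; have [K hK sub] := exact_index2_over hX.
have [dab dcd] := (ex_dab hX, ex_dcd hX).
have [Xa Xb Xc Xd] := And4 (ex_a hX) (ex_b hX) (ex_c hX) (ex_d hX).
pose u x := x \notin K; have hu : hom2 X u := half_hom2 hK.
have ntu : ~ [/\ u a = false, u b = false, u c = false & u d = false].
  case=> ua ub uc ud; have [sK cK] := hK.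
  have : X \subset K.
    rewrite -[X \subset K]/((X : {set gT}) \subset K); case: hX => _ _ <- _.
    by rewrite mul_subG // Dh_sub; apply/andP; split; apply: negbFE.
  by move/subset_leq_card; rewrite -cK; have := cardG_gt0 K; clear; lia.
case/orP: sub; rewrite Dh_sub => /andP[k1 k2].
  have [ua ub] : u a = false /\ u b = false by rewrite /u k1 k2.
  right; exists u => //; split=> //; apply/negbNE/negP=> /norP[uc ud].
  by apply: ntu; split=> //; apply: negbTE.
have [uc ud] : u c = false /\ u d = false by rewrite /u k1 k2.
case ua: (u a); last first.
  by left; exists u => //; split=> //; apply/negbNE/negP=> /negbTE ub; apply: ntu.
have [i [ubi]] : exists i, u (a ^+ i * b) = false.
  case ub: (u b); last by exists 0; rewrite mul1g.
  by exists 1%N; rewrite expg1 hu // ua ub.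
set b' := a ^+ i * b in ubi; have hX' : exact X a b' c d := exact_reflL i hX.
have Xb' := ex_b hX'.
suff: refl_hom X a b' c d \/ exists2 f, hom2 X f & [/\ f a = false, f b' = false & f c || f d].
  case=> [|[f hf [fa fb fcd]]]; first by move=> h; left; apply: (refl_hom_change Xa Xb h).
  right; exists f => //; split=> //; move: fb.
  by rewrite /b' hf ?groupX // (hom2X _ hf) // fa andbF.
pose M := hker hu; have hM : index2 M X := hker_half hu Xa ua.
have exM : exact M (a ^+ 2) b' c d by apply: exact_hker.
have [_ cM] := hM.
have lt : #|M| < n by apply: leq_trans le; rewrite -cM; have := cardG_gt0 M; clear; lia.
have Ma : a \notin M by rewrite hkerE Xa ua.
have [Ma2 Mb Mc Md] := And4 (ex_a exM) (ex_b exM) (ex_c exM) (ex_d exM).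
have na : a \in 'N(M) := subsetP (normal_norm (half_norm hM)) _ Xa.
have [f hf [fa2 [x Mx fx] alt]] : exists2 f, hom2 M f &
    [/\ f (a ^+ 2) = false, exists2 x, x \in M & f x &
        f b' = false \/ f c = false /\ f d = false].
  case: (IHn _ _ _ _ _ lt exM) => [[f hf [fa fb fc fd]]|[f hf [fa fb fcd]]]; exists f => //; split=> //.
  - by exists b'.
  - by right.
  - by case/orP: fcd => h; [exists c | exists d].
  - by left.
have [v hv [vinv [y My vy] vE]] := hom2_sum hf na Ma2 Mx fx.
have ca : (a ^+ 2) ^ a = a ^+ 2 by apply/conjg_fixP/commgP/commute_sym/commuteX.
have va2 : v (a ^+ 2) = false by case: vE => ->; rewrite ?ca fa2.
have [h hh [hE ha]] := hom2_ext hM Xa Ma hv vinv va2.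
have [hb hc hd] : [/\ h b' = v b', h c = v c & h d = v d] by split; apply: hE.
case vb: (v b').
  (* f + f^a kills b', because b'^a = b' a^2 and f kills a^2; so v = f here. *)
  case: vE => vE; last first.
    by move: vb; rewrite vE (refl_J (ex_dab hX')) hf // fa2 addbF addbb.
  case: alt => [fb|[fc fd]]; first by rewrite vE fb in vb.
  by left; exists h => //; split=> //; rewrite ?hb ?hc ?hd ?vb // vE.
right; exists h => //; split=> //; first by rewrite hb.
apply/negbNE/negP=> /norP[/negbTE hc0 /negbTE hd0]; move: vy.
rewrite (ex_eq exM hv (fun _ _ _ _ => erefl) (u := fun=> false)) //.
- by rewrite -hc.
- by rewrite -hd.
Qed.

(* The kernels of be and de are <a^2, b><c, d> and <a, b><c^2, d>. *)
Definition frame X K a b c d be de : Prop :=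
  [/\ exact X a b c d,
      hom2 X be /\ [/\ be a, be b = false, be c = false & be d = false],
      hom2 X de /\ [/\ de c, de d = false, de a = false & de b = false] &
      forall x, (x \in K) = [&& x \in X, ~~ be x & ~~ de x]].

Lemma frameC X K a b c d be de : frame X K a b c d be de -> frame X K c d a b de be.
Proof.
case=> hX [hb [? ? ? ?]] [hd [? ? ? ?]] KE; have hXC := exactC hX; split=> // x.
by rewrite KE [~~ be x && _]andbC.
Qed.

Section Frame.
Variables (X K : {group gT}) (a b c d : gT) (be de : gT -> bool).
Hypothesis hF : frame X K a b c d be de.

Let hX : exact X a b c d. Proof. by case: hF. Qed.
Let hbe : hom2 X be. Proof. by case: hF => _ []. Qed.
Let hde : hom2 X de. Proof. by case: hF => _ _ []. Qed.
Let KE x : (x \in K) = [&& x \in X, ~~ be x & ~~ de x]. Proof. by case: hF. Qed.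
Let be_a : be a. Proof. by case: hF => _ [_ []]. Qed.
Let be_c : be c = false. Proof. by case: hF => _ [_ []]. Qed.
Let be_b : be b = false. Proof. by case: hF => _ [_ []]. Qed.
Let be_d : be d = false. Proof. by case: hF => _ [_ []]. Qed.
Let de_a : de a = false. Proof. by case: hF => _ _ [_ []]. Qed.
Let de_b : de b = false. Proof. by case: hF => _ _ [_ []]. Qed.
Let de_c : de c. Proof. by case: hF => _ _ [_ []]. Qed.
Let de_d : de d = false. Proof. by case: hF => _ _ [_ []]. Qed.
Let dab := ex_dab hX.
Let dcd := ex_dcd hX.
Let Xa := ex_a hX.
Let Xb := ex_b hX.
Let Xc := ex_c hX.
Let Xd := ex_d hX.

Lemma fr_sub : K \subset X.
Proof. by apply/subsetP=> x; rewrite KE => /and3P[]. Qed.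

Lemma fr_norm : X \subset 'N(K).
Proof.
apply/subsetP=> g Xg; rewrite inE; apply/subsetP=> _ /imsetP[x Kx ->]; move: Kx.
by rewrite !KE => /and3P[Xx h1 h2]; rewrite groupJ // (hom2J hbe) // (hom2J hde) // h1.
Qed.

Let na : a \in 'N(K). Proof. exact: subsetP fr_norm _ Xa. Qed.
Let nc : c \in 'N(K). Proof. exact: subsetP fr_norm _ Xc. Qed.

Definition fr_M : {group gT} := hker hde.

Lemma fr_ME x : (x \in fr_M) = (x \in X) && ~~ de x. Proof. exact: hkerE. Qed.

Lemma fr_MX : index2 fr_M X. Proof. exact: hker_half Xc de_c. Qed.

Lemma fr_exM : exact fr_M a b (c ^+ 2) d.
Proof. exact: exactC (exact_hker hde (exactC hX) de_c de_d de_a de_b). Qed.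

Lemma fr_KE : K :=: hker (hom2S (hker_sub hde) hbe).
Proof. by apply/setP=> x; rewrite KE hkerE fr_ME -andbA [~~ be x && _]andbC. Qed.

Lemma fr_KM : index2 K fr_M.
Proof.
have Ma : a \in fr_M := ex_a fr_exM.
by rewrite /index2 fr_KE; apply: (hker_half _ Ma be_a).
Qed.

Lemma fr_ex : exact K (a ^+ 2) b (c ^+ 2) d.
Proof.
have be_c2 : be (c ^+ 2) = false by rewrite (hom2X _ hbe).
have := exact_hker (hom2S (hker_sub hde) hbe) fr_exM be_a be_b be_c2 be_d.
by rewrite /exact -fr_KE.
Qed.

Lemma fr_eq f u : hom2 K f -> hom2 K u -> f (a ^+ 2) = u (a ^+ 2) -> f b = u b ->
  f (c ^+ 2) = u (c ^+ 2) -> f d = u d -> {in K, f =1 u}.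
Proof. exact: ex_eq fr_ex. Qed.

Lemma fr_0 f : hom2 K f -> f (a ^+ 2) = false -> f b = false ->
  f (c ^+ 2) = false -> f d = false -> {in K, f =1 xpred0}.
Proof. by move=> hf *; apply: fr_eq. Qed.

Let Ka2 := ex_a fr_ex.
Let Kb := ex_b fr_ex.
Let Kc2 := ex_c fr_ex.
Let Kd := ex_d fr_ex.

Lemma fr_vals f : hom2 K f -> f ((a ^+ 2) ^ a) = f (a ^+ 2) /\ f (b ^ a) = f b (+) f (a ^+ 2).
Proof.
move=> hf; split; first by congr f; apply/conjg_fixP/commgP/commute_sym/commuteX.
by rewrite (refl_J dab) hf.
Qed.

Lemma fr_aa f : hom2 K f -> {in K, forall x, f ((x ^ a) ^ a) = f x}.
Proof. by move=> hf x Kx; rewrite -conjgM -expg2 (hom2J hf). Qed.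

Lemma fr_comm f : hom2 K f -> {in K, forall x, f ((x ^ a) ^ c) = f ((x ^ c) ^ a)}.
Proof.
move=> hf x Kx; have Kac : [~ a, c] \in K.
  rewrite commgEl KE groupM ?groupV ?groupJ //=.
  rewrite hbe ?groupV ?groupJ // hde ?groupV ?groupJ // (hom2V hbe) // (hom2V hde) //.
  by rewrite (hom2J hbe) // (hom2J hde) // !addbb.
rewrite -!conjgM commgC conjgM (hom2J hf) //.
by rewrite memJ_norm // groupM.
Qed.

Lemma fr_ext f : hom2 K f -> {in K, forall x, f (x ^ a) = f x} -> f (a ^+ 2) = false ->
  exists2 h, hom2 fr_M h & {in K, h =1 f} /\ h a = false.
Proof.
move=> hf inv f2; apply: (hom2_ext fr_KM) => //; first exact: ex_a fr_exM.
by rewrite KE be_a andbF.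
Qed.

Lemma fr_hom_form3 f : hom2 K f -> {in K, forall x, f (x ^ a) = f x} -> f (a ^+ 2) = false ->
  f b = false -> f (c ^+ 2) = false -> f d -> hom_form3 X c d a b.
Proof.
move=> hf inv fa fb fc fd; have [h hh [hE ha]] := fr_ext hf inv fa.
exists fr_M; first exact: fr_MX.
rewrite Dh_sub !fr_ME Xa Xb Xc Xd de_c de_d de_a de_b; split=> //.
by exists h => //; rewrite (hE _ Kc2) (hE _ Kd) (hE _ Kb) fb fc fd ha.
Qed.

(** If u(c^2) = 1, then u^a or u + u^a is nonzero at [d] alone, unless [u] is [a]-invariant. In that
    case s = u + u^c kills c^2, has value u(c^2) = 1 at [d], and is still [a]-invariant, so it kills
    a^2; only its value at [b] remains open. *)
Lemma fr_stepB_half u : hom2 K u -> u (a ^+ 2) = false -> u b = false ->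
  u (c ^+ 2) || u d ->
  refl_hom K (c ^+ 2) d (a ^+ 2) b \/
  exists2 e, hom2 K e & [/\ e (a ^+ 2) = false, e b, e (c ^+ 2) = false & e d] /\
    {in K, forall x, e (x ^ a) = e x} /\ {in K, forall x, e (x ^ c) = e x}.
Proof.
move=> hu ua ub; case uc: (u (c ^+ 2)); last by move=> /= ud; left; exists u.
move=> _.
have hua := hom2_conj na hu; have huc := hom2_conj nc hu.
have [a1 a2] := fr_vals hu; rewrite ua ub in a1 a2.
case r: (u ((c ^+ 2) ^ a)); last first.
  case t: (u (d ^ a)); first by left; exists (fun x => u (x ^ a)).
  have z := fr_0 hua a1 a2 r t; have := fr_aa hu Kc2.
  by rewrite z ?uc // memJ_norm.
case e: (u (d ^ a) (+) u d).
  left; exists (fun x => u (x ^ a) (+) u x); first exact: hom2D.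
  by rewrite r uc a1 ua a2 ub.
have inv : {in K, forall x, u (x ^ a) = u x}.
  apply: (fr_eq hua hu); rewrite ?a1 ?a2 ?r ?ua ?ub ?uc //.
  by case: (u d) (u (d ^ a)) e => [] [].
have [c1 c2] : u ((c ^+ 2) ^ c) = u (c ^+ 2) /\ u (d ^ c) = u d (+) u (c ^+ 2).
  split; first by congr u; apply/conjg_fixP/commgP/commute_sym/commuteX.
  by rewrite (refl_J dcd) hu.
rewrite uc in c1 c2.
pose s x := u (x ^ c) (+) u x; have hs : hom2 K s := hom2D huc hu.
have sa : {in K, forall x, s (x ^ a) = s x}.
  by move=> x Kx; rewrite /s fr_comm // !inv // memJ_norm.
have sc : {in K, forall x, s (x ^ c) = s x}.
  by move=> x Kx; rewrite /s -conjgM -expg2 (hom2J hu Kx Kc2) addbC.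
have s1 : s (c ^+ 2) = false by rewrite /s c1 uc.
have s2 : s d by rewrite /s c2; case: (u d).
have [_ e2] := fr_vals hs.
have s3 : s (a ^+ 2) = false.
  by move: e2; rewrite (sa _ Kb); case: (s b); case: (s _).
case sb: (s b); first by right; exists s.
by left; exists s.
Qed.

(** The kernel of [e] is a twin subgroup with both exponents 2, so [par_ok] holds by parity although
    [X] does have a subgroup of index 2 over a factor. A splitting homomorphism extends to [K] with
    value 0 at [b], hence 1 at [d]. *)
Lemma fr_stepB_eps e : hom2 K e -> e (a ^+ 2) = false -> e b -> e (c ^+ 2) = false -> e d ->
  {in K, forall x, e (x ^ a) = e x} -> {in K, forall x, e (x ^ c) = e x} ->
  refl_hom K (c ^+ 2) d (a ^+ 2) b.
Proof.
move=> he ea eb ec ed inva invc; pose P := hker he.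
have hP : index2 P K := hker_half he Kb eb; have [sPK cP] := hP.
have [_ cM] := fr_MX; have [_ cK] := fr_KM.
have Kj x : x \in K -> {in K, forall y, e (y ^ x) = e y} by move=> Kx y Ky; apply: (hom2J he).
have nP : P <| X.
  rewrite /normal (subset_trans sPK) ?fr_sub //=.
  have nK x : x \in X -> x \in 'N(K) := subsetP fr_norm x.
  by apply: (ex_normX hX); apply: hker_norm => //; rewrite ?nK //; apply: Kj.
have Pbd : b * d \in P by rewrite hkerE groupM //= he // eb ed.
have TI x y (f : gT -> bool) : hom2 X f -> f x -> dihp x y -> x \in X ->
    {in K, forall z, f z = false} -> x ^+ 2 \in P -> y \in K -> e y ->
    P :&: Dh x y = <[x ^+ 2]>.
  move=> hf fx dxy Xx fK Px2 Ky ey; apply/eqP; rewrite eqEsubset.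
  apply/andP; split; last by rewrite cycle_subG in_setI Px2 groupX ?Dh_l.
  apply/subsetP=> z /setIP[Pz Dz].
  have Kz := subsetP sPK z Pz; have Xz := subsetP fr_sub z Kz.
  have Xy := subsetP fr_sub y Ky.
  have ev i : f (x ^+ i) = false -> x ^+ i = (x ^+ 2) ^+ i./2.
    rewrite (hom2X _ hf) // fx andbT => ei.
    by rewrite -expgM mul2n -{1}[i]odd_double_half ei.
  case: (DhP dxy Dz) => -[i zE]; have := fK z Kz; rewrite zE.
    by move/ev=> ->; apply: mem_cycle.
  rewrite hf ?groupX // (fK y Ky) addbF => /ev xi; move: Pz; rewrite zE xi.
  by rewrite (groupMl _ (groupX _ Px2)) hkerE ey andbF.
have Pa2 : a ^+ 2 \in P by rewrite hkerE Ka2 ea.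
have Pc2 : c ^+ 2 \in P by rewrite hkerE Kc2 ec.
have hT : twin X P a b c d 2 2.
  split=> //.
  - by apply: (TI a b be) => // z; rewrite KE => /and3P[_ /negbTE].
  - by apply: (TI c d de) => // z; rewrite KE => /and3P[_ _ /negbTE].
  - apply/eqP; rewrite -(eqn_pmul2r (isT : 0 < 2)) cP (ex_card4 fr_ex); apply/eqP.
    by clear; lia.
have lt : #|P| * 2 < #|X|.
  by rewrite -cM -cK cP; have := cardG_gt0 K; clear; lia.
have ok : par_ok X a c b d 2 2 by left.
have IH K' a' b' c' d' : exact K' a' b' c' d' -> #|K'| < #|X| -> index2_over K' a' b' c' d'.
  by move=> h _; apply: exact_index2_over.
have [r hr [ra rc rbd]] := twin_splits IH (ltnSn _) lt hX hT ok.
have Pb : b \notin P by rewrite hkerE eb andbF.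
have rb2 : r (b ^+ 2) = false by have [_ -> _] := dab; apply: hom2_1 hr.
have [v hv [vE vb]] := hom2_ext hP Kb Pb hr (twin_act_b hX hT hr) rb2.
exists v => //; rewrite (vE _ Pc2) (vE _ Pa2); split=> //.
by have := vE _ Pbd; rewrite rbd hv // vb.
Qed.

End Frame.
End Forms.

(** * The action of [a] and [c] on Hom(K, Z/2) *)

Section Steps.
Variable gT : finGroupType.
Implicit Types (a b c d x y : gT) (K L M N X Y Q : {group gT}) (f u v : gT -> bool).

Definition fixes L Q v : Prop := {in Q & L, forall g x, v (x ^ g) = v x}.

(** A group of order 2 acting on a nonzero space over Z/2 fixes a nonzero vector: [v] itself, or v +
    v^g for g in [Y] outside [Q]. *)
Lemma fixes_step L Q Y v : index2 Q Y -> Y \subset 'N(L) -> hom2 L v ->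
  (exists2 x, x \in L & v x) -> fixes L Q v ->
  exists2 w, hom2 L w & (exists2 x, x \in L & w x) /\ fixes L Y w.
Proof.
move=> hQ nY hv [x0 Lx0 vx0] inv; have [sQ cQ] := hQ.
have [g Yg Qg] : exists2 g, g \in Y & g \notin Q.
  apply/subsetPn; apply/negP=> /subset_leq_card; rewrite -cQ.
  by have := cardG_gt0 Q; clear; lia.
have nL y : y \in Y -> y \in 'N(L) by apply: subsetP.
have Qg2 : g ^+ 2 \in Q by rewrite expg2; apply: (half_notin hQ).
suff [w hw [nt invw wg]] : exists2 w, hom2 L w & [/\ exists2 x, x \in L & w x,
    fixes L Q w & {in L, forall x, w (x ^ g) = w x}].
  exists w => //; split=> // y x Yy Lx; have [Qy|Qy] := boolP (y \in Q); first exact: invw.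
  have Qyg : y * g^-1 \in Q by apply: (half_notin hQ); rewrite ?groupV.
  rewrite -[y](mulgKV g) conjgM wg ?invw // memJ_norm // nL // (subsetP sQ) //.
case: (hom2_inv_dec L v g) => [h|[y Ly vy]]; first by exists v => //; split=> //; exists x0.
exists (fun x => v (x ^ g) (+) v x); first exact: hom2D (hom2_conj (nL g Yg) hv) hv.
split.
- by exists y => //; case: (v y) (v (y ^ g)) vy => [] [].
- move=> q x Qq Lx /=; rewrite (inv q x Qq Lx); congr (_ (+) _).
  have E : q * g = g * q ^ g by rewrite conjgE mulKVg.
  rewrite -conjgM E conjgM; apply: inv; last by rewrite memJ_norm // nL.
  by rewrite memJ_norm // (subsetP (normal_norm (half_norm hQ))).
- by move=> x Lx /=; rewrite -conjgM -expg2 (inv _ _ Qg2 Lx) addbC.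
Qed.

Section Frame.
Variables (X K : {group gT}) (a b c d : gT) (be de : gT -> bool).
Hypothesis hF : frame X K a b c d be de.

Let hX : exact X a b c d. Proof. by case: hF. Qed.
Let hFC := frameC hF.
Let hK := fr_ex hF.
Let nK := fr_norm hF.
Let dab := ex_dab hX.
Let dcd := ex_dcd hX.
Let na : a \in 'N(K). Proof. exact: subsetP nK _ (ex_a hX). Qed.
Let nc : c \in 'N(K). Proof. exact: subsetP nK _ (ex_c hX). Qed.
Let Ka2 := ex_a hK.
Let Kb := ex_b hK.
Let Kc2 := ex_c hK.
Let Kd := ex_d hK.

(** Suppose g is not [c]-invariant; then g^c is nonzero at a^2, hence not [a]-invariant, and neither
    is g. So t = g + g^a is nonzero, and it kills a^2 and [b]. If t(c^2) = 1, then t + t^c has the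
    right values at c^2 and [d], and adding g^c and g where needed corrects those at a^2 and [b]. *)
Lemma fr_stepC1 : refl_hom K (a ^+ 2) b (c ^+ 2) d -> hom_form3 X a b c d \/ refl_hom K (c ^+ 2) d (a ^+ 2) b.
Proof.
case=> g hg [ga gb gc gd].
case: (hom2_inv_dec K g c) => [inv|[y Ky gy]]; first by left; apply: (fr_hom_form3 hFC hg).
right; have hgc := hom2_conj nc hg; have hga := hom2_conj na hg.
have [c1 c2] := fr_vals hFC hg; rewrite gc gd in c1 c2.
have [a1 a2] := fr_vals hF hg; rewrite ga gb in a1 a2.
have [p|p] := boolP (g ((a ^+ 2) ^ c)); last first.
  have p0 := negbTE p; have [q|q] := boolP (g (b ^ c)).
    by case/eqP: gy; apply: (fr_eq hF hgc hg); rewrite ?p0 ?q ?c1 ?c2 ?ga ?gb.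
  have z := fr_0 hF hgc p0 (negbTE q) c1 c2.
  by have := fr_aa hFC hg Kb; rewrite gb z // memJ_norm.
pose t x := g (x ^ a) (+) g x; have ht : hom2 K t := hom2D hga hg.
have ta : t (a ^+ 2) = false by rewrite /t a1 ga.
have tb : t b = false by rewrite /t a2 gb.
have tc : t (c ^+ 2) = g ((c ^+ 2) ^ a) by rewrite /t gc addbF.
have td : t d = g (d ^ a) by rewrite /t gd addbF.
have nt : t (c ^+ 2) || t d.
  apply/negbNE/negP=> /norP[/negbTE t1 /negbTE t2].
  have inv : {in K, forall x, g (x ^ a) = g x}.
    by apply: (fr_eq hF hga hg); rewrite ?a1 ?a2 -?tc -?td ?t1 ?t2 ?ga ?gb ?gc ?gd.
  have [_ e] := fr_vals hF hgc; move: e; rewrite p (fr_comm hF hg Kb) inv; last by rewrite memJ_norm.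
  by case: (g _).
case tcE: (t (c ^+ 2)) in nt; last by exists t => //; split.
have [t1 t2] := fr_vals hFC ht; rewrite tcE in t1 t2.
pose s x := t (x ^ c) (+) t x; have hs : hom2 K s := hom2D (hom2_conj nc ht) ht.
have sc : s (c ^+ 2) = false by rewrite /s t1 tcE.
have sd : s d by rewrite /s t2; case: (t d).
pose s' x := if s (a ^+ 2) then s x (+) g (x ^ c) else s x.
have hs' : hom2 K s' by rewrite /s'; case: (s _) => //; apply: hom2D.
pose s'' x := if s' b then s' x (+) g x else s' x.
have hs'' : hom2 K s'' by rewrite /s''; case: (s' b) => //; apply: hom2D.
have s'a : s' (a ^+ 2) = false by rewrite /s'; case E: (s _); rewrite ?p ?E.
have s'c : s' (c ^+ 2) = false by rewrite /s'; case E: (s _); rewrite ?c1 sc.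
have s'd : s' d by rewrite /s'; case E: (s _); rewrite ?c2 sd.
exists s'' => //; rewrite /s''; case sb: (s' b); split; rewrite ?s'c ?s'd ?s'a ?ga ?gb ?gc ?gd //.
Qed.

(** If g is not [a]-invariant, h = g + g^a is, with h(c^2) = 1, and the kernel of its extension is
    the innermost group M of form (4). On the part of M inside [K] the vanishing of h says that g is
    [a]-invariant, so g extends from there to M. *)
Lemma fr_stepC2 : refl_hom K (c ^+ 2) d (a ^+ 2) b ->
  (exists2 f, hom2 K f & [/\ f (c ^+ 2) = false, f d, f (a ^+ 2) = false & f b = false] /\
     {in K, forall x, f (x ^ a) = f x}) \/ exists j, hom_form4 X a b c (c ^+ j * d).
Proof.
case=> g hg [gc gd ga gb].
case: (hom2_inv_dec K g a) => [inv|[y Ky gy]]; first by left; exists g.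
right; have hga := hom2_conj na hg.
have [a1 a2] := fr_vals hF hg; rewrite ga gb in a1 a2.
pose h x := g (x ^ a) (+) g x; have hh : hom2 K h := hom2D hga hg.
have hha : h (a ^+ 2) = false by rewrite /h a1 ga.
have hhb : h b = false by rewrite /h a2 gb.
have hhc : h (c ^+ 2).
  rewrite /h gc addbF; apply/negbNE/negP=> /negbTE r; have [t|/negbTE t] := boolP (g (d ^ a)).
    by case/eqP: gy; apply: (fr_eq hF hga hg); rewrite ?a1 ?a2 ?r ?t ?ga ?gb ?gc ?gd.
  have z := fr_0 hF hga a1 a2 r t; have := fr_aa hF hg Kd.
  by rewrite gd z // memJ_norm.
have inv : {in K, forall x, h (x ^ a) = h x}.
  by move=> x Kx; rewrite /h (fr_aa hF) // addbC.
have [h' hh' [hE h'a]] := fr_ext hF hh inv hha.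
(* Since h(c^2) = 1, one of [d] and c^2 d is in the kernel of h. *)
pose j := if h d then 2 else 0; pose d' := c ^+ j * d.
have Kcj : c ^+ j \in K by rewrite /j; case: ifP => _; [apply: Kc2 | apply: group1].
have Kd' : d' \in K by rewrite groupM.
have hd' : h d' = false by rewrite /d' /j; case E: (h d); rewrite ?mul1g // hh // hhc E.
have gd' : g d' by rewrite /d' hg // gd /j; case: ifP; rewrite ?gc ?(hom2_1 hg).
have exM := fr_exM hF; have [sKM cKM] := fr_KM hF; have sK := subsetP sKM.
have Ma : a \in fr_M hF := ex_a exM; have Mc2 : c ^+ 2 \in fr_M hF := ex_c exM.
pose M := hker hh'; have hM : index2 M (fr_M hF).
  by apply: (hker_half hh' Mc2); rewrite hE.
have ME x : (x \in M) = (x \in fr_M hF) && ~~ h' x by apply: hkerE.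
have Ma' : a \in M by rewrite ME Ma h'a.
have MK x : x \in K -> (x \in M) = ~~ h x by move=> Kx; rewrite ME sK // hE.
have Mb : b \in M by rewrite MK // hhb.
have Md' : d' \in M by rewrite MK // hd'.
have c4E : c ^+ 4 = (c ^+ 2) ^+ 2 by rewrite -expgM.
have Kc4 : c ^+ 4 \in K by rewrite c4E groupX.
have Mc4 : c ^+ 4 \in M by rewrite MK // c4E (hom2X 2 hh Kc2).
exists j, (fr_M hF); first exact: fr_MX.
split.
- by rewrite fr_ME; case: hF => _ _ [_ [-> _ _ _]] _; rewrite andbF.
- by rewrite Dh_sub Ma sK.
- exact: sK.
right; exists M => //; split=> //.
- by rewrite MK // hhc.
- by rewrite Dh_sub Ma'.
have hbe : hom2 X be by case: hF => _ [].
have be_a : be a by case: hF => _ [_ []].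
have sMX : M \subset X by apply: subset_trans (hker_sub hh') (hker_sub _).
pose M1 := hker (hom2S sMX hbe).
have hM1 : index2 M1 M := hker_half (hom2S sMX hbe) Ma' be_a.
have M1E x : (x \in M1) = (x \in M) && (x \in K).
  rewrite hkerE ME fr_ME; case: hF => _ _ _ ->.
  by case: (x \in X); case: (be x); case: (de x); case: (h' x).
have sM1K : M1 \subset K by apply/subsetP=> x; rewrite M1E => /andP[].
have g1 : hom2 M1 g := hom2S sM1K hg.
have inv1 : {in M1, forall x, g (x ^ a) = g x}.
  move=> x; rewrite M1E => /andP[Mx Kx]; move: Mx; rewrite MK // /h.
  by case: (g x); case: (g _).
have M1a : a \notin M1 by rewrite hkerE be_a andbF.
have [l hl [lE la]] := hom2_ext hM1 Ma' M1a g1 inv1 ga.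
exists l => //; split=> //.
- by rewrite lE ?M1E ?Mc4 // c4E (hom2X 2 hg Kc2).
- by rewrite lE // M1E Md'.
- by rewrite lE // M1E Mb.
Qed.

(** Let h extend [g] to <a, b><c^2, d> with h(a) = 0. If [g] is not [c]-invariant, g + g^c is
    nonzero at [b] alone and gives form (3). If it is, h extends to [X] unless h(a^c) = 1. In that
    last case, with 4 dividing [#[c]], the sign of the action of L = ker g on the cosets of <a^2, b>
    is a nonzero homomorphism; it leads to one invariant under [X], which is nonzero at [b] and
    again gives form (3). *)
Lemma fr_stepD g : hom2 K g -> g (c ^+ 2) = false -> g d -> g (a ^+ 2) = false -> g b = false ->
  {in K, forall x, g (x ^ a) = g x} ->
  [\/ refl_hom X c d a b, hom_form3 X a b c d | hom_form4 X a b c d].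
Proof.
move=> hg gc gd ga gb inv.
have [h hh [hE ha]] := fr_ext hF hg inv ga.
have exM := fr_exM hF; have hKM := fr_KM hF; have [sKM cKM] := hKM; have sK := subsetP sKM.
have [Ma Mb Mc2 Md] := And4 (ex_a exM) (ex_b exM) (ex_c exM) (ex_d exM).
have Mc : c \notin fr_M hF by rewrite fr_ME; case: hF => _ _ [_ [-> _ _ _]] _; rewrite andbF.
have hc2 : h (c ^+ 2) = false by rewrite hE.
case c4: (4 %| #[c]); last first.
  constructor 3; exists (fr_M hF); first exact: fr_MX.
  split; rewrite ?Dh_sub ?Ma //; left; split; first by rewrite c4.
  by exists h => //; rewrite ha !hE.
have hgc := hom2_conj nc hg.
have [c1 c2] := fr_vals hFC hg; rewrite gc gd in c1 c2.
case: (hom2_inv_dec K g c) => [invc|[y Ky gy]]; last first.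
  have inva : {in K, forall x, g ((x ^ a) ^ c) = g (x ^ c)}.
    by move=> x Kx; rewrite (fr_comm hF hg) // inv // memJ_norm.
  have [_ e] := fr_vals hF hgc; rewrite (inva _ Kb) in e.
  have p : g ((a ^+ 2) ^ c) = false by move: e; case: (g (b ^ c)); case: (g _).
  have [q|/negbTE q] := boolP (g (b ^ c)); last first.
    by case/eqP: gy; apply: (fr_eq hF hgc hg); rewrite ?p ?q ?c1 ?c2 ?ga ?gb ?gc ?gd.
  constructor 2; apply: (@fr_hom_form3 _ _ _ _ _ _ _ _ _ hFC (fun x => g (x ^ c) (+) g x)).
  - exact: hom2D.
  - by move=> x Kx; rewrite /= (fr_aa hFC hg) // addbC.
  - by rewrite c1 gc.
  - by rewrite c2 gd.
  - by rewrite p ga.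
  - by rewrite q gb.
have hMX := fr_MX hF; have ncM : c \in 'N(fr_M hF) := subsetP (normal_norm (half_norm hMX)) _ (ex_c hX).
case hac: (h (a ^ c)); last first.
  have hhc := hom2_conj ncM hh.
  have invh : {in fr_M hF, forall x, h (x ^ c) = h x}.
    by apply: (ex_eq exM hhc hh); rewrite ?ha ?hac // !hE ?invc // memJ_norm.
  have [f hf [fE fc]] := hom2_ext hMX (ex_c hX) Mc hh invh hc2.
  by constructor 1; exists f => //; rewrite fc !fE // ha !hE.
constructor 2; pose L := hker hg; have hLK : index2 L K := hker_half hg Kd gd; have [sLK cLK] := hLK.
have LE x : (x \in L) = (x \in K) && ~~ g x by apply: hkerE.
have La2 : a ^+ 2 \in L by rewrite LE Ka2 ga.
have Lb : b \in L by rewrite LE Kb gb.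
have Lc2 : c ^+ 2 \in L by rewrite LE Kc2 gc.
have Ld : d \notin L by rewrite LE gd andbF.
have nL : X \subset 'N(L).
  have nKx x : x \in X -> x \in 'N(K) := subsetP nK x.
  apply: (ex_normX hX); apply: hker_norm => //.
  - exact: nKx (ex_b hX).
  - by move=> x Kx; apply: (hom2J hg).
  - exact: nKx (ex_d hX).
  - by move=> x Kx; apply: (hom2J hg).
have sLX : L \subset X := subset_trans sLK (fr_sub hF).
have sMX : fr_M hF \subset X by case: hMX.
have oc : (#[c ^+ 2] * 2 = #[c])%N.
  by case: hF => _ _ [hde [de_c _ _ _]] _; apply: (ev_order hde (ex_c hX) de_c).
pose D := Dh (a ^+ 2) b; have sDL : D \subset L by rewrite Dh_sub La2.
have iLD : #|L : D| = #[c ^+ 2].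
  have := Lagrange sDL; have := ex_card4 hK; rewrite -cLK (card_Dh (dihp_pow 2 dab)) => e1 e2.
  apply/eqP; rewrite -(@eqn_pmul2l (#[a ^+ 2] * 2 * 2)) ?muln_gt0 ?order_gt0 //.
  by rewrite mulnAC e2 e1; apply/eqP; clear; lia.
have hs := @sgX_hom2 gT D L.
(* c^2 permutes the cosets of D in a single cycle, whose length [#[c ^+ 2]] is even because 4
   divides [#[c]]. *)
have sc : sgX D L (c ^+ 2).
  rewrite (sgX_semireg sDL Lc2); last first.
    move=> y Ly; apply/trivgP; rewrite /= -(ex_conj (exactC hX) (subsetP sLX _ Ly)).
    apply: setISS; first by rewrite cycle_subG groupX ?Dh_l.
    by rewrite conjSg Dh_pow_sub.
  rewrite iLD divnn order_gt0 addn1 /=; move: c4; rewrite -oc.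
  by rewrite -[4]/(2 * 2)%N dvdn_pmul2r // dvdn2.
have fL : fixes L L (sgX D L) by move=> q x Lq Lx; apply: (hom2J hs).
have nt0 : exists2 x, x \in L & sgX D L x by exists (c ^+ 2).
(* L, [K], [fr_M hF] and [X] form a chain with steps of index 2, so invariance is gained one step at
   a time. *)
have [v1 hv1 [nt1 f1]] := fixes_step hLK (subset_trans (fr_sub hF) nL) hs nt0 fL.
have [v2 hv2 [nt2 f2]] := fixes_step hKM (subset_trans sMX nL) hv1 nt1 f1.
have [v hv [[x0 Lx0 vx0] fv]] := fixes_step hMX nL hv2 nt2 f2.
have va : v (a ^+ 2) = false.
  have := fv a b (ex_a hX) Lb; rewrite (refl_J dab) hv //.
  by case: (v b); case: (v _).
(* c^2 is conjugate to (c^a)^2, and c^a is an involution c * d times an element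
   of L, so v kills its square. *)
have vc : v (c ^+ 2) = false.
  have Kk : [~ a, c] \in K.
    rewrite -[K : {set gT}]/(gval K) (fr_KE hF) hkerE commgEl groupM ?groupV ?memJ_norm //=.
    case: hF => _ [hbe _] _ _; have Xa := ex_a hX; have Xc := ex_c hX.
    by rewrite hbe ?groupV ?groupJ // (hom2V hbe) // (hom2J hbe) // addbb.
  have gk : g [~ a, c] by rewrite -hE // commgEl hh ?groupV ?memJ_norm // (hom2V hh) // ha.
  pose l := d * [~ c, a].
  have Ll : l \in L.
    by rewrite LE /l -invg_comm groupM ?groupV //= hg ?groupV // (hom2V hg) // gd gk.
  have Xcd : c * d \in X by rewrite groupM ?(ex_c hX) ?(ex_d hX).
  have caE : c ^ a = c * d * l.
    by have [_ d2 _] := dcd; rewrite conjg_mulR /l !mulgA -(mulgA c d d) -expg2 d2 mulg1.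
  have cd2 : (c * d) ^+ 2 = 1 by have := dihp_refl 1 dcd; rewrite expg1 => -[].
  have cdV : (c * d)^-1 = c * d by apply/eqP; rewrite eq_invg_mul -expg2 cd2.
  rewrite -(fv a _ (ex_a hX) Lc2) conjXg caE.
  have -> : (c * d * l) ^+ 2 = l ^ (c * d) * l by rewrite expg2 conjgE cdV !mulgA.
  have Llc : l ^ (c * d) \in L by rewrite memJ_norm // (subsetP nL).
  by rewrite hv // fv // addbb.
(* An element of L is a product of powers of a^2, [b] and c^2; since v is nonzero and kills a^2 and
   c^2, it cannot kill [b]. *)
have vb : v b.
  apply/negbNE/negP=> /negbTE vb; have Kx0 := subsetP sLK _ Lx0.
  have : x0 \in Dh (a ^+ 2) b * Dh (c ^+ 2) d by case: hK => _ _ ->.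
  case/mulsgP=> y z Dy Dz x0E; have Ly := subsetP sDL y Dy.
  have Lz : z \in L by rewrite -(groupMl _ Ly) -x0E.
  have vy : v y = false.
    case: (DhP (dihp_pow 2 dab) Dy) => -[i ->]; first by rewrite (hom2X _ hv) // va andbF.
    by rewrite (hv _ _ (groupX i La2) Lb) vb (hom2X _ hv) // va andbF.
  have vz : v z = false.
    case: (DhP (dihp_pow 2 dcd) Dz) => -[i zE]; first by rewrite zE (hom2X _ hv) // vc andbF.
    by move: Lz; rewrite zE (groupMl _ (groupX i Lc2)) (negbTE Ld).
  by rewrite x0E hv // vy vz in vx0.
have vd2 : v (d ^+ 2) = false by case: dcd => _ -> _; apply: hom2_1 hv.
have vdinv : {in L, forall x, v (x ^ d) = v x} by move=> x; apply: fv; apply: ex_d hX.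
have [w hw [wE wd]] := hom2_ext hLK Kd Ld hv vdinv vd2.
have [wa wb wc] : [/\ w (a ^+ 2) = v (a ^+ 2), w b = v b & w (c ^+ 2) = v (c ^+ 2)].
  by split; apply: wE.
have Lj x : x \in L -> w (x ^ c) = w x.
  by move=> Lx; rewrite !wE ?fv ?(ex_c hX) // memJ_norm // (subsetP nL) ?(ex_c hX).
apply: (fr_hom_form3 hFC hw); rewrite ?wa ?wb ?wc ?va ?vb ?vc //.
apply: (fr_eq hF (hom2_conj nc hw) hw); [exact: Lj | exact: Lj | exact: Lj |].
by have [_ ->] := fr_vals hFC hw; rewrite wc vc addbF.
Qed.

End Frame.
End Steps.

(** * From homomorphisms to the four forms *)

Section Main.
Variable gT : finGroupType.
Implicit Types (a b c d x y : gT) (K L M N X Y : {group gT}) (f u v : gT -> bool).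

(** Choosing reflections b' and d' killed by be and de makes [K] the exact product of <a^2, b'> and
    <c^2, d'>. A homomorphism killing [a] takes the same value at [b] and b', and similarly for [d],
    so a changed reflection remains only where the homomorphism is not defined at the rotation
    itself. *)
Lemma exact_cases X a b c d : exact X a b c d ->
  [\/ refl_hom X a b c d, refl_hom X c d a b, (exists i, hom_form3 X a (a ^+ i * b) c d)
    | exists j, hom_form4 X a b c (c ^+ j * d)].
Proof.
move=> hX; have [dab dcd] := (ex_dab hX, ex_dcd hX); have hXC := exactC hX.
have [Xa Xb Xc Xd] := And4 (ex_a hX) (ex_b hX) (ex_c hX) (ex_d hX).
case: (refl_hom_or_trivial hX) => [t|[de hde [de_a de_b de_cd]]]; first by constructor 1.
case de_c: (de c); last by constructor 2; exists de => //; rewrite de_c in de_cd.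
case: (refl_hom_or_trivial hXC) => [t|[be hbe [be_c be_d be_ab]]]; first by constructor 2.
case be_a: (be a); last by constructor 1; exists be => //; rewrite be_a in be_ab.
have refl f x y : hom2 X f -> x \in X -> y \in X -> f x -> exists i, f (x ^+ i * y) = false.
  move=> hf Xx Xy fx; case fy: (f y); last by exists 0; rewrite mul1g.
  by exists 1%N; rewrite expg1 hf // fx fy.
have [i be_b'] := refl be a b hbe Xa Xb be_a.
have [j de_d'] := refl de c d hde Xc Xd de_c.
set b' := a ^+ i * b in be_b'; set d' := c ^+ j * d in de_d'.
have hX' : exact X a b' c d' by apply/exact_reflR/exact_reflL.
have dc i' : (c ^+ i' * d' = c ^+ (i' + j) * d) by rewrite /d' mulgA expgD.
have DG : Dh a b' = Dh a b := Dh_reflE i dab.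
have DH : Dh c d' = Dh c d := Dh_reflE j dcd.
have de_b' : de b' = false by rewrite /b' hde ?groupX // (hom2X _ hde) // de_a de_b andbF.
have be_d' : be d' = false by rewrite /d' hbe ?groupX // (hom2X _ hbe) // be_c be_d andbF.
pose K := hker (hom2S (hker_sub hbe) hde).
have hF : frame X K a b' c d' be de by split=> // x; rewrite !hkerE andbA.
have hFC := frameC hF.
suff: [\/ refl_hom X c d' a b', hom_form3 X a b' c d' | exists j', hom_form4 X a b' c (c ^+ j' * d')].
  case=> [[f hf [fc fd fa fb]]|[M hM [aM bM sH [f hf [fa fb fc fd]]]]|[j' [N hN [cN sG dN alt]]]].
  - constructor 2; exists f => //; split=> //.
    + by move: fd; rewrite /d' hf ?groupX // (hom2X _ hf) // fc andbF.
    + by move: fb; rewrite /b' hf ?groupX // (hom2X _ hf) // fa andbF.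
  - constructor 3; exists i, M => //; rewrite DH in sH; split=> //.
    have [Mc Md] : c \in M /\ d \in M by apply/andP; rewrite -Dh_sub.
    exists f => //; split=> //.
    by move: fd; rewrite /d' hf ?groupX // (hom2X _ hf) // fc andbF.
  - have tl M x y : Dh a b \subset M -> refl_hom M x y a b' -> refl_hom M x y a b.
      rewrite Dh_sub => /andP[Ma Mb] [f hf [fx fy fa fb]]; exists f => //; split=> //.
      by move: fb; rewrite /b' hf ?groupX // (hom2X _ hf) // fa andbF.
    constructor 4; exists (j' + j)%N, N => //; rewrite -dc; rewrite DG in sG; split=> //.
    case: alt => [[c4 t]|[M hM [cM sGM dM t]]]; [left|right]; first by split=> //; apply: tl.
    by exists M => //; rewrite DG in sGM; split=> //; apply: tl.
pose goal := [\/ refl_hom X c d' a b', hom_form3 X a b' c d' | exists j', hom_form4 X a b' c (c ^+ j' * d')].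
have gam : refl_hom K (c ^+ 2) d' (a ^+ 2) b' -> goal.
  move=> t; case: (fr_stepC2 hF t) => [[f hf [[fc fd fa fb] inv]]|]; last by constructor 3.
  case: (fr_stepD hF hf fc fd fa fb inv) => h; [by constructor 1 | by constructor 2 |].
  by constructor 3; exists 0; rewrite mul1g.
suff: refl_hom K (a ^+ 2) b' (c ^+ 2) d' \/ refl_hom K (c ^+ 2) d' (a ^+ 2) b'.
  case=> t; last exact: gam.
  by case: (fr_stepC1 hF t) => [h|/gam //]; constructor 2.
have hK := fr_ex hF; have [K' hK' sub] := exact_index2_over hK.
pose u x := x \notin K'; have hu : hom2 K u := half_hom2 hK'.
have ntu : ~ [/\ a ^+ 2 \in K', b' \in K', c ^+ 2 \in K' & d' \in K'].
  case=> ua ub uc ud; have [sK cK] := hK'.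
  have : K \subset K'.
    rewrite -[K \subset K']/((K : {set gT}) \subset K'); case: hK => _ _ <- _.
    by rewrite mul_subG // Dh_sub ?ua ?uc.
  by move/subset_leq_card; rewrite -cK; have := cardG_gt0 K'; clear; lia.
case/orP: sub; rewrite Dh_sub => /andP[k1 k2].
  have ua : u (a ^+ 2) = false by rewrite /u k1.
  have ub : u b' = false by rewrite /u k2.
  have ucd : u (c ^+ 2) || u d'.
    by rewrite /u -negb_and; apply/negP=> /andP[? ?]; apply: ntu.
  right; have [//|[e he [[e1 e2 e3 e4] [ia ic]]]] := fr_stepB_half hF hu ua ub ucd.
  exact: (fr_stepB_eps hF he e1 e2 e3 e4 ia ic).
have uc : u (c ^+ 2) = false by rewrite /u k1.
have ud : u d' = false by rewrite /u k2.
have uab : u (a ^+ 2) || u b'.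
  by rewrite /u -negb_and; apply/negP=> /andP[? ?]; apply: ntu.
have [h|[e he [[e1 e2 e3 e4] [ic ia]]]] := fr_stepB_half hFC hu uc ud uab; first by left.
by right; apply: (fr_stepB_eps hF he e3 e4 e1 e2 ia ic).
Qed.

(** The order 2 n of the group keeps [b] out of [<[a]>], which has at most n elements. *)
Lemma dihedral_dihp n a b : dihedral_gens n a b -> dihp a b.
Proof.
case=> n2 iso an b2 ab; split=> //; apply/negP=> Ab.
have : #|<<[set a; b]>>| <= n.
  apply: leq_trans (_ : #|<[a]>| <= n).
    by apply: subset_leq_card; rewrite gen_subG subUset !sub1set cycle_id.
  by rewrite -orderE dvdn_leq ?(ltnW n2) // order_dvdn an.
rewrite mul2n in iso; rewrite (card_isog iso) card_dihedral //; move: n2; clear; lia.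
Qed.

Lemma bidihedral_exact X n m a b c d : exact_bidihedral X n m a b c d -> exact X a b c d.
Proof.
case=> /dihedral_dihp dab /dihedral_dihp dcd E I; split=> //; rewrite !Dh_unlock //.
Qed.

Lemma half_sdprod L M x : index2 L M -> x \in M -> x \notin L -> x ^+ 2 = 1 -> L ><| <[x]> = M.
Proof.
move=> hL Mx Lx x2; have [sL cL] := hL.
have ox : #[x] = 2.
  by apply: nt_prime_order => //; apply: contraNneq Lx => ->.
have nx : <[x]> \subset 'N(L).
  by rewrite cycle_subG (subsetP (normal_norm (half_norm hL))).
have ti : L :&: <[x]> = 1.
  apply/trivgP; rewrite /= (cycle2g ox); apply/subsetP=> y; rewrite !inE.
  by case/andP=> Ly /orP[] // /eqP yx; rewrite -yx Ly in Lx.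
rewrite sdprodE //; apply/eqP; rewrite eqEcard mul_subG ?cycle_subG //=.
by rewrite TI_cardMg // -cL -orderE ox.
Qed.

Lemma half_dot M X x : index2 M X -> x \in X -> x \notin M -> dot_product M <[x]>%G X.
Proof.
move=> hM Xx Mx; have [sM cM] := hM; have nM := half_norm hM.
(* Exponent 0 satisfies the definition; as [M] has index 2, exponent 2 would do as well. *)
split=> //; last by move=> h _; exists 0; rewrite expg0 group1.
have nx : <[x]> \subset 'N(M) by rewrite cycle_subG (subsetP (normal_norm nM)).
have x2 : x ^+ 2 \in M by rewrite expg2; apply: (half_notin hM).
have [_ c2] := half_adjoin (subsetP nx _ (cycle_id x)) Mx x2.
apply/eqP; rewrite -norm_joinEr // eqEcard join_subG sM cycle_subG Xx /=.
by rewrite -cM -c2.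
Qed.

(** Identifies the kernels with the products displayed in the forms: the two factors meet trivially,
    so comparing orders suffices. *)
Lemma factor_cyc X L a b c d : exact X a b c d -> L \subset X -> Dh a b \subset L ->
  forall s, c ^+ s \in L -> #|L| = (#|Dh a b| * #[c ^+ s])%N ->
  <<[set a; b]>> * <[c ^+ s]> = L.
Proof.
move=> hX sLX sGL s Lc cL; have -> : <<[set a; b]>> = Dh a b by rewrite Dh_unlock.
apply/eqP; rewrite eqEcard mul_subG ?cycle_subG //= TI_cardMg -?orderE ?cL //.
apply/trivgP; have [_ _ _ <-] := hX; apply: setIS; rewrite cycle_subG groupX //.
exact: Dh_l.
Qed.

Lemma refl_hom_form1 X a b c d : exact X a b c d -> refl_hom X a b c d -> form1 X a b c d.
Proof.
move=> hX [f hf [fa fb fc fd]]; have [Xa Xb Xc Xd] := And4 (ex_a hX) (ex_b hX) (ex_c hX) (ex_d hX).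
have hL := hker_half hf Xb fb; have [sL cL] := hL.
rewrite /form1; have -> : <<[set c; d]>> * <[a]> = hker hf.
  rewrite -{1}[a]expg1; apply: (factor_cyc (exactC hX) sL); rewrite ?Dh_sub ?hkerE ?Xa ?Xc ?Xd ?fa ?fc ?fd //.
  rewrite expg1; apply/eqP; rewrite -(eqn_pmul2r (isT : 0 < 2)) cL (ex_card4 hX).
  by rewrite (card_Dh (ex_dcd hX)); apply/eqP; clear; lia.
apply: half_sdprod => //; first by rewrite hkerE fb andbF.
by case: (ex_dab hX).
Qed.

Lemma index2_ev M X x : index2 M X -> x \in X -> x \notin M -> (#[x ^+ 2] * 2 = #[x])%N.
Proof. by move=> hM Xx Mx; apply: (ev_order (half_hom2 hM) Xx Mx). Qed.

Lemma hom_form3P X a b c d : exact X a b c d -> hom_form3 X a b c d -> form3 X a b c d.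
Proof.
move=> hX [M hM [aM bM sH [f hf [fa fb fc fd]]]]; exists M; last exact: half_dot (ex_a hX) aM.
have Ma2 : a ^+ 2 \in M by rewrite expg2; apply: (half_notin hM); rewrite ?(ex_a hX).
have [Mc Md] : c \in M /\ d \in M by apply/andP; rewrite -Dh_sub.
have hL := hker_half hf bM fb; have [sL cL] := hL; have [sM cM] := hM.
have -> : <<[set c; d]>> * <[a ^+ 2]> = hker hf.
  apply: (factor_cyc (exactC hX) (subset_trans sL sM)); rewrite ?Dh_sub ?hkerE ?Ma2 ?Mc ?Md ?fa ?fc ?fd //.
  apply/eqP; rewrite -(eqn_pmul2r (isT : 0 < 4)) -[4]/(2 * 2)%N [eqbLHS]mulnA cL cM (ex_card4 hX).
  by rewrite (card_Dh (ex_dcd hX)) -(index2_ev hM (ex_a hX) aM); apply/eqP; clear; lia.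
apply: half_sdprod => //; first by rewrite hkerE fb andbF.
by case: (ex_dab hX).
Qed.

Lemma hom_form4P X a b c d : exact X a b c d -> hom_form4 X a b c d -> form4 X a b c d.
Proof.
move=> hX [N hN [cN sG dN alt]]; have dcd := ex_dcd hX; have d2 : d ^+ 2 = 1 by case: dcd.
have Nc2 : c ^+ 2 \in N by rewrite expg2; apply: (half_notin hN); rewrite ?(ex_c hX).
have dotX := half_dot hN (ex_c hX) cN; have oc := index2_ev hN (ex_c hX) cN.
have c4E : c ^+ 4 = (c ^+ 2) ^+ 2 by rewrite -expgM.
have [Na Nb] : a \in N /\ b \in N by apply/andP; rewrite -Dh_sub.
have [sN cN'] := hN; have cX := ex_card4 hX; have cG := card_Dh (ex_dab hX).
case: alt => [[c4 [f hf [fc fd fa fb]]]|[M hM [cM sGM dM [f hf [fc fd fa fb]]]]].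
  exists N, N; split=> //; last first.
    split=> //; last by move=> h _; exists 0; rewrite expg0 group1.
    by apply/eqP; rewrite eqEsubset mulG_subl mul_subG // cycle_subG.
  have hL := hker_half hf dN fd; have [sL cL] := hL.
  have o4 : #[c ^+ 4] = #[c ^+ 2].
    rewrite c4E orderXgcd; have -> : gcdn #[c ^+ 2] 2 = 1%N; last by rewrite divn1.
    apply/eqP; rewrite -/(coprime _ _) coprimen2; apply: contraR c4 => ev.
    by rewrite -oc -[4]/(2 * 2)%N dvdn_pmul2r // dvdn2.
  have -> : <<[set a; b]>> * <[c ^+ 4]> = hker hf.
    apply: (factor_cyc hX (subset_trans sL sN)); rewrite ?Dh_sub ?hkerE ?Na ?Nb ?fa ?fb //.
      by rewrite c4E groupX // (hom2X _ hf) // fc.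
    apply/eqP; rewrite -(eqn_pmul2r (isT : 0 < 4)) -[4]/(2 * 2)%N [eqbLHS]mulnA cL cN' cX.
    by rewrite cG o4 -oc; apply/eqP; clear; lia.
  by apply: half_sdprod => //; rewrite hkerE fd andbF.
have [Ma Mb] : a \in M /\ b \in M by apply/andP; rewrite -Dh_sub.
exists M, N; split=> //; last exact: half_dot.
have hL := hker_half hf dM fd; have [sL cL] := hL; have [sM cM'] := hM.
have oc2 := index2_ev hM Nc2 cM.
have Mc4 : c ^+ 4 \in M by rewrite c4E expg2; apply: (half_notin hM).
have -> : <<[set a; b]>> * <[c ^+ 4]> = hker hf.
  apply: (factor_cyc hX (subset_trans sL (subset_trans sM sN))); rewrite ?Dh_sub ?hkerE ?Ma ?Mb ?Mc4 ?fa ?fb ?fc //.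
  apply/eqP; rewrite -(eqn_pmul2r (isT : 0 < 8)) -[8]/(2 * 2 * 2)%N -(mulnA 2) 2![eqbLHS]mulnA cL cM' cN' cX.
  by rewrite cG -oc -oc2 c4E; apply/eqP; clear; lia.
by apply: half_sdprod => //; rewrite hkerE fd andbF.
Qed.

End Main.

Theorem theorem1p2 (gT : finGroupType) (X : {group gT}) (n m : nat)
    (a b c d : gT) (hX : exact_bidihedral X n m a b c d) :
  [\/ form1 X a b c d,
      form2 X a b c d,
      (exists i : nat, form3 X a (a ^+ i * b) c d)
    | (exists j : nat, form4 X a b c (c ^+ j * d))].
Proof.
have eX := bidihedral_exact hX.
case: (exact_cases eX) => [t|t|[i t]|[j t]].
- by constructor 1; apply: refl_hom_form1.
- by constructor 2; apply: (refl_hom_form1 (exactC eX)).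
- by constructor 3; exists i; apply: hom_form3P t; apply: exact_reflL.
- by constructor 4; exists j; apply: hom_form4P t; apply: exact_reflR.
Qed.
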